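(* For every $k\in\mathbb N$ one has $H^{2k,0}(\mathcal D_e)\neq 0$, where $H^{k,m}(\mathcal D_e)$ denotes the cohomology of the even-type graph complex $(\mathcal D_e^{k,m},\delta_e)$ in order $k$ and degree $m$.
   Context: **Graphs on the circle.** A graph consists of an oriented circle and finitely many edges joining vertices. Vertices on the circle are called external, vertices off the circle are called internal. The whole object (circle included) is connected, every internal vertex has valence at least 3, and every external vertex is an endpoint of at least one edge. Edges are not pieces of the circle; an edge may join an external vertex to itself. An arc is a piece of the circle between two consecutive external vertices; a regular edge is an edge with at least one internal endpoint. Let $e,v_i,v_e$ be the numbers of edges, internal and external vertices. The order is $k=e-v_i$ and the degree is $m=2e-v_e-3v_i$. **The space.** $\mathcal D_e^{k,m}$ is the real vector space generated by graphs of order $k$ and degree $m$ (up to isomorphism preserving the oriented circle) decorated by a numbering of the external vertices and a numbering of the edges, modulo the relations: a permutation of the external vertex labels, or of the edge labels, multiplies the graph by the sign of the permutation; graphs with two edges joining the same pair of vertices, and graphs with an edge whose endpoints are the same internal vertex, are zero. **Coboundary.** $\delta_e\colon\mathcal D_e^{k,m}\to\mathcal D_e^{k,m+1}$ sends $\Gamma$ to the signed sum of the graphs obtained by contracting, one at a time, all regular edges and all arcs of $\Gamma$. Contracting an arc oriented (by the circle) from vertex $i$ to vertex $j$ has sign $(-1)^j$ if $j>i$ and $(-1)^{i+1}$ if $j<i$; contracting the regular edge labelled $\alpha$ has sign $(-1)^{\alpha+1+v_e}$, with $v_e$ the number of external vertices of $\Gamma$. When external vertices $i,j$ are identified the new vertex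 is labelled $\min(i,j)$ and labels greater than $\max(i,j)$ decrease by one; when edge $\alpha$ is contracted edge labels greater than $\alpha$ decrease by one (contracting an edge joining an external to an internal vertex yields an external vertex with the same label). *)

(* Defs.v *)
From HB Require Import structures.
From mathcomp.multinomials Require Import freeg.
From mathcomp Require Import all_boot all_order fingroup perm all_algebra.
From mathcomp Require Import zify.
From mathcomp Require Import boolp reals.

Set Implicit Arguments.
Unset Strict Implicit.
Unset Printing Implicit Defensive.

Import Order.TTheory GRing.Theory Num.Theory.

Local Open Scope ring_scope.
Local Open Scope quotient_scope.

Section QuotientModule.
Variables (R : pzRingType) (V : lmodType R) (I : submodClosed V).

(* [submodClosed] does not inherit from [zmodClosed], which [Quotient.quot]
   requires. *)
Definition submodule : {pred V} := I.

Lemma submodule_zmod_closed : zmod_closed submodule.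
Proof.
split=> [|u v Iu Iv]; first exact: rpred0.
by rewrite -scaleN1r; apply: rpredD => //; apply: rpredZ.
Qed.

HB.instance Definition _ := GRing.isZmodClosed.Build V submodule
  submodule_zmod_closed.

Definition quot_mod := Quotient.quot submodule.
HB.instance Definition _ := GRing.Zmodule.on quot_mod.
HB.instance Definition _ := ZmodQuotient.on quot_mod.

Local Notation Q := quot_mod.

Lemma pi_quot_eq (u v : V) : (\pi_Q u == \pi_Q v) = (u - v \in I).
Proof. exact/esym/(Quotient.idealrBE submodule). Qed.

Definition quot_scale (a : R) : Q -> Q :=
  lift_op1 Q ( *:%R a).

Lemma pi_quot_scale a : {morph \pi_Q : x / a *: x >-> quot_scale a x}.
Proof.
move=> x; unlock quot_scale; apply/eqP.
by rewrite pi_quot_eq -scalerBr rpredZ // -pi_quot_eq reprK.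
Qed.

Lemma quot_scaleA a b v : quot_scale a (quot_scale b v) = quot_scale (a * b) v.
Proof. by rewrite -[v]reprK -!pi_quot_scale scalerA. Qed.

Lemma quot_scale1 : left_id 1 quot_scale.
Proof. by move=> v; rewrite -[v]reprK -pi_quot_scale scale1r. Qed.

Lemma quot_scaleDr : right_distributive quot_scale +%R.
Proof.
move=> a u v; rewrite -[u]reprK -[v]reprK.
by rewrite -raddfD -!pi_quot_scale -raddfD scalerDr.
Qed.

Lemma quot_scaleDl v : {morph quot_scale^~ v : a b / a + b}.
Proof.
by move=> a b; rewrite -[v]reprK -!pi_quot_scale -raddfD scalerDl.
Qed.

HB.instance Definition _ := GRing.Zmodule_isLmodule.Build R Q
  quot_scaleA quot_scale1 quot_scaleDr quot_scaleDl.

Lemma pi_quot_scalable : scalable (\pi_Q : V -> Q).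
Proof. by move=> a x; rewrite pi_quot_scale. Qed.

Lemma pi_quot_eq0 (v : V) : (\pi_Q v == 0) = (v \in I).
Proof. by rewrite -[0](raddf0 (\pi_Q)) pi_quot_eq subr0. Qed.

End QuotientModule.

(* External vertices are on the left, internal vertices on the right. *)
Definition vertex (n p : nat) : Type := ('I_n + 'I_p)%type.
HB.instance Definition _ n p := Finite.on (vertex n p).

(* The first component lists the external vertices in the cyclic order in
   which they are met along the oriented circle, starting from an arbitrary
   one. The second component gives the two ends of each edge; the order of the
   two ends is irrelevant. An ordinal [i] stands for the label [i.+1]. The
   numbering of the internal vertices is not part of the decoration: it is
   forgotten by [isomorphic] below. *)
Definition labelled (n p q : nat) : Type :=
  (seq 'I_n * {ffun 'I_q -> vertex n p * vertex n p})%type.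
HB.instance Definition _ n p q := Choice.on (labelled n p q).

Section Labelled.
Variables n p q : nat.
Implicit Type x : labelled n p q.

Definition circle x : seq 'I_n := x.1.
Definition ends x : {ffun 'I_q -> vertex n p * vertex n p} := x.2.

(* A small loop counts twice. *)
Definition valence x (v : vertex n p) : nat :=
  (\sum_(a < q) (((ends x a).1 == v) + ((ends x a).2 == v)))%N.

Definition adjacent x : rel (vertex n p) := fun v w =>
  [exists a, (ends x a == (v, w)) || (ends x a == (w, v))].

(* All external vertices lie on the circle, so the whole object is connected
   as soon as every internal vertex is joined by edges to an external one. *)
Definition connected_to_circle x : bool :=
  [forall v : 'I_p, exists w : 'I_n, connect (adjacent x) (inr v) (inl w)].

Definition is_graph x : bool :=
  [&& perm_eq (circle x) (enum 'I_n),
      [forall v : 'I_p, 3 <= valence x (inr v)],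
      [forall w : 'I_n, 1 <= valence x (inl w)]
    & connected_to_circle x]%N.

Definition same_pair (e f : vertex n p * vertex n p) : bool :=
  (f == e) || (f == (e.2, e.1)).

Definition has_multiple_edge x : bool :=
  [exists a, exists b, (a != b) && same_pair (ends x a) (ends x b)].

Definition has_internal_loop x : bool :=
  [exists a, exists v : 'I_p, ends x a == (inr v, inr v)].

Definition map_vertex n' p' (f : vertex n p -> vertex n' p')
    (e : vertex n p * vertex n p) : vertex n' p' * vertex n' p' :=
  (f e.1, f e.2).

Definition renumber_int (s : 'S_p) (v : vertex n p) : vertex n p :=
  match v with inl w => inl w | inr u => inr (s u) end.

Definition renumber_ext (s : 'S_n) (v : vertex n p) : vertex n p :=
  match v with inl w => inl (s w) | inr u => inr u end.

(* Isomorphism of graphs preserving the oriented circle and the labels of the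
   external vertices and of the edges. *)
Definition isomorphic x y : Prop :=
  (exists r : nat, circle y = rot r (circle x)) /\
  (exists s : 'S_p, forall a,
     same_pair (map_vertex (renumber_int s) (ends x a)) (ends y a)).

Definition relabel_ext (s : 'S_n) x : labelled n p q :=
  ([seq s w | w <- circle x],
   [ffun a => map_vertex (renumber_ext s) (ends x a)]).

(* The edge labelled [s a] in [x] is labelled [a] in [relabel_edges s x]. *)
Definition relabel_edges (s : 'S_q) x : labelled n p q :=
  (circle x, [ffun a => ends x (s a)]).

End Labelled.

Definition shape : Type := (nat * nat * nat)%type.
HB.instance Definition _ := Choice.on shape.

Record graph := Graph {
  graph_val : {s : shape & labelled s.1.1 s.1.2 s.2};
  _ : is_graph (tagged graph_val)
}.
HB.instance Definition _ := [isSub for graph_val].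
HB.instance Definition _ := [Choice of graph by <:].

Definition n_ext (g : graph) : nat := (tag (graph_val g)).1.1.
Definition n_int (g : graph) : nat := (tag (graph_val g)).1.2.
Definition n_edges (g : graph) : nat := (tag (graph_val g)).2.
Definition drawing (g : graph) : labelled (n_ext g) (n_int g) (n_edges g) :=
  tagged (graph_val g).

Definition order_of (g : graph) : int := (n_edges g)%:Z - (n_int g)%:Z.
Definition degree_of (g : graph) : int :=
  2 * (n_edges g)%:Z - (n_ext g)%:Z - 3 * (n_int g)%:Z.

(* Identifies the external vertices [h] and [lift h l]. When [h] is the greater
   of the two, the common label is the smaller one and the labels greater than
   [h] decrease by one. *)
Definition merge_ext n p (h : 'I_n.+1) (l : 'I_n) (v : vertex n.+1 p) :
    vertex n p :=
  match v with inl w => inl (odflt l (unlift h w)) | inr u => inr u end.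

Definition contract_arc n p q (h : 'I_n.+1) (l : 'I_n)
    (x : labelled n.+1 p q) : labelled n p q :=
  (pmap (unlift h) (circle x),
   [ffun a => map_vertex (merge_ext h l) (ends x a)]).

(* Identifies the internal vertex [u] with [y]. *)
Definition merge_int n p (u : 'I_p.+1) (y : vertex n p) (v : vertex n p.+1) :
    vertex n p :=
  match v with
  | inl w => inl w
  | inr w => if unlift u w is Some w' then inr w' else y
  end.

(* For a regular edge which is not a small loop: an internal end to be removed,
   and the other end, numbered as in the contracted graph. *)
Definition merged_ends n p (e : vertex n p.+1 * vertex n p.+1) :
    option ('I_p.+1 * vertex n p) :=
  match e with
  | (inl _, inl _) => None
  | (inl w, inr u) | (inr u, inl w) => Some (u, inl w)
  | (inr u, inr v) => omap (fun v' => (u, inr v')) (unlift u v)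
  end.

Definition contract_edge n p q (a : 'I_q.+1) (u : 'I_p.+1) (y : vertex n p)
    (x : labelled n p.+1 q.+1) : labelled n p q :=
  (circle x, [ffun b => map_vertex (merge_int u y) (ends x (lift a b))]).

Lemma map_vertex_same_pair n p n' p' (f : vertex n p -> vertex n' p') e e' :
  same_pair e e' -> same_pair (map_vertex f e) (map_vertex f e').
Proof.
by case/orP=> /eqP ->; rewrite /same_pair /map_vertex /= eqxx ?orbT.
Qed.

Lemma connect_map (T U : finType) (e : rel T) (e' : rel U) (f : T -> U) :
  (forall v w, e v w -> connect e' (f v) (f w)) ->
  forall v w, connect e v w -> connect e' (f v) (f w).
Proof.
move=> sub v w /connectP[s + ->].
elim: s v => [|u s IH] v /=; first by rewrite connect0.
by case/andP=> /sub evu /IH; apply: connect_trans.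
Qed.

Lemma lift_ocancel n (h : 'I_n.+1) :
  ocancel (unlift h : 'I_n.+1 -> option 'I_n) (lift h).
Proof. by move=> w; case: unliftP. Qed.

Lemma perm_eq_unlift n (h : 'I_n.+1) (s : seq 'I_n.+1) :
  perm_eq s (enum 'I_n.+1) -> perm_eq (pmap (unlift h) s) (enum 'I_n).
Proof.
move=> s_enum; have s_uniq : uniq s by rewrite (perm_uniq s_enum) enum_uniq.
apply: uniq_perm; first exact: pmap_uniq (@lift_ocancel n h) _ s_uniq.
  exact: enum_uniq.
move=> w; rewrite (can2_mem_pmap (@lift_ocancel n h) (@liftK _ h)).
by rewrite (perm_mem s_enum) !mem_enum.
Qed.

Lemma leq_valence_map n p n' p' q (f : vertex n p -> vertex n' p')
    (x : labelled n p q) (y : labelled n' p' q) v :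
  (forall a, ends y a = map_vertex f (ends x a)) ->
  (valence x v <= valence y (f v))%N.
Proof.
move=> yE; apply: leq_sum => a _; rewrite yE /=.
by apply: leq_add; case: eqP => // ->; rewrite eqxx.
Qed.

Lemma is_graph_contract_arc n p q h l (x : labelled n.+1 p q) :
  is_graph x -> is_graph (contract_arc h l x).
Proof.
set y := contract_arc h l x.
have yE a : ends y a = map_vertex (merge_ext h l) (ends x a) by rewrite ffunE.
case/and4P=> circ /forallP val_int /forallP val_ext /forallP conn.
apply/and4P; split.
- exact: perm_eq_unlift.
- apply/forallP=> v.
  exact: leq_trans (val_int v) (leq_valence_map _ yE).
- apply/forallP=> w.
  apply: leq_trans (val_ext (lift h w)) _.
  by have := leq_valence_map (inl (lift h w)) yE; rewrite /= liftK.
- apply/forallP=> v; have /existsP[w cvw] := conn v.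
  apply/existsP; exists (odflt l (unlift h w)).
  apply: (connect_map (f := merge_ext h l)) cvw => {}v {}w /existsP[a].
  move=> evw; apply: connect1; apply/existsP; exists a; rewrite yE.
  by case/orP: evw => /eqP ->; rewrite eqxx ?orbT.
Qed.

Lemma valence_lift n p q (x : labelled n p q.+1) a v :
  valence x v = (((ends x a).1 == v) + ((ends x a).2 == v) +
    \sum_(b < q) (((ends x (lift a b)).1 == v) + ((ends x (lift a b)).2 == v)))%N.
Proof.
by rewrite /valence (bigD1_ord a).
Qed.

Section ContractEdge.
Variables (n p q : nat) (x : labelled n p.+1 q.+1) (a : 'I_q.+1).
Variables (u : 'I_p.+1) (y : vertex n p).
Hypothesis merged : merged_ends (ends x a) = Some (u, y).

Definition lift_int (v : vertex n p) : vertex n p.+1 :=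
  match v with inl w => inl w | inr w => inr (lift u w) end.

Lemma merge_lift_int v : merge_int u y (lift_int v) = v.
Proof. by case: v => //= w; rewrite liftK. Qed.

Lemma merged_endsE : same_pair (inr u, lift_int y) (ends x a).
Proof.
case: (ends x a) merged => [[w|v] [w'|v']] //=.
- by case=> -> <-; apply/orP; right.
- by case=> -> <-; apply/orP; left.
- case: unliftP => //= j -> [-> <-]; apply/orP; left; exact: eqxx.
Qed.

Lemma merge_ends : map_vertex (merge_int u y) (ends x a) = (y, y).
Proof.
by case/orP: merged_endsE => /eqP ->;
  rewrite /map_vertex /= unlift_none merge_lift_int.
Qed.

Lemma lift_int_neq v : (inr u == lift_int v) = false.
Proof.
by case: v => //= w; apply/negP=> /eqP[/eqP]; apply/negP; rewrite neq_lift.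
Qed.

Lemma lift_int_inj : injective lift_int.
Proof. by apply: (can_inj (g := merge_int u y)); apply: merge_lift_int. Qed.

Lemma valence_contract_edge v :
  (valence (contract_edge a u y x) v + (v == y).*2 =
   valence x (lift_int v) + (v == y) * valence x (inr u))%N.
Proof.
have merge_eq w : ((merge_int u y w == v) =
    (w == lift_int v) + (v == y) * (w == inr u) :> nat)%N.
  case: w => [w|w] /=.
    rewrite muln0 addn0; congr nat_of_bool.
    by case: v.
  case: unliftP => [w' ->|->].
    have -> : (inr (lift u w') == inr u :> vertex n p.+1) = false.
      by apply/negP=> /eqP[/eqP]; rewrite eq_sym (negPf (neq_lift _ _)).
    rewrite muln0 addn0; congr nat_of_bool; rewrite -(inj_eq lift_int_inj).
    by [].
  by rewrite lift_int_neq eqxx muln1 add0n eq_sym.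
rewrite !(valence_lift _ a) /valence.
have -> : (\sum_(b < q) (((ends (contract_edge a u y x) b).1 == v) +
    ((ends (contract_edge a u y x) b).2 == v)) =
  \sum_(b < q) (((ends x (lift a b)).1 == lift_int v) +
    ((ends x (lift a b)).2 == lift_int v)) +
  (v == y) * \sum_(b < q) (((ends x (lift a b)).1 == inr u) +
    ((ends x (lift a b)).2 == inr u)))%N.
  rewrite big_distrr -big_split; apply: eq_bigr => b _ /=.
  by rewrite ffunE /= !merge_eq mulnDr addnACA.
have ends_u : (((ends x a).1 == inr u) + ((ends x a).2 == inr u) = 1)%N.
  by case/orP: merged_endsE => /eqP -> /=; rewrite eqxx eq_sym lift_int_neq.
have ends_v : (((ends x a).1 == lift_int v) + ((ends x a).2 == lift_int v) =
    (v == y))%N.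
  by case/orP: merged_endsE => /eqP -> /=;
    rewrite lift_int_neq (inj_eq lift_int_inj) eq_sym ?addn0.
rewrite ends_u ends_v mulnDr muln1 -muln2.
move: (\sum_(b < q) _)%N (\sum_(b < q) _)%N => S1 S2.
by case: (v == y); lia.
Qed.

Lemma is_graph_contract_edge : is_graph x -> is_graph (contract_edge a u y x).
Proof.
case/and4P=> circ /forallP val_int /forallP val_ext /forallP conn.
apply/and4P; split=> //.
- apply/forallP=> v; have := valence_contract_edge (inr v).
  have := val_int (lift u v); have := val_int u; rewrite /= -muln2.
  by case: eqP => _ /=; lia.
- apply/forallP=> w; have := valence_contract_edge (inl w).
  have := val_ext w; have := val_int u; rewrite /= -muln2.
  by case: eqP => _ /=; lia.
- apply/forallP=> v; have /existsP[w cvw] := conn (lift u v).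
  apply/existsP; exists w.
  suff sub v1 v2 : adjacent x v1 v2 ->
      connect (adjacent (contract_edge a u y x)) (merge_int u y v1)
        (merge_int u y v2).
    by have := connect_map sub cvw; rewrite /= liftK.
  case/existsP=> b; have [->|a'b] := eqVneq b a.
    move: merge_ends; rewrite /map_vertex => -[E1 E2].
    by case/orP=> /eqP Eb; move: E1 E2; rewrite Eb /= => -> ->; exact: connect0.
  have [c bE] : exists c, b = lift a c.
    by case: (unliftP a b) a'b => [c ->|->]; [exists c | rewrite eqxx].
  move=> ex12; apply: connect1; apply/existsP; exists c.
  rewrite ffunE /map_vertex -bE.
  by case/orP: ex12 => /eqP -> /=; rewrite eqxx ?orbT.
Qed.
End ContractEdge.

Lemma map_vertex_comp n p n' p' n'' p'' (g : vertex n' p' -> vertex n'' p'')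
    (f : vertex n p -> vertex n' p') e :
  map_vertex g (map_vertex f e) = map_vertex (g \o f) e.
Proof. by []. Qed.

Lemma eq_map_vertex n p n' p' (f g : vertex n p -> vertex n' p') :
  f =1 g -> map_vertex f =1 map_vertex g.
Proof. by move=> fg e; rewrite /map_vertex !fg. Qed.

Definition lower_perm n (s : 'S_n.+1) (h : 'I_n.+1) : 'S_n :=
  odflt 1%g [pick s0 : 'S_n | s == lift_perm h (s h) s0].

Lemma lower_permE n (s : 'S_n.+1) (h : 'I_n.+1) :
  s = lift_perm h (s h) (lower_perm s h).
Proof.
rewrite /lower_perm; case: pickP => [s0 /eqP //|no_s0]; exfalso.
have neq_sh k : s h != s (lift h k) by rewrite (inj_eq perm_inj) neq_lift.
have f_ex k : exists k', s (lift h k) = lift (s h) k'.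
  by have /unlift_some[k' -> _] := neq_sh k; exists k'.
pose f k := odflt k (unlift (s h) (s (lift h k))).
have fE k : s (lift h k) = lift (s h) (f k).
  by have [k' Ek] := f_ex k; rewrite /f Ek liftK.
have f_inj : injective f.
  by move=> k k' ff'; apply/(@lift_inj _ h)/(@perm_inj _ s); rewrite !fE ff'.
have /eqP[] := no_s0 (perm f_inj).
apply/permP=> k; case: (unliftP h k) => [k' ->|->].
  by rewrite lift_perm_lift permE fE.
by rewrite lift_perm_id.
Qed.

Lemma lower_perm_lift n (s : 'S_n.+1) h k :
  s (lift h k) = lift (s h) (lower_perm s h k).
Proof. by rewrite {1}(lower_permE s h) lift_perm_lift. Qed.

Lemma odd_lower_perm n (s : 'S_n.+1) h :
  lower_perm s h = odd h (+) odd (s h) (+) s :> bool.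
Proof.
have := congr1 (@odd_perm _) (lower_permE s h); rewrite odd_lift_perm.
by move: (odd_perm (lower_perm s h)) (odd_perm s) (odd h) (odd (s h));
  do 4!case.
Qed.

Lemma pmap_rot (T U : Type) (f : T -> option U) r (s : seq T) :
  exists r', pmap f (rot r s) = rot r' (pmap f s).
Proof.
rewrite {1}/rot; move: (take r s) (drop r s) (cat_take_drop r s) => s1 s2 <-.
by exists (size (pmap f s1)); rewrite !pmap_cat rot_size_cat.
Qed.

Lemma is_graph_uniq n p q (x : labelled n p q) : is_graph x -> uniq (circle x).
Proof. by case/and4P=> circ _ _ _; rewrite (perm_uniq circ) enum_uniq. Qed.

Lemma mem_circle n p q (x : labelled n p q) w : is_graph x -> w \in circle x.
Proof. by case/and4P=> circ _ _ _; rewrite (perm_mem circ) mem_enum. Qed.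

Definition rotate n p q r (x : labelled n p q) : labelled n p q :=
  (rot r (circle x), ends x).

Lemma is_graph_rotate n p q r (x : labelled n p q) :
  is_graph x -> is_graph (rotate r x).
Proof.
case/and4P=> circ gi ge gc; apply/and4P; split=> //.
by rewrite perm_rot.
Qed.

Lemma renumber_int1 n p (v : vertex n p) : renumber_int 1 v = v.
Proof. by case: v => //= u; rewrite perm1. Qed.

Lemma isomorphic_rotate n p q r (x : labelled n p q) : isomorphic x (rotate r x).
Proof.
split; first by exists r.
exists 1%g => a; rewrite (eq_map_vertex (@renumber_int1 _ _)).
by rewrite /map_vertex -surjective_pairing /same_pair eqxx.
Qed.

Lemma isomorphic_contract_arc n p q h l (x y : labelled n.+1 p q) :
  isomorphic x y -> isomorphic (contract_arc h l x) (contract_arc h l y).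
Proof.
case=> -[r cE] [s eE]; split; first by rewrite /= cE; apply: pmap_rot.
exists s => a; rewrite !ffunE.
have := map_vertex_same_pair (merge_ext h l) (eE a); rewrite !map_vertex_comp.
by congr same_pair; apply: eq_map_vertex; case.
Qed.

Lemma isomorphic_contract_edge n p q a u u' y y' (s : 'S_p)
    (x x' : labelled n p.+1 q.+1) (t : 'S_p.+1) :
  (exists r, circle x' = rot r (circle x)) ->
  (forall b, same_pair (map_vertex (renumber_int t) (ends x b)) (ends x' b)) ->
  (forall v, merge_int u' y' (renumber_int t v) =
             renumber_int s (merge_int u y v)) ->
  isomorphic (contract_edge a u y x) (contract_edge a u' y' x').
Proof.
move=> circ xx' merge_t; split=> //; exists s => b; rewrite !ffunE.
have := map_vertex_same_pair (merge_int u' y') (xx' (lift a b)).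
by rewrite !map_vertex_comp; congr same_pair; apply: eq_map_vertex.
Qed.

Lemma merge_renumber_int n p (t : 'S_p.+1) u (y v : vertex n _) :
  merge_int (t u) (renumber_int (lower_perm t u) y) (renumber_int t v) =
  renumber_int (lower_perm t u) (merge_int u y v).
Proof.
case: v => //= w; case: (unliftP u w) => [w' ->|->] /=.
  by rewrite lower_perm_lift liftK.
by rewrite unlift_none.
Qed.

Lemma isomorphic_internal_loop n p q (x y : labelled n p q) :
  isomorphic x y -> has_internal_loop y = has_internal_loop x.
Proof.
case=> _ [s xy]; apply/existsP/existsP=> -[a /existsP[v /eqP Ea]]; exists a;
  apply/existsP; have := xy a; rewrite /map_vertex Ea; last first.
  by case/orP=> /eqP ->; exists (s v).
case: (ends x a) => [[?|w] [?|w']] /orP[] /eqP //= [Ew Ew'];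
  exists w; apply/eqP; congr (inr _, inr _); apply: (@perm_inj _ s);
  by rewrite -?Ew -?Ew'.
Qed.

Lemma is_graph_relabel_ext n p q (x : labelled n p q) (s : 'S_n) :
  is_graph x -> is_graph (relabel_ext s x).
Proof.
have endsE a : ends (relabel_ext s x) a = map_vertex (renumber_ext s) (ends x a).
  by rewrite ffunE.
have valE v := leq_valence_map v endsE.
case/and4P=> circ /forallP gi /forallP ge /forallP gc; apply/and4P; split.
- apply: uniq_perm; rewrite ?enum_uniq //.
    by rewrite map_inj_uniq ?(perm_uniq circ) ?enum_uniq //; apply: perm_inj.
  move=> w; rewrite mem_enum; apply/mapP; exists (s^-1%g w); rewrite ?permKV //.
  by rewrite (perm_mem circ) mem_enum.
- by apply/forallP=> v; apply: leq_trans (gi v) (valE (inr v)).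
- apply/forallP=> w; apply: leq_trans (ge (s^-1%g w)) _.
  by have := valE (inl (s^-1%g w)); rewrite /= permKV.
- apply/forallP=> v; have /existsP[w cvw] := gc v.
  apply/existsP; exists (s w).
  apply: (connect_map (f := renumber_ext s)) cvw => {}v {}w /existsP[a].
  move=> evw; apply: connect1; apply/existsP; exists a; rewrite endsE.
  by case/orP: evw => /eqP ->; rewrite eqxx ?orbT.
Qed.

Lemma is_graph_relabel_edges n p q (x : labelled n p q) (s : 'S_q) :
  is_graph x -> is_graph (relabel_edges s x).
Proof.
have valE v : valence (relabel_edges s x) v = valence x v.
  rewrite /valence [RHS](reindex_inj (@perm_inj _ s)).
  by apply: eq_bigr => a _; rewrite ffunE.
have adjE : adjacent (relabel_edges s x) =2 adjacent x.
  move=> v w; apply/existsP/existsP=> -[a Ea].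
    by exists (s a); move: Ea; rewrite ffunE.
  by exists (s^-1%g a); rewrite ffunE permKV.
case/and4P=> circ gi ge gc; apply/and4P; split=> //.
- by apply/forallP=> v; rewrite valE; apply: (forallP gi).
- by apply/forallP=> v; rewrite valE; apply: (forallP ge).
- apply/forallP=> v; have /existsP[w cvw] := forallP gc v.
  by apply/existsP; exists w; rewrite (eq_connect adjE).
Qed.

Section Complex.
Variable R : realType.

Local Notation chains := {freeg graph / R}.

(* A configuration satisfying [is_graph], seen as a basis vector. *)
Definition basis_vector n p q (x : labelled n p q) : chains :=
  if insub (existT (fun s : shape => labelled s.1.1 s.1.2 s.2) (n, p, q) x)
     is Some g then << g >> else 0.

Definition arc_sign n (i j : 'I_n) : R :=
  if (i < j)%N then (-1) ^+ j.+1 else (-1) ^+ i.+2.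

Definition edge_sign n q (a : 'I_q) : R := (-1) ^+ (a.+1 + 1 + n).

(* The contraction of the arc from [i] to [j]; for [i = j] there is nothing to
   contract. *)
Definition arc_term n p q (x : labelled n.+1 p q) (i j : 'I_n.+1) : chains :=
  let: (h, l) := if (i < j)%N then (j, i) else (i, j) in
  if unlift h l is Some l'
  then arc_sign i j *: basis_vector (contract_arc h l' x) else 0.

Definition arc_contractions n p q : labelled n p q -> chains :=
  match n with
  | 0 => fun=> 0
  | n'.+1 => fun x => \sum_(i < n'.+1) arc_term x i (next (circle x) i)
  end.

Definition edge_term n p q (x : labelled n p.+1 q.+1) (a : 'I_q.+1) : chains :=
  if merged_ends (ends x a) is Some (u, y)
  then edge_sign n a *: basis_vector (contract_edge a u y x) else 0.

Definition edge_contractions n p q : labelled n p q -> chains :=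
  match p, q with
  | p'.+1, q'.+1 => fun x => \sum_(a < q'.+1) edge_term x a
  | _, _ => fun=> 0
  end.

(* A graph with an internal small loop represents 0, so its coboundary is 0.
   The contraction formula cannot be used for such a graph: contracting an edge
   between its looped vertex and the circle gives a graph with an external
   small loop, which need not represent 0. *)
Definition labelled_coboundary n p q (x : labelled n p q) : chains :=
  if has_internal_loop x then 0 else arc_contractions x + edge_contractions x.

Definition chain_coboundary : chains -> chains :=
  fglift (fun g : graph => labelled_coboundary (drawing g)).

Variant relator : chains -> Prop :=
| RelIso n p q (x y : labelled n p q) of
    is_graph x & is_graph y & isomorphic x y :
    relator (basis_vector y - basis_vector x)
| RelExt n p q (x : labelled n p q) (s : 'S_n) of
    is_graph x :
    relator (basis_vector (relabel_ext s x) - (-1) ^+ s *: basis_vector x)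
| RelEdges n p q (x : labelled n p q) (s : 'S_q) of
    is_graph x :
    relator (basis_vector (relabel_edges s x) - (-1) ^+ s *: basis_vector x)
| RelMultiple n p q (x : labelled n p q) of
    is_graph x & has_multiple_edge x : relator (basis_vector x)
| RelLoop n p q (x : labelled n p q) of
    is_graph x & has_internal_loop x : relator (basis_vector x).

Inductive relation_span : chains -> Prop :=
| RelSpan0 : relation_span 0
| RelSpanS (a : R) (r c : chains) of relator r & relation_span c :
    relation_span (a *: r + c).

Definition relations : {pred chains} := [pred c | `[< relation_span c >]].

Lemma relations_submod_closed : submod_closed relations.
Proof.
split=> [|a u v]; first exact/asboolP/RelSpan0.
move=> /asboolP Ru /asboolP Rv; apply/asboolP.
elim: Ru => [|b r c Rr _ IH]; first by rewrite scaler0 add0r.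
by rewrite scalerDr scalerA -addrA; apply: RelSpanS.
Qed.

HB.instance Definition _ := GRing.isSubmodClosed.Build R chains relations
  relations_submod_closed.

Lemma relator_relations r : relator r -> r \in relations.
Proof.
move=> Rr; apply/asboolP; rewrite -[r]addr0 -[r]scale1r.
by apply: RelSpanS => //; apply: RelSpan0.
Qed.

Lemma basis_vector_isomorphic n p q (x y : labelled n p q) :
  is_graph x -> is_graph y -> isomorphic x y ->
  basis_vector y - basis_vector x \in relations.
Proof. by move=> gx gy xy; apply/relator_relations/RelIso. Qed.

Lemma arc_term_isomorphic n p q (x y : labelled n.+1 p q) i j :
  is_graph x -> is_graph y -> isomorphic x y ->
  arc_term y i j - arc_term x i j \in relations.
Proof.
move=> gx gy xy; rewrite /arc_term; case: ifP => _;
  (case: unliftP => [l _|_]; last by rewrite subrr rpred0);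
  rewrite -scalerBr rpredZ //; apply: basis_vector_isomorphic;
  rewrite ?is_graph_contract_arc //; exact: isomorphic_contract_arc.
Qed.

Lemma edge_term_isomorphic n p q (x y : labelled n p.+1 q.+1) a :
  is_graph x -> is_graph y -> isomorphic x y ->
  edge_term y a - edge_term x a \in relations.
Proof.
move=> gx gy [circ [s xy]].
suff: match merged_ends (ends x a), merged_ends (ends y a) return Prop with
      | Some (u, v), Some (u', v') =>
          exists s0 : 'S_p, forall w,
            merge_int u' v' (renumber_int s w) =
            renumber_int s0 (merge_int u v w)
      | None, None => True
      | _, _ => False
      end.
  rewrite /edge_term.
  case Ex: (merged_ends (ends x a)) => [[u v]|];
    case Ey: (merged_ends (ends y a)) => [[u' v']|] //; last first.
    by rewrite subrr rpred0.
  case=> s0 Es0; rewrite -scalerBr rpredZ //.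
  apply: basis_vector_isomorphic; rewrite ?is_graph_contract_edge //.
  exact: isomorphic_contract_edge Es0.
move: (xy a); case: (ends x a) => [[w|u] [w'|u']];
  rewrite /same_pair /map_vertex => /orP[] /eqP -> //=.
- by exists (lower_perm s u') => v; rewrite -merge_renumber_int.
- by exists (lower_perm s u') => v; rewrite -merge_renumber_int.
- by exists (lower_perm s u) => v; rewrite -merge_renumber_int.
- by exists (lower_perm s u) => v; rewrite -merge_renumber_int.
- case: (unliftP u u') => [v ->|->] /=; last by rewrite unlift_none.
  rewrite lower_perm_lift liftK /=.
  by exists (lower_perm s u) => w; rewrite -merge_renumber_int.
- case: (unliftP u u') => [v ->|->] /=; last by rewrite unlift_none.
  set u1 := lift u v; pose t := (tperm u u1 * s)%g.
  have tu : s u1 = t u by rewrite permM tpermL.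
  have tu1 : s u = lift (t u) (lower_perm t u v).
    by rewrite -lower_perm_lift permM tpermR.
  rewrite tu tu1 liftK /=.
  exists (lower_perm t u) => w; rewrite -merge_renumber_int.
  case: w => //= w; have -> : t w = s (tperm u u1 w) by rewrite permM.
  case: tpermP => [->|->|//].
    by rewrite tu tu1 liftK unlift_none.
  by rewrite tu tu1 liftK unlift_none.
Qed.

Lemma rpred_congr (a b : chains) :
  a - b \in relations -> b \in relations -> a \in relations.
Proof. by move=> Rab Rb; rewrite -[a](subrK b) rpredD. Qed.

Lemma labelled_coboundary_isomorphic n p q (x y : labelled n p q) :
  is_graph x -> is_graph y -> isomorphic x y ->
  labelled_coboundary y - labelled_coboundary x \in relations.
Proof.
move=> gx gy xy; rewrite /labelled_coboundary (isomorphic_internal_loop xy).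
case: ifP => _; first by rewrite subrr rpred0.
rewrite opprD addrACA rpredD //.
  case: n x y gx gy xy => [|n] x y gx gy xy /=; first by rewrite subrr rpred0.
  rewrite -sumrB rpred_sum // => i _; have [[r ->] _] := xy.
  by rewrite next_rot ?is_graph_uniq ?arc_term_isomorphic.
case: p q x y gx gy xy => [|p] [|q] x y gx gy xy /=; rewrite ?subrr ?rpred0 //.
by rewrite -sumrB rpred_sum // => a _; apply: edge_term_isomorphic.
Qed.

Definition arc_removed n (i j : 'I_n) : 'I_n := if (i < j)%N then j else i.
Definition arc_kept n (i j : 'I_n) : 'I_n := if (i < j)%N then i else j.

Lemma arc_termE n p q (x : labelled n.+1 p q) (i j : 'I_n.+1) l :
  arc_kept i j = lift (arc_removed i j) l ->
  arc_term x i j =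
    arc_sign i j *: basis_vector (contract_arc (arc_removed i j) l x).
Proof.
by rewrite /arc_term /arc_kept /arc_removed; case: ifP => _ ->; rewrite liftK.
Qed.

Lemma arc_signE n (i j : 'I_n) :
  arc_sign i j = (-1) ^+ (odd (arc_removed i j).+1 (+) (j <= i)%N).
Proof.
by rewrite /arc_sign /arc_removed; case: (ltnP i j) => _;
  rewrite -signr_odd /= ?addbF ?addbT.
Qed.

Lemma arc_term_relabel_ext n p q (x : labelled n.+1 p q) (s : 'S_n.+1) i j t :
  is_graph x -> is_graph (relabel_ext s x) -> i != j ->
  circle x = i :: j :: t ->
  arc_term (relabel_ext s x) (s i) (s j) - (-1) ^+ s *: arc_term x i j
    \in relations.
Proof.
move=> gx gsx neq_ij circ.
set h := arc_removed i j; set h' := arc_removed (s i) (s j).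
have neq_hk : h != arc_kept i j.
  by rewrite /h /arc_removed /arc_kept; case: ifP; rewrite // eq_sym.
have /unlift_some[l hl _] := neq_hk.
pose flip : bool := (j <= i)%N (+) (s j <= s i)%N.
pose s1 : 'S_n.+1 := if flip then (tperm i j * s)%g else s.
have s1h : s1 h = h'.
  rewrite /s1 /flip /h /h' /arc_removed.
  by case: (ltnP i j) => _; case: (ltnP (s i) (s j)) => _ /=; rewrite ?permM ?tpermL ?tpermR.
have s1k : s1 (arc_kept i j) = arc_kept (s i) (s j).
  rewrite /s1 /flip /arc_kept.
  by case: (ltnP i j) => _; case: (ltnP (s i) (s j)) => _ /=; rewrite ?permM ?tpermL ?tpermR.
pose s0 := lower_perm s1 h.
have hl' : arc_kept (s i) (s j) = lift h' (s0 l).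
  by rewrite -s1k hl lower_perm_lift s1h.
rewrite (arc_termE _ hl) (arc_termE _ hl') -/h -/h'.
have s1P w : w != i -> w != j -> s w = s1 w.
  move=> wi wj; rewrite /s1; case: (flip) => //.
  by rewrite permM tpermD // eq_sym.
have ijE w : (w == i) || (w == j) = (w == h) || (w == lift h l).
  rewrite -hl /h /arc_removed /arc_kept.
  by case: ifP => _ //; rewrite orbC.
have merge w : odflt (s0 l) (unlift h' (s w)) = s0 (odflt l (unlift h w)).
  have [wij|/norP[wi wj]] := boolP ((w == i) || (w == j)).
    have -> : odflt l (unlift h w) = l.
      by move: wij; rewrite ijE => /orP[] /eqP ->; rewrite ?unlift_none ?liftK.
    have : (s w == h') || (s w == lift h' (s0 l)).
      rewrite -hl' /h' /arc_removed /arc_kept.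
      by case/orP: wij => /eqP ->; case: ifP; rewrite eqxx ?orbT.
    by case/orP => /eqP ->; rewrite ?unlift_none ?liftK.
  rewrite (s1P _ wi wj); case: (unliftP h w) => [k ->|->].
    by rewrite lower_perm_lift s1h liftK.
  by rewrite s1h unlift_none.
have circle_merge (m : 'I_n.+1) l0 i0 j0 t0 : uniq [:: i0, j0 & t0] ->
    (forall w, (w == i0) || (w == j0) = (w == m) || (w == lift m l0)) ->
    pmap (unlift m) [:: i0, j0 & t0] =
    l0 :: [seq odflt l0 (unlift m w) | w <- t0].
  move=> /and3P[]; rewrite inE negb_or => /andP[i0j0 i0t] j0t _ mE.
  have Et : pmap (unlift m) t0 = [seq odflt l0 (unlift m w) | w <- t0].
    have : m \notin t0.
      by have := mE m; rewrite eqxx /= => /orP[] /eqP ->.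
    elim: t0 {i0t j0t} => //= w t0 IH; rewrite inE negb_or => /andP[mw /IH ->].
    by have /unlift_some[k _ ->] := mw.
  rewrite /= Et; have := mE i0; have := mE j0; rewrite !eqxx orbT /=.
  have Em : unlift m m = None by rewrite unlift_none.
  move=> /esym/orP[] /eqP Ej /esym/orP[] /eqP Ei; subst; rewrite ?eqxx // in i0j0 *;
    by rewrite /= ?Em ?liftK /= ?Em ?liftK.
have E : contract_arc h' (s0 l) (relabel_ext s x) =
         relabel_ext s0 (contract_arc h l x).
  congr pair; last first.
    apply/ffunP=> a; rewrite !ffunE !map_vertex_comp.
    by apply: eq_map_vertex; case=> //= w; rewrite merge.
  have ux := is_graph_uniq gx; have usx := is_graph_uniq gsx.
  have Ec : circle (relabel_ext s x) = [:: s i, s j & [seq s w | w <- t]].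
    by rewrite -[LHS]/[seq s w | w <- circle x] circ.
  rewrite circ in ux; rewrite Ec in usx; rewrite Ec.
  rewrite -[circle (contract_arc h l x)]/(pmap (unlift h) (circle x)) circ.
  rewrite (circle_merge h' (s0 l)) // ?(circle_merge h l) //=.
    by rewrite -!map_comp; congr cons; apply: eq_map => w /=; rewrite merge.
  move=> w; rewrite -hl' /h' /arc_removed /arc_kept.
  by case: ifP => _ //; rewrite orbC.
have gc := is_graph_contract_arc h l gx.
have gc' : is_graph (relabel_ext s0 (contract_arc h l x)).
  by rewrite -E is_graph_contract_arc.
rewrite E scalerA.
have -> : (-1) ^+ s * arc_sign i j = arc_sign (s i) (s j) * (-1) ^+ s0 :> R.
  rewrite !arc_signE -!signr_addb -/h -/h' odd_lower_perm s1h.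
  congr (_ ^+ nat_of_bool _).
  have -> : odd_perm s1 = flip (+) s.
    by rewrite /s1; case: (flip); rewrite // odd_permM odd_tperm neq_ij.
  rewrite /flip /=.
  by move: (odd_perm s) (odd h) (odd h') (j <= i)%N (s j <= s i)%N;
    do 5!case.
by rewrite -scalerA -scalerBr rpredZ //; apply/relator_relations/RelExt.
Qed.

Lemma relabel_ext_rotate n p q (x : labelled n p q) s r :
  relabel_ext s (rotate r x) = rotate r (relabel_ext s x).
Proof. by rewrite /relabel_ext /rotate /= map_rot. Qed.

Lemma next_arc n p q (x : labelled n p q) i : is_graph x ->
  i != next (circle x) i ->
  exists r t, circle (rotate r x) = i :: next (circle x) i :: t.
Proof.
move=> gx; have [r s rE] := rot_to (mem_circle i gx).
have <- := next_rot r (is_graph_uniq gx) i; rewrite rE.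
by case: s rE => [|j t] rE /=; rewrite eqxx ?eqxx // => _; exists r, t.
Qed.

Lemma relations_trans (a b c : chains) :
  a - b \in relations -> b - c \in relations -> a - c \in relations.
Proof. by move=> Rab Rbc; rewrite -(subrKA b) rpredD. Qed.

Lemma relations_sym (a b : chains) : a - b \in relations -> b - a \in relations.
Proof. by move=> Rab; rewrite -opprB rpredN. Qed.

Lemma arc_contractions_relabel_ext n p q (x : labelled n p q) (s : 'S_n) :
  is_graph x -> is_graph (relabel_ext s x) ->
  arc_contractions (relabel_ext s x) - (-1) ^+ s *: arc_contractions x
    \in relations.
Proof.
case: n x s => [|n] x s gx gsx /=; first by rewrite scaler0 subrr rpred0.
rewrite (reindex_inj (@perm_inj _ s)) scaler_sumr -sumrB rpred_sum // => i _.
rewrite (next_map (@perm_inj _ s)) ?is_graph_uniq //.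
have [ij|neq_ij] := eqVneq i (next (circle x) i).
  by rewrite /arc_term -ij !ltnn /= !unlift_none scaler0 subrr rpred0.
have [r [t circ]] := next_arc gx neq_ij.
set j := next (circle x) i in neq_ij circ *.
have grx := is_graph_rotate r gx; have grsx := is_graph_rotate r gsx.
have rel1 : arc_term (rotate r x) i j - arc_term x i j \in relations.
  by apply: arc_term_isomorphic => //; apply: isomorphic_rotate.
have rel2 : arc_term (rotate r (relabel_ext s x)) (s i) (s j) -
    arc_term (relabel_ext s x) (s i) (s j) \in relations.
  by apply: arc_term_isomorphic => //; apply: isomorphic_rotate.
apply: relations_trans (relations_sym rel2) _.
rewrite -relabel_ext_rotate in grsx rel2 *.
apply: relations_trans (arc_term_relabel_ext grx grsx neq_ij circ) _.
by rewrite -scalerBr rpredZ.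
Qed.

Lemma edge_contractions_relabel_ext n p q (x : labelled n p q) (s : 'S_n) :
  is_graph x -> is_graph (relabel_ext s x) ->
  edge_contractions (relabel_ext s x) - (-1) ^+ s *: edge_contractions x
    \in relations.
Proof.
case: p q x => [|p] [|q] x gx gsx /=; rewrite ?scaler0 ?subrr ?rpred0 //.
rewrite scaler_sumr -sumrB rpred_sum // => a _; rewrite /edge_term.
have -> : merged_ends (ends (relabel_ext s x) a) =
    omap (fun uy => (uy.1, renumber_ext s uy.2)) (merged_ends (ends x a)).
  rewrite ffunE; case: (ends x a) => [[w|u] [w'|u']] //=.
  by case: unliftP.
case Ea: (merged_ends (ends x a)) => [[u y]|] /=; last first.
  by rewrite scaler0 subrr rpred0.
have E : contract_edge a u (renumber_ext s y) (relabel_ext s x) =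
    relabel_ext s (contract_edge a u y x).
  congr pair; apply/ffunP=> b; rewrite !ffunE !map_vertex_comp.
  by apply: eq_map_vertex; case=> //= w; case: unliftP.
have gc := is_graph_contract_edge Ea gx.
have gc' : is_graph (relabel_ext s (contract_edge a u y x)).
  rewrite -E; apply: is_graph_contract_edge => //.
  rewrite ffunE; move: Ea; case: (ends x a) => [[w|v] [w'|v']] //=.
  - by case=> -> <-.
  - by case=> -> <-.
  - by case: unliftP => // ? _ [-> <-].
rewrite E scalerA mulrC -scalerA -scalerBr rpredZ //.
exact/relator_relations/RelExt.
Qed.

Lemma internal_loop_relabel_ext n p q (x : labelled n p q) (s : 'S_n) :
  has_internal_loop (relabel_ext s x) = has_internal_loop x.
Proof.
apply: eq_existsb => a; apply: eq_existsb => v; rewrite ffunE.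
by case: (ends x a) => [[w|u] [w'|u']].
Qed.

Lemma labelled_coboundary_relabel_ext n p q (x : labelled n p q) (s : 'S_n) :
  is_graph x -> is_graph (relabel_ext s x) ->
  labelled_coboundary (relabel_ext s x) - (-1) ^+ s *: labelled_coboundary x
    \in relations.
Proof.
move=> gx gsx; rewrite /labelled_coboundary internal_loop_relabel_ext.
case: ifP => _; first by rewrite scaler0 subrr rpred0.
rewrite scalerDr opprD addrACA rpredD //.
  exact: arc_contractions_relabel_ext.
exact: edge_contractions_relabel_ext.
Qed.

Lemma arc_contractions_relabel_edges n p q (x : labelled n p q) (s : 'S_q) :
  is_graph x -> is_graph (relabel_edges s x) ->
  arc_contractions (relabel_edges s x) - (-1) ^+ s *: arc_contractions x
    \in relations.
Proof.
case: n x => [|n] x gx gsx /=; first by rewrite scaler0 subrr rpred0.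
rewrite scaler_sumr -sumrB rpred_sum // => i _.
have E h l : contract_arc h l (relabel_edges s x) =
    relabel_edges s (contract_arc h l x).
  by congr pair; apply/ffunP=> a; rewrite !ffunE.
rewrite /arc_term; case: ifP => _;
  (case: unliftP => [l _|_]; last by rewrite scaler0 subrr rpred0);
  rewrite scalerA mulrC -scalerA -scalerBr rpredZ // E;
  by apply/relator_relations/RelEdges; apply: is_graph_contract_arc.
Qed.

Lemma edge_contractions_relabel_edges n p q (x : labelled n p q) (s : 'S_q) :
  is_graph x -> is_graph (relabel_edges s x) ->
  edge_contractions (relabel_edges s x) - (-1) ^+ s *: edge_contractions x
    \in relations.
Proof.
case: p q x s => [|p] [|q] x s gx gsx /=; rewrite ?scaler0 ?subrr ?rpred0 //.
rewrite [in X in _ - X](reindex_inj (@perm_inj _ s)).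
rewrite scaler_sumr -sumrB rpred_sum // => a _; rewrite /edge_term.
have Esa : ends (relabel_edges s x) a = ends x (s a) by rewrite ffunE.
rewrite Esa; case Ea: (merged_ends (ends x (s a))) => [[u y]|]; last first.
  by rewrite scaler0 subrr rpred0.
have E : contract_edge a u y (relabel_edges s x) =
    relabel_edges (lower_perm s a) (contract_edge (s a) u y x).
  by congr pair; apply/ffunP=> b; rewrite !ffunE lower_perm_lift.
have gc := is_graph_contract_edge Ea gx.
have gc' : is_graph (relabel_edges (lower_perm s a) (contract_edge (s a) u y x)).
  by rewrite -E; apply: is_graph_contract_edge; rewrite // Esa.
rewrite E scalerA.
have -> : (-1) ^+ s * edge_sign n (s a) =
    edge_sign n a * (-1) ^+ lower_perm s a :> R.
  rewrite /edge_sign -!(signr_odd _ (_ + _)) -!signr_addb odd_lower_perm.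
  congr (_ ^+ nat_of_bool _); rewrite !oddD /=.
  by move: (odd_perm s) (odd a) (odd (s a)) (odd n); do 4!case.
rewrite -scalerA -scalerBr rpredZ //.
exact/relator_relations/RelEdges.
Qed.

Lemma internal_loop_relabel_edges n p q (x : labelled n p q) (s : 'S_q) :
  has_internal_loop (relabel_edges s x) = has_internal_loop x.
Proof.
apply/existsP/existsP=> -[a /existsP[v Ev]].
  by exists (s a); apply/existsP; exists v; move: Ev; rewrite ffunE.
by exists (s^-1%g a); apply/existsP; exists v; rewrite ffunE permKV.
Qed.

Lemma labelled_coboundary_relabel_edges n p q (x : labelled n p q) (s : 'S_q) :
  is_graph x -> is_graph (relabel_edges s x) ->
  labelled_coboundary (relabel_edges s x) - (-1) ^+ s *: labelled_coboundary x
    \in relations.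
Proof.
move=> gx gsx; rewrite /labelled_coboundary internal_loop_relabel_edges.
case: ifP => _; first by rewrite scaler0 subrr rpred0.
rewrite scalerDr opprD addrACA rpredD //.
  exact: arc_contractions_relabel_edges.
exact: edge_contractions_relabel_edges.
Qed.

Lemma labelled_coboundary_multiple n p q (x : labelled n p q) :
  is_graph x -> has_multiple_edge x -> labelled_coboundary x \in relations.
Proof.
move=> gx /existsP[a /existsP[b /andP[neq_ab same_ab]]].
have gy := is_graph_relabel_edges (tperm a b) gx.
have xy : isomorphic x (relabel_edges (tperm a b) x).
  split; first by exists 0; rewrite rot0.
  exists 1%g => c; rewrite (eq_map_vertex (@renumber_int1 _ _)) ffunE.
  rewrite /map_vertex -surjective_pairing.
  case: tpermP => [->|->|_ _]; rewrite ?same_ab //; last first.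
    by rewrite /same_pair eqxx.
  case/orP: same_ab => /eqP ->; rewrite /same_pair ?eqxx //=.
  by rewrite -surjective_pairing eqxx orbT.
have := labelled_coboundary_relabel_edges gx gy.
rewrite odd_tperm neq_ab expr1 scaleN1r opprK => Rs.
have := labelled_coboundary_isomorphic gx gy xy => Rd.
have := rpredB Rs Rd; rewrite opprD opprK addrACA subrr add0r -mulr2n => R2.
have /(rpredZ 2^-1) : 2%:R *: labelled_coboundary x \in relations.
  by rewrite scaler_nat.
by rewrite scalerA mulVf ?scale1r // pnatr_eq0.
Qed.

Lemma chain_coboundary_is_linear : linear chain_coboundary.
Proof.
have addB c d : chain_coboundary (c - d) =
    chain_coboundary c - chain_coboundary d by exact: lift_is_additive.
have add0 : chain_coboundary 0 = 0 by rewrite -[X in chain_coboundary X](subrr 0) addB subrr.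
have addN c : chain_coboundary (- c) = - chain_coboundary c.
  by rewrite -(sub0r c) addB add0 sub0r.
have addD c d : chain_coboundary (c + d) =
    chain_coboundary c + chain_coboundary d.
  by rewrite -{1}(opprK d) addB addN opprK.
have addS I (r : seq I) (F : I -> chains) :
    chain_coboundary (\sum_(i <- r) F i) =
    \sum_(i <- r) chain_coboundary (F i).
  exact: (big_morph _ addD add0).
move=> a u v; rewrite addD; congr (_ + _).
rewrite -[in RHS](freeg_sumE u) addS scaler_sumr.
have -> : a *: u = \sum_(g <- dom u) << a * coeff g u *g g >> by [].
rewrite addS; apply: eq_bigr => g _.
by rewrite /chain_coboundary !liftU scalerA.
Qed.

HB.instance Definition _ := GRing.isLinear.Build R chains chains *:%R
  chain_coboundary chain_coboundary_is_linear.

Lemma chain_coboundary_basis_vector n p q (x : labelled n p q) :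
  is_graph x -> chain_coboundary (basis_vector x) = labelled_coboundary x.
Proof.
move=> gx; rewrite /basis_vector; case: insubP => [g _ gE|]; last first.
  by rewrite /= gx.
rewrite /chain_coboundary liftU scale1r.
rewrite /drawing /n_ext /n_int /n_edges.
by move: gE; rewrite /= => ->.
Qed.

Lemma chain_coboundary_relations c :
  c \in relations -> chain_coboundary c \in relations.
Proof.
move=> /asboolP; elim=> [|a r d Rr _ IH]; first by rewrite raddf0 rpred0.
rewrite linearP rpredD // rpredZ //.
case: Rr => [n p q x y gx gy xy|n p q x s gx|n p q x s gx|
             n p q x gx mx|n p q x gx lx].
- rewrite raddfB /= !chain_coboundary_basis_vector //.
  exact: labelled_coboundary_isomorphic.
- rewrite raddfB /= linearZ /= !chain_coboundary_basis_vector //.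
  - exact/labelled_coboundary_relabel_ext/is_graph_relabel_ext.
  - exact: is_graph_relabel_ext.
- rewrite raddfB /= linearZ /= !chain_coboundary_basis_vector //.
  - exact/labelled_coboundary_relabel_edges/is_graph_relabel_edges.
  - exact: is_graph_relabel_edges.
- by rewrite /= chain_coboundary_basis_vector // labelled_coboundary_multiple.
- by rewrite /= chain_coboundary_basis_vector // /labelled_coboundary lx rpred0.
Qed.

Definition D_e : Type := quot_mod relations.
HB.instance Definition _ := GRing.Lmodule.on D_e.
HB.instance Definition _ := Quotient.on D_e.

Definition graph_class : chains -> D_e := \pi_D_e.

Lemma graph_class_is_linear : linear graph_class.
Proof.
move=> a u v; apply: etrans (raddfD (\pi_(quot_mod relations)) _ _) _.
by congr (_ + _); exact: (pi_quot_scalable relations).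
Qed.

HB.instance Definition _ := GRing.isLinear.Build R chains D_e *:%R
  graph_class graph_class_is_linear.

Lemma graph_class_surj (x : D_e) : exists c, graph_class c = x.
Proof. by exists (generic_quotient.repr x); apply: reprK. Qed.

Lemma graph_class_eq (c d : chains) :
  graph_class c = graph_class d <-> c - d \in relations.
Proof. by rewrite -(pi_quot_eq relations); split=> /eqP. Qed.

Definition coboundary (x : D_e) : D_e :=
  graph_class (chain_coboundary (generic_quotient.repr x)).

Lemma coboundary_class (c : chains) :
  coboundary (graph_class c) = graph_class (chain_coboundary c).
Proof.
apply/graph_class_eq; rewrite -raddfB chain_coboundary_relations //.
by apply/graph_class_eq; apply: reprK.
Qed.

Lemma coboundary_is_linear : linear coboundary.
Proof.
move=> a u v; have [c <-] := graph_class_surj u.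
have [d <-] := graph_class_surj v.
by rewrite -linearP !coboundary_class linearP linearP.
Qed.

HB.instance Definition _ := GRing.isLinear.Build R D_e D_e *:%R coboundary
  coboundary_is_linear.

Definition homogeneous (k m : int) : {pred chains} :=
  [pred c | all (fun g => (order_of g == k) && (degree_of g == m)) (dom c)].

Lemma homogeneous_submod_closed k m : submod_closed (homogeneous k m).
Proof.
split=> [|a u v /allP hu /allP hv]; first by rewrite inE dom0.
by apply/allP=> g /domD_subset; rewrite mem_cat => /orP[/domZ_subset/hu|/hv].
Qed.

HB.instance Definition _ k m := GRing.isSubmodClosed.Build R chains
  (homogeneous k m) (homogeneous_submod_closed k m).

Lemma homogeneous_basis_vector n p q (x : labelled n p q) :
  basis_vector x \in
    homogeneous (q%:Z - p%:Z) (2 * q%:Z - n%:Z - 3 * p%:Z).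
Proof.
rewrite /basis_vector; case: insubP => [g _ gE|_]; last exact: rpred0.
by rewrite inE domU1 /= andbT /order_of /degree_of /n_ext /n_int /n_edges gE /=
  !eqxx.
Qed.

Lemma homogeneous_chain_coboundary k m c :
  c \in homogeneous k m -> chain_coboundary c \in homogeneous k (m + 1).
Proof.
move=> /allP hc; rewrite -(freeg_sumE c) raddf_sum /= big_seq rpred_sum // => g.
move=> /hc /andP[/eqP <- /eqP <-]; rewrite /chain_coboundary liftU rpredZ //.
rewrite /labelled_coboundary; case: ifP => _; first exact: rpred0.
rewrite /order_of /degree_of.
move: (n_ext g) (n_int g) (n_edges g) (drawing g) => n p q x.
rewrite rpredD //.
  case: n x => [|n] x /=; first exact: rpred0.
  rewrite rpred_sum // => i _; rewrite /arc_term.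
  have mE : 2 * q%:Z - n%:Z - 3 * p%:Z = 2 * q%:Z - n.+1%:Z - 3 * p%:Z + 1 by lia.
  by case: ifP => _; case: unliftP => [l _|_]; rewrite ?rpred0 // rpredZ // -mE;
    apply: homogeneous_basis_vector.
case: p q x => [|p] [|q] x /=; rewrite ?rpred0 // rpred_sum // => a _.
rewrite /edge_term; case: merged_ends => [[u y]|]; last exact: rpred0.
have -> : q.+1%:Z - p.+1%:Z = q%:Z - p%:Z by lia.
have -> : 2 * q.+1%:Z - n%:Z - 3 * p.+1%:Z + 1 = 2 * q%:Z - n%:Z - 3 * p%:Z
  by lia.
by rewrite rpredZ // homogeneous_basis_vector.
Qed.

Definition bigraded (k m : int) : {pred D_e} :=
  [pred x | `[< exists2 c, c \in homogeneous k m & graph_class c = x >]].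

Lemma bigraded_submod_closed k m : submod_closed (bigraded k m).
Proof.
split=> [|a u v]; first by apply/asboolP; exists 0; rewrite ?rpred0 ?raddf0.
case/asboolP=> c hc <- /asboolP[d hd <-]; apply/asboolP.
by exists (a *: c + d); rewrite ?linearP // rpredD // rpredZ.
Qed.

HB.instance Definition _ k m := GRing.isSubmodClosed.Build R D_e
  (bigraded k m) (bigraded_submod_closed k m).

Lemma bigraded_coboundary k m x :
  x \in bigraded k m -> coboundary x \in bigraded k (m + 1).
Proof.
case/asboolP=> c hc <-; apply/asboolP; exists (chain_coboundary c).
  exact: homogeneous_chain_coboundary.
by rewrite coboundary_class.
Qed.

Definition is_cocycle (k m : int) : {pred D_e} :=
  [pred x | (x \in bigraded k m) && (coboundary x == 0)].

Lemma is_cocycle_submod_closed k m : submod_closed (is_cocycle k m).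
Proof.
split=> [|a u v]; first by rewrite inE rpred0 raddf0 eqxx.
case/andP=> bu /eqP du /andP[bv /eqP dv].
by rewrite inE rpredD ?rpredZ //= linearP /= du dv scaler0 addr0.
Qed.

HB.instance Definition _ k m := GRing.isSubmodClosed.Build R D_e
  (is_cocycle k m) (is_cocycle_submod_closed k m).

Record cocycle (k m : int) := Cocycle {
  cocycle_val : D_e;
  _ : cocycle_val \in is_cocycle k m
}.
HB.instance Definition _ k m := [isSub for @cocycle_val k m].
HB.instance Definition _ k m := [Choice of cocycle k m by <:].
HB.instance Definition _ k m := [SubChoice_isSubLmodule of cocycle k m by <:].

Definition is_coboundary (k m : int) : {pred cocycle k m} :=
  [pred z | `[< exists2 y, y \in bigraded k (m - 1) & coboundary y = \val z >]].

Lemma is_coboundary_submod_closed k m : submod_closed (@is_coboundary k m).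
Proof.
split=> [|a u v]; first by apply/asboolP; exists 0; rewrite ?rpred0 ?raddf0.
case/asboolP=> y by_ dy /asboolP[z bz dz]; apply/asboolP.
by exists (a *: y + z); rewrite ?rpredD ?rpredZ // !linearP /= dy dz.
Qed.

HB.instance Definition _ k m := GRing.isSubmodClosed.Build R (cocycle k m)
  (@is_coboundary k m) (@is_coboundary_submod_closed k m).

Definition cohomology (k m : int) : Type := quot_mod (@is_coboundary k m).
HB.instance Definition _ k m := GRing.Lmodule.on (cohomology k m).

End Complex.

(* Main.v *)
(** The cochain groups vanish in negative degree, because the valences of a graph
add up to twice its number of edges; so a nonzero cocycle of degree 0 suffices.
Multiplying graphs by summing over the cyclic shuffles of their external
vertices makes the complex a differential graded algebra: an arc joining two
different factors is contracted with opposite signs in the two orders of its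
ends. In order 2, let [X] be the circle with two crossed chords and [Y] the
circle with one tripod. Contracting any arc of [X] or any edge of [Y] gives up
to sign the same graph [V], so [4 V] for [X] and [-3 V] for [Y], while an arc of
[Y] gives a double edge. Hence [3 X + 4 Y] is a cocycle, and its [k]-th power is
a cocycle of order [2 k]. The determinant of the incidence matrix between
external vertices and edges has all the symmetries required of a linear form on
the complex; it vanishes on every multiple of [X] and multiplies by a nonzero
constant under the product with [Y], so it does not vanish on the power. *)

Require Import Defs.
From HB Require Import structures.
From mathcomp.multinomials Require Import freeg.
From mathcomp Require Import all_boot all_order fingroup perm all_algebra.
From mathcomp Require Import zify.
From mathcomp Require Import boolp reals.

Set Implicit Arguments.
Unset Strict Implicit.
Unset Printing Implicit Defensive.

Import Order.TTheory GRing.Theory Num.Theory.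

Local Open Scope ring_scope.

(** * Cyclic words and their shuffles *)

(** The product is built only as left multiplication by a fixed graph, extended linearly in the
    right factor; the powers are iterates applied to the bare circle. The labels of the right factor
    are shifted by the numbers [r] and [t] of external vertices and edges of the left one. Together
    with the prefactor of the product this changes contraction signs by [(-1)^(r + t)], which is 1
    for [X] (4 + 2) and for [Y] (3 + 3), so the coboundary passes the left factor without a sign. A
    circle has no base point, whereas a drawing stores it as a word. Shuffles are therefore summed
    over all words and divided by the number of points. The contraction of an arc takes words of
    [n + 1] letters to words of [n]; rooting both sums at the merged point absorbs the two different
    divisors and makes the contraction a bijection. The determinant ignores the circle, so all
    shuffles contribute equally and their number only has to be positive. The two ends of a chord of
    [X] give equal rows; the three legs of [Y] give an identity block. *)

Section CyclicWords.
Variable T : eqType.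
Implicit Types (a b c ca cb : seq T).

(** Membership in a finite list of rotations makes the relation boolean, so that it can filter the
    terms of a sum. *)
Definition same_cycle a b : bool :=
  b \in [seq rot i a | i <- iota 0 (size a).+1].

Lemma same_cycleP a b : reflect (exists r, b = rot r a) (same_cycle a b).
Proof.
apply: (iffP mapP) => [[i _ ->]|[r ->]]; first by exists i.
by exists (minn r (size a)); rewrite -?rot_minn // mem_iota ltnS geq_minr.
Qed.

Lemma same_cycle_refl a : same_cycle a a.
Proof. by apply/same_cycleP; exists 0%N; rewrite rot0. Qed.

Lemma same_cycle_sym a b : same_cycle a b = same_cycle b a.
Proof.
suff sub x y : same_cycle x y -> same_cycle y x by apply/idP/idP; apply: sub.
case/same_cycleP=> r ->; apply/same_cycleP.
exists (size (rot r x) - r)%N; exact/esym/rotK.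
Qed.

Lemma same_cycle_trans b a c : same_cycle a b -> same_cycle b c -> same_cycle a c.
Proof.
case/same_cycleP=> r -> /same_cycleP[s ->]; apply/same_cycleP.
by rewrite rot_rot_add; eexists.
Qed.

Lemma same_cycle_left a b c : same_cycle a b -> same_cycle a c = same_cycle b c.
Proof.
by move=> ab; apply/idP/idP; apply: same_cycle_trans; rewrite // same_cycle_sym.
Qed.

Lemma same_cycle_right a b c : same_cycle a b -> same_cycle c a = same_cycle c b.
Proof. by rewrite ![same_cycle c _]same_cycle_sym; apply: same_cycle_left. Qed.

Lemma same_cycle_perm a b : same_cycle a b -> perm_eq a b.
Proof. by case/same_cycleP=> r ->; rewrite perm_sym perm_rot. Qed.

Lemma same_cycle_filter (p : pred T) a b :
  same_cycle a b -> same_cycle (filter p a) (filter p b).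
Proof.
case/same_cycleP=> r ->; apply/same_cycleP.
exists (size (filter p (take r a))).
rewrite [in LHS]/rot; move: (take r a) (drop r a) (cat_take_drop r a) => x y <-.
by rewrite !filter_cat rot_size_cat.
Qed.

(** A proper rotation beginning with [i] would exhibit a second occurrence of [i], inside [s].
    Rooting a cycle at a letter that occurs once thus turns equality up to rotation into equality of
    words. *)
Lemma same_cycle_cons i s t : i \notin s ->
  same_cycle (i :: s) (i :: t) = (s == t).
Proof.
move=> nis; apply/idP/eqP=> [/same_cycleP[[|r]]|->]; last first.
- exact: same_cycle_refl.
- rewrite /rot /=; case E: (drop r s) => [|j d] /=.
    by move: (cat_take_drop r s); rewrite E cats0 => -> [->].
  case=> Ej _; move: nis; rewrite -(cat_take_drop r s) E Ej mem_cat inE eqxx.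
  by rewrite orbT.
- by rewrite rot0 => -[->].
Qed.

(** Each factor is compared up to rotation on its own, because neither circle has a base point to
    align with the other. *)
Definition cyclic_shuffle ca cb c : bool :=
  same_cycle ca (filter (mem ca) c) && same_cycle cb (filter (mem cb) c).

Lemma cyclic_shuffleC ca cb c : cyclic_shuffle ca cb c = cyclic_shuffle cb ca c.
Proof. exact: andbC. Qed.

Lemma cyclic_shuffle_rot ca cb c c' :
  same_cycle c c' -> cyclic_shuffle ca cb c = cyclic_shuffle ca cb c'.
Proof.
by move=> cc'; congr andb; apply: same_cycle_right; apply: same_cycle_filter.
Qed.

Lemma cyclic_shuffle_left ca ca' cb c :
  same_cycle ca ca' -> cyclic_shuffle ca cb c = cyclic_shuffle ca' cb c.
Proof.
move=> caa'; rewrite /cyclic_shuffle -(same_cycle_left _ caa').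
congr (same_cycle _ _ && _); apply: eq_filter => i; rewrite !inE.
exact/perm_mem/same_cycle_perm.
Qed.

End CyclicWords.

Lemma same_cycle_pmap (T T' : eqType) (f : T -> option T') (a b : seq T) :
  same_cycle a b -> same_cycle (pmap f a) (pmap f b).
Proof.
by case/same_cycleP=> r ->; apply/same_cycleP; apply: pmap_rot.
Qed.

Lemma same_cycle_map (T T' : eqType) (f : T -> T') (a b : seq T) :
  same_cycle a b -> same_cycle (map f a) (map f b).
Proof.
by case/same_cycleP=> r ->; apply/same_cycleP; exists r; rewrite map_rot.
Qed.

Lemma same_cycle_map_inj (T T' : eqType) (f : T -> T') (a b : seq T) :
  injective f -> same_cycle (map f a) (map f b) = same_cycle a b.
Proof.
move=> f_inj; apply/idP/idP; last exact: same_cycle_map.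
case/same_cycleP=> r; rewrite -map_rot => /(inj_map f_inj) ->.
by apply/same_cycleP; exists r.
Qed.

(** The two maps are asked to be inverse only on the indices that are summed; the maps used below,
    such as rotating to a given head or dropping two letters, are not inverse elsewhere. *)
Lemma big_seq_bij (T1 T2 : eqType) (V : nmodType) (r1 : seq T1) (r2 : seq T2)
    (P1 : pred T1) (P2 : pred T2) (f : T1 -> T2) (g : T2 -> T1) F1 F2 :
  uniq r1 -> uniq r2 ->
  (forall x, x \in r1 -> P1 x ->
     [/\ f x \in r2, P2 (f x), g (f x) = x & F1 x = F2 (f x) :> V]) ->
  (forall y, y \in r2 -> P2 y -> [/\ g y \in r1, P1 (g y) & f (g y) = y]) ->
  \sum_(x <- r1 | P1 x) F1 x = \sum_(y <- r2 | P2 y) F2 y.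
Proof.
move=> u1 u2 H1 H2; rewrite -big_filter -[RHS]big_filter.
have -> : \sum_(x <- filter P1 r1) F1 x = \sum_(x <- filter P1 r1) F2 (f x).
  apply: eq_big_seq => x; rewrite mem_filter => /andP[Px xr].
  by have [] := H1 x xr Px.
rewrite -(big_map f xpredT F2); apply: perm_big; apply: uniq_perm.
- rewrite map_inj_in_uniq ?filter_uniq // => x y.
  rewrite !mem_filter => /andP[Px xr] /andP[Py yr] fxy.
  by have [_ _ <- _] := H1 x xr Px; have [_ _ <- _] := H1 y yr Py; rewrite fxy.
- exact: filter_uniq.
move=> y; apply/mapP/idP => [[x + ->]|]; rewrite !mem_filter => /andP[Py yr].
  by have [-> ->] := H1 x yr Py.
by have [gr Pg fg] := H2 y yr Py; exists (g y); rewrite // mem_filter gr Pg.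
Qed.

(** A cycle on distinct points has one reading from each of them, and [f] takes the same value on
    all these readings. *)
Lemma sum_permutations_rooted (T : eqType) (V : nmodType) (s : seq T)
    (e : T) (f : seq T -> V) :
  uniq s -> e \in s ->
  {in permutations s, forall c c', same_cycle c c' -> f c = f c'} ->
  \sum_(c <- permutations s) f c =
  (\sum_(c <- permutations s | ohead c == Some e) f c) *+ size s.
Proof.
move=> us es rotf.
have base e' : e' \in s ->
    \sum_(c <- permutations s | ohead c == Some e') f c =
    \sum_(c <- permutations s | ohead c == Some e) f c.
  move=> e's.
  have root x y c : x \in s -> y \in s -> c \in permutations s ->
      ohead c == Some x ->
      [/\ rot (index y c) c \in permutations s,
          ohead (rot (index y c) c) == Some y,
          rot (index x (rot (index y c) c)) (rot (index y c) c) = c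
        & f c = f (rot (index y c) c)].
    move=> xs ys cs hc; have pc : perm_eq c s by rewrite -mem_permutations.
    have yc : y \in c by rewrite (perm_mem pc).
    have uc : uniq c by rewrite (perm_uniq pc).
    split.
    - by rewrite mem_permutations (perm_trans _ pc) // perm_rot.
    - by rewrite rot_index.
    - case: c hc cs pc yc uc => //= z c /eqP[->] {z} _ _ yc uc.
      case: (eqVneq x y) yc => [<- _|xy yc]; first by rewrite /= rot0 /= eqxx rot0.
      have yc' : y \in c by move: yc; rewrite inE eq_sym (negPf xy).
      rewrite /=; set i := (index y c).+1; have isz : (i < size (x :: c))%N.
        by rewrite /= ltnS index_mem.
      (* The old head [x] lands just after the [size - i] letters moved to the front, so rotating
         back to [x] is the inverse rotation. *)
      have -> : index x (rot i (x :: c)) = (size (rot i (x :: c)) - i)%N.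
        rewrite /rot index_cat size_cat size_take size_drop isz.
        have -> : (x \in drop i (x :: c)) = false.
          apply/negP=> /= /mem_drop; move: uc => /= /andP[/negPf->].
          by [].
        rewrite /= eqxx addn0 /=; move: isz => /=; lia.
      exact: rotK.
    - by apply: rotf => //; apply/same_cycleP; exists (index y c).
  apply: (@big_seq_bij _ _ _ _ _ _ _ (fun c => rot (index e c) c)
            (fun c => rot (index e' c) c)); rewrite ?permutations_uniq //.
  - by move=> c cs hc; have [] := root e' e c e's es cs hc.
  - by move=> c cs hc; have [] := root e e' c es e's cs hc.
transitivity (\sum_(e' <- s) \sum_(c <- permutations s | ohead c == Some e') f c).
  rewrite (exchange_big_dep xpredT) //= big_seq [RHS]big_seq; apply: eq_bigr => c.
  rewrite mem_permutations => pc.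
  case: c pc => [|x c] pc; first by move: es; rewrite -(perm_mem pc).
  have xs : x \in s by rewrite -(perm_mem pc) mem_head.
  rewrite -big_filter.
  have -> : [seq i <- s | ohead (x :: c) == Some i] = [:: x].
    transitivity [seq i <- s | pred1 x i].
      by apply: eq_filter => i /=; rewrite eq_sym.
    by apply: filter_pred1_uniq.
  by rewrite big_seq1.
rewrite big_seq (eq_bigr _ base) -big_seq big_const_seq count_predT.
by rewrite iter_addr_0.
Qed.

Lemma sum_permutations_rooted_cond (T : eqType) (V : nmodType) (s : seq T)
    (e : T) (P : pred (seq T)) (f : seq T -> V) :
  uniq s -> e \in s ->
  {in permutations s, forall c c', same_cycle c c' -> P c = P c' /\ f c = f c'} ->
  \sum_(c <- permutations s | P c) f c =
  (\sum_(c <- permutations s | (ohead c == Some e) && P c) f c) *+ size s.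
Proof.
move=> us es rotf; rewrite big_mkcond big_mkcondr.
by apply: sum_permutations_rooted => // c cs c' /(rotf c cs)[-> ->].
Qed.

(** * Contracting arcs in cyclic shuffles *)

Section Shuffles.
Variable R : realType.

(** Total on configurations: one that is not a graph gets the class 0, which frees the symmetry
    rules below from validity hypotheses. *)
Definition drawing_class n p q (x : labelled n p q) : D_e R :=
  graph_class (basis_vector R x).

Lemma graph_class_relation (c : {freeg graph / R}) :
  c \in @relations R -> graph_class c = 0.
Proof.
by move=> Rc; rewrite -[0](raddf0 (@graph_class R)); apply/graph_class_eq;
  rewrite subr0.
Qed.

Lemma graph_classZ a (c : {freeg graph / R}) :
  graph_class (a *: c) = a *: graph_class c.
Proof. exact: linearZ. Qed.

Lemma drawing_class_nongraph n p q (x : labelled n p q) :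
  ~~ is_graph x -> drawing_class x = 0.
Proof.
move=> ngx; rewrite /drawing_class /basis_vector; case: insubP => [g /= gx|_].
  by rewrite gx in ngx.
exact: raddf0.
Qed.

Lemma drawing_class_isomorphic n p q (x y : labelled n p q) :
  is_graph x -> is_graph y -> isomorphic x y ->
  drawing_class x = drawing_class y.
Proof.
move=> gx gy xy; apply/esym/graph_class_eq; exact: basis_vector_isomorphic.
Qed.

Lemma drawing_class_same_cycle n p q (c c' : seq 'I_n)
    (E : {ffun 'I_q -> vertex n p * vertex n p}) :
  same_cycle c c' -> drawing_class (c, E) = drawing_class (c', E).
Proof.
have sub a b : same_cycle a b -> is_graph ((a, E) : labelled n p q) ->
    is_graph ((b, E) : labelled n p q).
  by case/same_cycleP=> r ->; exact: (@is_graph_rotate n p q r (a, E)).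
move=> cc'; have [g|ng] := boolP (is_graph ((c, E) : labelled n p q)).
  apply: drawing_class_isomorphic => //; first exact: sub g.
  by case/same_cycleP: cc' => r ->; apply: (@isomorphic_rotate n p q r (c, E)).
rewrite !drawing_class_nongraph //; apply: contra ng.
by apply: sub; rewrite same_cycle_sym.
Qed.

Lemma relabel_extK n p q (s : 'S_n) :
  cancel (@relabel_ext n p q s) (relabel_ext s^-1%g).
Proof.
case=> c E; congr pair; rewrite /circle /ends /=.
  by rewrite -map_comp map_id_in // => i _ /=; rewrite permK.
apply/ffunP=> a; rewrite !ffunE; case: (E a) => -[i|u] [j|v];
  by rewrite /map_vertex /= ?permK.
Qed.

Lemma relabel_edgesK n p q (s : 'S_q) :
  cancel (@relabel_edges n p q s) (relabel_edges s^-1%g).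
Proof.
by case=> c E; congr pair; apply/ffunP=> a; rewrite !ffunE permKV.
Qed.

Lemma drawing_class_relabel_ext n p q (s : 'S_n) (x : labelled n p q) :
  drawing_class (relabel_ext s x) = (-1) ^+ s *: drawing_class x.
Proof.
have [gx|ngx] := boolP (is_graph x).
  rewrite /drawing_class -graph_classZ; apply/graph_class_eq.
  exact/relator_relations/RelExt.
rewrite !drawing_class_nongraph ?scaler0 //; apply: contra ngx.
by move/(is_graph_relabel_ext s^-1%g); rewrite relabel_extK.
Qed.

Lemma drawing_class_relabel_edges n p q (s : 'S_q) (x : labelled n p q) :
  drawing_class (relabel_edges s x) = (-1) ^+ s *: drawing_class x.
Proof.
have [gx|ngx] := boolP (is_graph x).
  rewrite /drawing_class -graph_classZ; apply/graph_class_eq.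
  exact/relator_relations/RelEdges.
rewrite !drawing_class_nongraph ?scaler0 //; apply: contra ngx.
by move/(is_graph_relabel_edges s^-1%g); rewrite relabel_edgesK.
Qed.

Lemma drawing_class_multiple n p q (x : labelled n p q) :
  has_multiple_edge x -> drawing_class x = 0.
Proof.
move=> mx; have [gx|/drawing_class_nongraph//] := boolP (is_graph x).
exact/graph_class_relation/relator_relations/RelMultiple.
Qed.

Lemma drawing_class_loop n p q (x : labelled n p q) :
  has_internal_loop x -> drawing_class x = 0.
Proof.
move=> mx; have [gx|/drawing_class_nongraph//] := boolP (is_graph x).
exact/graph_class_relation/relator_relations/RelLoop.
Qed.

Definition contract_ends n p q (h : 'I_n.+1) (l : 'I_n)
    (E : {ffun 'I_q -> vertex n.+1 p * vertex n.+1 p}) :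
    {ffun 'I_q -> vertex n p * vertex n p} :=
  [ffun a => map_vertex (merge_ext h l) (E a)].

(** The division compensates for listing each cycle once per starting point. Two empty words get the
    value 0, by the convention on the inverse of 0; the factor multiplied from the left always has
    external vertices below. *)
Definition shuffle_class n p q (ca cb : seq 'I_n)
    (E : {ffun 'I_q -> vertex n p * vertex n p}) : D_e R :=
  (size (ca ++ cb))%:R^-1 *:
    \sum_(c <- permutations (ca ++ cb) | cyclic_shuffle ca cb c)
      drawing_class (c, E).

Lemma shuffle_classC n p q (ca cb : seq 'I_n)
    (E : {ffun 'I_q -> vertex n p * vertex n p}) :
  shuffle_class ca cb E = shuffle_class cb ca E.
Proof.
have cab : perm_eq (ca ++ cb) (cb ++ ca) by rewrite perm_catC.
rewrite /shuffle_class (perm_size cab); congr (_ *: _).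
rewrite (perm_big _ (perm_permutations cab)).
by apply: eq_bigl => c; rewrite cyclic_shuffleC.
Qed.

Lemma shuffle_class_left n p q (ca ca' cb : seq 'I_n)
    (E : {ffun 'I_q -> vertex n p * vertex n p}) :
  same_cycle ca ca' -> shuffle_class ca cb E = shuffle_class ca' cb E.
Proof.
move=> cc; have cab : perm_eq (ca ++ cb) (ca' ++ cb).
  by rewrite perm_cat2r same_cycle_perm.
rewrite /shuffle_class (perm_size cab); congr (_ *: _).
rewrite (perm_big _ (perm_permutations cab)).
by apply: eq_bigl => c; apply: cyclic_shuffle_left.
Qed.

(** In this form the divisor has disappeared, which makes sums over circles with different numbers
    of points comparable. *)
Lemma shuffle_class_rooted n p q (ca cb : seq 'I_n) (l : 'I_n)
    (E : {ffun 'I_q -> vertex n p * vertex n p}) :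
  uniq (ca ++ cb) -> l \in ca ++ cb ->
  shuffle_class ca cb E =
  \sum_(c <- permutations (ca ++ cb) |
          (ohead c == Some l) && cyclic_shuffle ca cb c) drawing_class (c, E).
Proof.
move=> uab lab; rewrite /shuffle_class (@sum_permutations_rooted_cond _ _ _ l) //.
  rewrite -scaler_nat scalerA mulVf ?scale1r //.
  by rewrite pnatr_eq0; case: (ca ++ cb) lab.
move=> c _ c' cc'; rewrite (cyclic_shuffle_rot _ _ cc').
by rewrite (drawing_class_same_cycle _ cc').
Qed.

Section Arcs.
Variables (n p q : nat) (E : {ffun 'I_q -> vertex n.+1 p * vertex n.+1 p}).
Implicit Types (c ca cb : seq 'I_n.+1) (i j : 'I_n.+1).

Definition arc_class c i j : D_e R :=
  graph_class (arc_term R ((c, E) : labelled n.+1 p q) i j).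

Lemma arc_class_same_cycle c c' i j :
  same_cycle c c' -> arc_class c i j = arc_class c' i j.
Proof.
move=> cc'; rewrite /arc_class /arc_term; case: ifP => _;
  (case: unliftP => // l _; rewrite !graph_classZ; congr (_ *: _));
  by apply: drawing_class_same_cycle; apply: same_cycle_pmap.
Qed.

Lemma arc_class_diag c i : arc_class c i i = 0.
Proof. by rewrite /arc_class /arc_term ltnn unlift_none raddf0. Qed.

Lemma arc_classE c i j l : arc_kept i j = lift (arc_removed i j) l ->
  arc_class c i j = arc_sign R i j *:
    drawing_class (pmap (unlift (arc_removed i j)) c,
                   contract_ends (arc_removed i j) l E).
Proof. by move=> hl; rewrite /arc_class (arc_termE _ _ hl) graph_classZ. Qed.

Lemma arc_removed_neq_kept i j : i != j ->
  exists l : 'I_n, arc_kept i j = lift (arc_removed i j) l.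
Proof.
move=> neq_ij; have neq_hk : arc_removed i j != arc_kept i j.
  by rewrite /arc_removed /arc_kept; case: ifP; rewrite // eq_sym.
by have /unlift_some[l hl _] := neq_hk; exists l.
Qed.

(** Exchanging the labels [i] and [j] everywhere is an odd relabelling and gives the sign. Once the
    two points are merged, exchanging them in the edges has no effect, so exchanging them on the
    circle alone gives the same sign. *)
Lemma arc_class_swap c i j : is_graph ((c, E) : labelled n.+1 p q) ->
  i != j -> next c i = j ->
  arc_class (map (tperm i j) c) j i = - arc_class c i j.
Proof.
set x : labelled n.+1 p q := (c, E) => gx neq_ij cij.
set s := tperm i j.
have neq : i != next (circle x) i by rewrite cij.
have [r [t]] := next_arc gx neq.
rewrite [next _ _]cij => circ.
have grx := is_graph_rotate r gx; have gsrx := is_graph_relabel_ext s grx.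
have /graph_class_eq := arc_term_relabel_ext R grx gsrx neq_ij circ.
rewrite graph_classZ odd_tperm neq_ij scaleN1r tpermL tpermR.
have -> : graph_class (arc_term R (rotate r x) i j) = arc_class c i j.
  by apply: arc_class_same_cycle; rewrite same_cycle_sym; apply/same_cycleP; exists r.
move=> <-; have [l hl] : exists l, arc_kept j i = lift (arc_removed j i) l.
  by apply: arc_removed_neq_kept; rewrite eq_sym.
rewrite (arc_classE _ hl) (arc_termE _ _ hl) graph_classZ; congr (_ *: _).
rewrite /contract_arc -[graph_class _]/(drawing_class _).
have -> : ends (relabel_ext s (rotate r x)) =
    [ffun a => map_vertex (renumber_ext s) (E a)] by [].
have -> : [ffun a => map_vertex (merge_ext (arc_removed j i) l)
    ([ffun a0 => map_vertex (renumber_ext s) (E a0)] a)] =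
    contract_ends (arc_removed j i) l E.
  apply/ffunP=> a; rewrite !ffunE map_vertex_comp; apply: eq_map_vertex.
  case=> //= w; have : (i == arc_removed j i) && (j == lift (arc_removed j i) l) ||
      (j == arc_removed j i) && (i == lift (arc_removed j i) l).
    by rewrite -hl /arc_removed /arc_kept; case: ifP; rewrite !eqxx ?orbT.
  case/orP=> /andP[/eqP Ei /eqP Ej]; rewrite /s; case: tpermP => [->|->|//];
    by rewrite -?Ei Ej -?Ei ?liftK ?unlift_none -?Ei ?liftK ?unlift_none.
apply: drawing_class_same_cycle; apply: same_cycle_pmap.
by rewrite /circle /=; apply: same_cycle_map; apply/same_cycleP; exists r.
Qed.
End Arcs.
End Shuffles.

(** * Consecutive points in a cyclic shuffle *)

Section CyclicWordLemmas.
Variable n : nat.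
Implicit Types (c ca cb : seq 'I_n).

Lemma next_rooted (T : eqType) (c : seq T) i j :
  uniq c -> i \in c -> i != j -> next c i = j ->
  exists t, same_cycle c [:: i, j & t].
Proof.
move=> uc ic neq cij; have [r s rE] := rot_to ic.
have := next_rot r uc i; rewrite cij rE.
case: s rE => [|j' t] rE /=; rewrite eqxx => E; first by rewrite E eqxx in neq.
by exists t; apply/same_cycleP; exists r; rewrite rE E.
Qed.

Lemma next_same_cycle (T : eqType) (c c' : seq T) :
  uniq c -> same_cycle c c' -> next c' =1 next c.
Proof. by move=> uc /same_cycleP[r ->]; apply: next_rot. Qed.

(** Restricting [c] to the letters of [ca] removes nothing between two consecutive letters that are
    both kept. *)
Lemma next_cyclic_shuffle ca cb c i : uniq c -> i \in ca -> i \in c ->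
  cyclic_shuffle ca cb c -> next c i \in ca -> next c i = next ca i.
Proof.
move=> uc ica ic /andP[sa _] nca.
have uf : uniq (filter (mem ca) c) by rewrite filter_uniq.
have uca : uniq ca by rewrite (perm_uniq (same_cycle_perm sa)).
rewrite -(next_same_cycle uca sa).
have [E|neq] := eqVneq i (next c i); last first.
  have [t ct] := next_rooted uc ic neq erefl.
  rewrite -(next_same_cycle uf (same_cycle_filter _ ct)) /= ica nca /=.
  by rewrite eqxx.
(* A letter that is its own successor is the only letter of [c]. *)
have [r s rE] := rot_to ic.
have := next_rot r uc i; rewrite -E rE.
have ur : uniq (i :: s) by rewrite -rE rot_uniq.
case: s ur rE => [|j t] ur rE /=; rewrite eqxx => Ej.
  have ci : same_cycle c [:: i] by apply/same_cycleP; exists r.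
  rewrite -(next_same_cycle uf (same_cycle_filter _ ci)) /= ica /=.
  by rewrite eqxx.
by move: ur; rewrite Ej /= inE eqxx.
Qed.

(** The two neighbours belong to different factors, so each restricted word sees only one of them
    and does not change. *)
Lemma cyclic_shuffle_swap ca cb c i j : uniq c -> i \in c -> i != j ->
  i \in ca -> i \notin cb -> j \in cb -> j \notin ca -> next c i = j ->
  cyclic_shuffle ca cb (map (tperm i j) c) = cyclic_shuffle ca cb c.
Proof.
move=> uc ic neq ia nib jb nja cij.
have [t ct] := next_rooted uc ic neq cij.
rewrite (cyclic_shuffle_rot _ _ ct).
rewrite (cyclic_shuffle_rot _ _ (same_cycle_map (tperm i j) ct)) /=.
rewrite tpermL tpermR.
have -> : [seq tperm i j w | w <- t] = t.
  have : uniq [:: i, j & t] by rewrite -(perm_uniq (same_cycle_perm ct)).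
  case/and3P; rewrite inE negb_or => /andP[_ nit] njt _.
  apply: map_id_in => w wt.
  by rewrite tpermD //; apply: contraTneq wt => <-.
by rewrite /cyclic_shuffle /= ia jb (negPf nib) (negPf nja).
Qed.

End CyclicWordLemmas.

Lemma lift_pmap_unlift n (h : 'I_n.+1) (s : seq 'I_n.+1) :
  h \notin s -> map (lift h) (pmap (unlift h) s) = s.
Proof.
elim: s => //= w s IH; rewrite inE negb_or => /andP[hw /IH E].
by have /unlift_some[w' wE ->] := hw; rewrite /= E -wE.
Qed.

Lemma pmap_unlift_lift n (h : 'I_n.+1) (s : seq 'I_n) :
  pmap (unlift h) (map (lift h) s) = s.
Proof. by elim: s => //= w s IH; rewrite liftK /= IH. Qed.

Lemma notin_map_lift n (h : 'I_n.+1) (s : seq 'I_n) : h \notin map (lift h) s.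
Proof. by apply/mapP=> -[w _ /eqP]; apply/negP; rewrite neq_lift. Qed.

(** This is the contraction of an arc read backwards: the letter [l] is split into the neighbours
    [i] and [j]. With both words rooted at this place, the condition on the first factor becomes an
    equality of tails on either side, and the second factor does not contain the place. *)
Lemma cyclic_shuffle_insert n (h : 'I_n.+1) (l : 'I_n) i j
    (ta cb t : seq 'I_n) :
  (i == h) && (j == lift h l) || (j == h) && (i == lift h l) ->
  l \notin ta -> l \notin cb -> l \notin t ->
  cyclic_shuffle [:: i, j & map (lift h) ta] (map (lift h) cb)
    [:: i, j & map (lift h) t] = cyclic_shuffle (l :: ta) cb (l :: t).
Proof.
move=> ij lta lcb lt; have linj := @lift_inj _ h.
have notin s : l \notin s -> i \notin map (lift h) s /\ j \notin map (lift h) s.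
  move=> ls; have hs := notin_map_lift h s.
  by case/orP: ij => /andP[/eqP-> /eqP->]; rewrite (mem_map linj).
have neq : i != j.
  by case/orP: ij => /andP[/eqP-> /eqP->]; rewrite ?neq_lift // eq_sym neq_lift.
have filter_cons2 (s u : seq 'I_n.+1) : i \notin u -> j \notin u ->
    filter (mem [:: i, j & s]) u = filter (mem s) u.
  move=> iu ju; apply: eq_in_filter => w wu /=; rewrite !inE.
  case: eqP => [E|_] /=; first by rewrite -E wu in iu.
  by case: eqP => [E|_] //; rewrite -E wu in ju.
have filter_cons1 (s u : seq 'I_n) : l \notin u ->
    filter (mem (l :: s)) u = filter (mem s) u.
  move=> lu; apply: eq_in_filter => w wu /=; rewrite !inE.
  by case: eqP => [E|_] //=; rewrite -E wu in lu.
have filter_lift (s u : seq 'I_n) :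
    filter (mem (map (lift h) s)) (map (lift h) u) =
    map (lift h) (filter (mem s) u).
  rewrite filter_map; congr map; apply: eq_filter => w /=.
  exact: mem_map.
have [ita jta] := notin _ lta; have [icb jcb] := notin _ lcb.
have [it jt] := notin _ lt.
rewrite /cyclic_shuffle; congr andb.
  rewrite /= !inE !eqxx orbT /= same_cycle_cons; last first.
    by rewrite inE negb_or neq.
  rewrite eqseq_cons eqxx /= filter_cons2 // filter_lift.
  rewrite filter_cons1 // same_cycle_cons // (inj_eq (inj_map linj)).
  by [].
rewrite /= (negPf icb) (negPf jcb) (negPf lcb) filter_lift.
exact: same_cycle_map_inj.
Qed.

Section ArcSums.
Variable R : realType.
Variables (n p q : nat) (E : {ffun 'I_q -> vertex n.+1 p * vertex n.+1 p}).
Implicit Types (c ca cb : seq 'I_n.+1) (i j : 'I_n.+1).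

(* The contraction, in all the shuffles of [ca] and [cb] where they are
   consecutive, of two points which are consecutive on [ca] or on [cb]. *)
Definition shuffle_arc ca cb i j : D_e R :=
  if unlift (arc_removed i j) (arc_kept i j) is Some l
  then arc_sign R i j *:
    shuffle_class R (pmap (unlift (arc_removed i j)) ca)
      (pmap (unlift (arc_removed i j)) cb)
      (contract_ends (arc_removed i j) l E)
  else 0.

Lemma shuffle_arcC ca cb i j : shuffle_arc ca cb i j = shuffle_arc cb ca i j.
Proof.
by rewrite /shuffle_arc; case: unlift => // l; rewrite shuffle_classC.
Qed.

Definition arc_sum ca cb i j : D_e R :=
  \sum_(c <- permutations (ca ++ cb) | cyclic_shuffle ca cb c && (next c i == j))
    arc_class R E c i j.

Lemma arc_sumC ca cb i j : arc_sum ca cb i j = arc_sum cb ca i j.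
Proof.
have cab : perm_eq (ca ++ cb) (cb ++ ca) by rewrite perm_catC.
rewrite /arc_sum (perm_big _ (perm_permutations cab)).
by apply: eq_bigl => c; rewrite cyclic_shuffleC.
Qed.

Section Complementary.
Variables ca cb : seq 'I_n.+1.
Hypothesis cab_enum : perm_eq (ca ++ cb) (enum 'I_n.+1).

Let cab_uniq : uniq (ca ++ cb).
Proof. by rewrite (perm_uniq cab_enum) enum_uniq. Qed.

Let mem_cab i : i \in ca ++ cb.
Proof. by rewrite (perm_mem cab_enum) mem_enum. Qed.

(** Shuffles in which [j] follows [i] correspond to shuffles of the contracted factor. The left side
    counts all [n.+1] readings of each shuffle, while [shuffle_arc] is normalized; hence the
    multiplicity. *)
Lemma arc_sum_same i : i \in ca ->
  arc_sum ca cb i (next ca i) = shuffle_arc ca cb i (next ca i) *+ n.+1.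
Proof.
move=> ica; set j := next ca i.
have uca : uniq ca by move: cab_uniq; rewrite cat_uniq => /and3P[].
(* If [i] is its own successor on [ca], there is no arc to contract and both sides vanish by the
   conventions for equal ends. *)
have [ij|neq] := eqVneq i j.
  rewrite -ij /shuffle_arc /arc_removed /arc_kept ltnn unlift_none mul0rn.
  by rewrite /arc_sum big1 // => c _; apply: arc_class_diag.
have [l hl] := arc_removed_neq_kept neq.
rewrite /shuffle_arc hl liftK; set h := arc_removed i j in hl *.
have ijh : (i == h) && (j == lift h l) || (j == h) && (i == lift h l).
  by rewrite -hl /h /arc_removed /arc_kept; case: ifP; rewrite !eqxx ?orbT.
have size_cab : size (ca ++ cb) = n.+1.
  by rewrite (perm_size cab_enum) size_enum_ord.
have [ta caE] := next_rooted uca ica neq erefl.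
have u_ijab : uniq ([:: i, j & ta] ++ cb).
  by rewrite -(perm_uniq (_ : perm_eq (ca ++ cb) _)) // perm_cat2r same_cycle_perm.
have hijta : h \notin ta /\ lift h l \notin ta.
  move: u_ijab => /= /and3P[]; rewrite inE negb_or !mem_cat !negb_or.
  move=> /andP[_ /andP[ita _]] /andP[jta _] _.
  by case/orP: ijh => /andP[/eqP <- /eqP <-].
have hijcb : h \notin cb /\ lift h l \notin cb.
  move: u_ijab => /= /and3P[]; rewrite inE negb_or !mem_cat !negb_or.
  move=> /andP[_ /andP[_ icb]] /andP[_ jcb] _.
  by case/orP: ijh => /andP[/eqP <- /eqP <-].
pose ta' := pmap (unlift h) ta; pose cb' := pmap (unlift h) cb.
have taE : ta = map (lift h) ta' by rewrite lift_pmap_unlift; case: hijta.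
have cbE : cb = map (lift h) cb' by rewrite lift_pmap_unlift; case: hijcb.
have lta' : l \notin ta' by case: hijta => _; rewrite taE (mem_map (@lift_inj _ h)).
have lcb' : l \notin cb' by case: hijcb => _; rewrite cbE (mem_map (@lift_inj _ h)).
have ca'E : same_cycle (pmap (unlift h) ca) (l :: ta').
  apply: (@same_cycle_trans _ (pmap (unlift h) [:: i, j & ta])).
    exact: same_cycle_pmap.
  rewrite [pmap _ _]/= -/ta'; have [/andP[/eqP-> /eqP->]|/andP[/eqP-> /eqP->]] := orP ijh;
    by rewrite unlift_none liftK /= same_cycle_refl.
have ca'_enum : perm_eq ((l :: ta') ++ cb') (enum 'I_n).
  apply: perm_trans (perm_eq_unlift h cab_enum).
  by rewrite pmap_cat perm_cat2r perm_sym same_cycle_perm.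
have uca' : uniq ((l :: ta') ++ cb') by rewrite (perm_uniq ca'_enum) enum_uniq.
rewrite (shuffle_class_left _ _ _ ca'E) (@shuffle_class_rooted _ _ _ _ _ _ l) ?mem_head //.
rewrite /arc_sum (@sum_permutations_rooted_cond _ _ _ i) //; last first.
  move=> c; rewrite mem_permutations => pc c' cc'.
  have uc : uniq c by rewrite (perm_uniq pc).
  rewrite -(cyclic_shuffle_rot _ _ cc') (next_same_cycle uc cc').
  by rewrite (arc_class_same_cycle _ _ _ _ cc').
rewrite size_cab; congr (_ *+ _); rewrite scaler_sumr.
(* Words rooted at [i] begin with [i, j]; this pair is traded for the merged letter [l], the head of
   the contracted word. *)
apply: (@big_seq_bij (seq 'I_n.+1) (seq 'I_n) _ _ _ _ _
    (fun c => l :: pmap (unlift h) (drop 2 c))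
    (fun d => [:: i, j & map (lift h) (behead d)]));
  rewrite ?permutations_uniq //.
- move=> c; rewrite mem_permutations => pc /andP[hc /andP[Wc /eqP cij]].
  have uc : uniq c by rewrite (perm_uniq pc).
  have [t cE] : exists t, c = [:: i, j & t].
    case: c hc cij uc {pc Wc} => // i' [|j' t] /eqP[->] /=; rewrite eqxx => Ej _.
      by rewrite Ej eqxx in neq.
    by exists t; rewrite Ej.
  subst c; rewrite /= drop0.
  have ht : h \notin t /\ lift h l \notin t.
    move: uc => /= /and3P[]; rewrite inE negb_or => /andP[_ it] jt _.
    by case/orP: ijh => /andP[/eqP <- /eqP <-].
  have tE : t = map (lift h) (pmap (unlift h) t).
    by rewrite lift_pmap_unlift; case: ht.
  have lt : l \notin pmap (unlift h) t.
    by case: ht => _; rewrite {1}tE (mem_map (@lift_inj _ h)).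
  have pijt : pmap (unlift h) [:: i, j & t] = l :: pmap (unlift h) t.
    rewrite /=; have [/andP[/eqP-> /eqP->]|/andP[/eqP-> /eqP->]] := orP ijh;
      by rewrite unlift_none liftK.
  split.
  - rewrite mem_permutations -pijt.
    rewrite perm_sym (perm_trans ca'_enum) // perm_sym.
    by apply: perm_eq_unlift; apply: perm_trans pc cab_enum.
  - rewrite eqxx /= -(cyclic_shuffle_insert ijh) // -tE -taE -cbE.
    by rewrite -(cyclic_shuffle_left _ _ caE).
  - by rewrite -tE.
  - rewrite (arc_classE _ _ _ hl) -/h; congr (_ *: drawing_class _ (_, _)).
    exact: pijt.
move=> c'; rewrite mem_permutations => pc' /andP[hc' Wc'].
case: c' pc' hc' Wc' => // l' t pc' /eqP[El] Wc'.
rewrite {l'}El in pc' Wc' *; rewrite [behead _]/=.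
have uc' : uniq (l :: t) by rewrite (perm_uniq pc').
have lt : l \notin t by case/andP: uc'.
split.
- rewrite mem_permutations; apply: uniq_perm => //.
    rewrite /= (map_inj_uniq (@lift_inj _ h)) inE negb_or neq /=.
    have ht := notin_map_lift h t.
    by case/orP: ijh => /andP[/eqP-> /eqP->]; rewrite (mem_map (@lift_inj _ h));
      rewrite lt ht /=; case/andP: uc'.
  move=> w; rewrite mem_cab.
  have Ew : (w == i) || (w == j) = (w == h) || (w == lift h l).
    by case/orP: ijh => /andP[/eqP-> /eqP->] //; rewrite orbC.
  rewrite !inE orbA Ew; case: (unliftP h w) => [w' ->|->]; last by rewrite eqxx.
  rewrite (mem_map (@lift_inj _ h)) eq_sym (negPf (neq_lift _ _)) /=.
  rewrite (inj_eq (@lift_inj _ h)) -in_cons (perm_mem pc') (perm_mem ca'_enum).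
  exact: mem_enum.
- rewrite /= !eqxx /= andbT (cyclic_shuffle_left _ _ caE) taE cbE.
  by rewrite (cyclic_shuffle_insert ijh).
- by rewrite /= drop0 pmap_unlift_lift.
Qed.

(** Among the letters of [ca], only the successor of [i] on [ca] can directly follow [i] in a
    shuffle. *)
Lemma arc_sum_neighbours i : i \in ca ->
  \sum_(j <- ca) arc_sum ca cb i j = shuffle_arc ca cb i (next ca i) *+ n.+1.
Proof.
move=> ica; have uca : uniq ca by move: cab_uniq; rewrite cat_uniq => /and3P[].
rewrite (bigD1_seq (next ca i)) ?mem_next //= arc_sum_same // big_seq_cond.
rewrite big1 ?addr0 // => j /andP[jca neq]; rewrite /arc_sum big_seq_cond big1 //.
move=> c; rewrite mem_permutations => /and3P[pc Wc /eqP cij].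
have uc : uniq c by rewrite (perm_uniq pc).
have ic : i \in c by rewrite (perm_mem pc).
have := next_cyclic_shuffle uc ica ic Wc; rewrite cij => /(_ jca) E'.
by rewrite E' eqxx in neq.
Qed.

Hypothesis graph_E : forall c, perm_eq c (enum 'I_n.+1) ->
  is_graph ((c, E) : labelled n.+1 p q).

(** Exchanging the neighbours [i] and [j] is an involution that carries the shuffles with [j] after
    [i] to those with [i] after [j], and [arc_class_swap] gives opposite contractions. *)
Lemma arc_sum_swap i j : i \in ca -> j \in cb ->
  arc_sum ca cb i j = - arc_sum ca cb j i.
Proof.
move=> ica jcb.
have /and3P[_ /hasPn ncab _] : [&& uniq ca, ~~ has [in ca] cb & uniq cb].
  by rewrite -cat_uniq.
have jnca : j \notin ca by apply: ncab.
have incb : i \notin cb by apply: contraL ica => /ncab.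
have neq : i != j by apply: contraTneq ica => ->.
rewrite /arc_sum -sumrN.
have swapK : involutive (map (tperm i j)).
  by move=> c; rewrite -map_comp map_id_in // => w _ /=; rewrite tpermK.
have mem_swap c : c \in permutations (ca ++ cb) ->
    map (tperm i j) c \in permutations (ca ++ cb).
  rewrite !mem_permutations => pc.
  apply: uniq_perm => //; first by rewrite map_inj_uniq ?(perm_uniq pc) //; apply: perm_inj.
  move=> w; rewrite mem_cab -(tpermK i j w) (mem_map perm_inj).
  by rewrite (perm_mem pc) mem_cab.
apply: (@big_seq_bij (seq 'I_n.+1) (seq 'I_n.+1) _ _ _ _ _
    (map (tperm i j)) (map (tperm i j)));
  rewrite ?permutations_uniq //.
- move=> c cp /andP[Wc /eqP cij].
  have pc : perm_eq c (ca ++ cb) by rewrite -mem_permutations.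
  have uc : uniq c by rewrite (perm_uniq pc).
  have ic : i \in c by rewrite (perm_mem pc).
  split=> //; first exact: mem_swap.
    rewrite cyclic_shuffle_swap // Wc -{2}(tpermL i j) next_map //; last exact: perm_inj.
    by rewrite cij tpermR eqxx.
  rewrite arc_class_swap ?opprK //; apply: graph_E; exact: perm_trans pc cab_enum.
- move=> c cp /andP[Wc /eqP cji].
  have pc : perm_eq c (ca ++ cb) by rewrite -mem_permutations.
  have uc : uniq c by rewrite (perm_uniq pc).
  have jc : j \in c by rewrite (perm_mem pc).
  split=> //; first exact: mem_swap.
  rewrite cyclic_shuffleC tpermC cyclic_shuffle_swap 1?eq_sym // cyclic_shuffleC Wc.
  rewrite -{2}(tpermL j i) next_map //; last exact: perm_inj.
  by rewrite cji tpermR eqxx.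
Qed.

End Complementary.

(** Splitting the arcs by the factors of their two ends gives four sums; the two mixed ones cancel
    by [arc_sum_swap]. *)
Lemma sum_arc_classes ca cb : perm_eq (ca ++ cb) (enum 'I_n.+1) ->
  (forall c, perm_eq c (enum 'I_n.+1) ->
     is_graph ((c, E) : labelled n.+1 p q)) ->
  \sum_(c <- permutations (ca ++ cb) | cyclic_shuffle ca cb c)
     \sum_i arc_class R E c i (next c i) =
  (\sum_(i <- ca) shuffle_arc ca cb i (next ca i) +
   \sum_(i <- cb) shuffle_arc ca cb i (next cb i)) *+ n.+1.
Proof.
move=> cab_enum graph_E; rewrite exchange_big /=.
transitivity (\sum_i \sum_j arc_sum ca cb i j).
  apply: eq_bigr => i _; rewrite (partition_big (fun c => next c i) xpredT) //=.
  by apply: eq_bigr => j _; apply: eq_bigr => c /andP[_ /eqP ->].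
have sum_enum (F : 'I_n.+1 -> D_e R) :
    \sum_i F i = \sum_(i <- ca) F i + \sum_(i <- cb) F i.
  by rewrite -big_cat -big_enum; apply/perm_big; rewrite perm_sym.
transitivity (
    \sum_(i <- ca) (\sum_(j <- ca) arc_sum ca cb i j + \sum_(j <- cb) arc_sum ca cb i j) +
    \sum_(i <- cb) (\sum_(j <- ca) arc_sum ca cb i j + \sum_(j <- cb) arc_sum ca cb i j)).
  by rewrite sum_enum; congr (_ + _); apply: eq_bigr => i _; apply: sum_enum.
rewrite !big_split /= [X in _ + X + _]exchange_big /=.
set ab := \sum_(j <- cb) \sum_(i <- ca) arc_sum ca cb i j.
have -> : \sum_(i <- cb) \sum_(j <- ca) arc_sum ca cb i j = - ab.
  rewrite /ab -sumrN big_seq [RHS]big_seq; apply: eq_bigr => j jcb.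
  rewrite -sumrN big_seq [RHS]big_seq; apply: eq_bigr => i ica.
  by rewrite (arc_sum_swap cab_enum graph_E ica jcb) opprK.
rewrite -addrA addNKr.
have ba_enum : perm_eq (cb ++ ca) (enum 'I_n.+1) by rewrite perm_catC.
rewrite mulrnDl; congr (_ + _).
  rewrite -sumrMnl big_seq [RHS]big_seq; apply: eq_bigr => i ic.
  exact: arc_sum_neighbours.
rewrite -sumrMnl big_seq [RHS]big_seq; apply: eq_bigr => i ic.
rewrite shuffle_arcC -(arc_sum_neighbours ba_enum) //.
by apply: eq_bigr => j _; rewrite arc_sumC.
Qed.
End ArcSums.

(** * Contracting edges in a union of two graphs *)

Definition endpoints (n p q : nat) : Type :=
  {ffun 'I_q -> vertex n p * vertex n p}.

Definition embed n p N P (f : 'I_n -> 'I_N) (k : 'I_p -> 'I_P)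
    (v : vertex n p) : vertex N P :=
  match v with inl w => inl (f w) | inr u => inr (k u) end.

(* The edges of the union of two graphs; [sp] tells which of the two graphs an
   edge comes from. *)
Definition glue r s t n p q N P Q (fx : vertex r s -> vertex N P)
    (fy : vertex n p -> vertex N P) (sp : 'I_Q -> 'I_t + 'I_q)
    (D : endpoints r s t) (E : endpoints n p q) : endpoints N P Q :=
  [ffun a => match sp a with
             | inl b => map_vertex fx (D b)
             | inr b => map_vertex fy (E b)
             end].

Definition swap_sum (A B : Type) (v : A + B) : B + A :=
  match v with inl a => inr a | inr b => inl b end.

Lemma glueC r s t n p q N P Q (fx : vertex r s -> vertex N P)
    (fy : vertex n p -> vertex N P) (sp : 'I_Q -> 'I_t + 'I_q)
    (D : endpoints r s t) (E : endpoints n p q) :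
  glue fx fy sp D E = glue fy fx (fun a => swap_sum (sp a)) E D.
Proof. by apply/ffunP=> a; rewrite !ffunE /=; case: (sp a). Qed.

Definition contract_edge_ends n p q (a : 'I_q.+1) (u : 'I_p.+1) (y : vertex n p)
    (E : endpoints n p.+1 q.+1) : endpoints n p q :=
  [ffun b => map_vertex (merge_int u y) (E (lift a b))].

Lemma pmap_map_some (A B C : Type) (f : A -> B) (g : A -> C) (h : B -> option C)
    (s : seq A) : (forall a, h (f a) = Some (g a)) ->
  pmap h (map f s) = map g s.
Proof. by move=> hfg; elim: s => //= a s ->; rewrite hfg. Qed.

Lemma pmap_map_omap (A A' B C : Type) (f : A -> B) (g : A' -> C)
    (h : B -> option C) (k : A -> option A') (s : seq A) :
  (forall a, h (f a) = omap g (k a)) -> pmap h (map f s) = map g (pmap k s).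
Proof. by move=> hfg; elim: s => //= a s ->; rewrite hfg; case: (k a). Qed.

Section Gluing.
Variable R : realType.

Section ArcRight.
Variables r n N s p P t q Q : nat.
Variables (f : 'I_r -> 'I_N.+1) (f' : 'I_r -> 'I_N).
Variables (g : 'I_n.+1 -> 'I_N.+1) (g' : 'I_n -> 'I_N).
Variables (kx : 'I_s -> 'I_P) (ky : 'I_p -> 'I_P) (sp : 'I_Q -> 'I_t + 'I_q).
Hypothesis g_f : forall h a, unlift (g h) (f a) = Some (f' a).
Hypothesis g_g : forall h b, unlift (g h) (g b) = omap g' (unlift h b).
Hypothesis g_mono : forall i j, (g i < g j)%N = (i < j)%N.

Lemma contract_ends_glue h l (D : endpoints r s t) (E : endpoints n.+1 p q) :
  contract_ends (g h) (g' l) (glue (embed f kx) (embed g ky) sp D E) =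
  glue (embed f' kx) (embed g' ky) sp D (contract_ends h l E).
Proof.
apply/ffunP=> a; rewrite !ffunE; case: (sp a) => b; rewrite ?ffunE !map_vertex_comp.
  by apply: eq_map_vertex; case=> //= w; rewrite g_f.
by apply: eq_map_vertex; case=> //= w; rewrite g_g; case: unliftP.
Qed.

(** The embeddings are arbitrary because [r + n.+1] and [(r + n).+1] are convertible only when [r]
    is a numeral. Contractions in the left factor have no such difficulty, as [r.+1 + n] reduces. *)
Lemma shuffle_arc_glue_right (D : endpoints r s t) (E : endpoints n.+1 p q)
    (cx : seq 'I_r) (cy : seq 'I_n.+1) i j :
  shuffle_arc R (glue (embed f kx) (embed g ky) sp D E) (map f cx) (map g cy)
    (g i) (g j) =
  if unlift (arc_removed i j) (arc_kept i j) is Some l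
  then arc_sign R (g i) (g j) *:
    shuffle_class R (map f' cx) (map g' (pmap (unlift (arc_removed i j)) cy))
      (glue (embed f' kx) (embed g' ky) sp D (contract_ends (arc_removed i j) l E))
  else 0.
Proof.
have -> : shuffle_arc R (glue (embed f kx) (embed g ky) sp D E) (map f cx)
    (map g cy) (g i) (g j) =
  if unlift (g (arc_removed i j)) (g (arc_kept i j)) is Some l
  then arc_sign R (g i) (g j) *:
    shuffle_class R (pmap (unlift (g (arc_removed i j))) (map f cx))
      (pmap (unlift (g (arc_removed i j))) (map g cy))
      (contract_ends (g (arc_removed i j)) l
         (glue (embed f kx) (embed g ky) sp D E))
  else 0.
  by rewrite /shuffle_arc /arc_removed /arc_kept g_mono; case: ifP.
rewrite g_g; case: (unlift (arc_removed i j) (arc_kept i j)) => [l|]; last by [].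
rewrite [omap _ _]/=; cbv beta iota.
rewrite contract_ends_glue (pmap_map_some _ (g_f _)).
by rewrite (pmap_map_omap _ (g_g _)).
Qed.
End ArcRight.

Lemma shuffle_arc_glue_left r n N s p P t q Q
    (f : 'I_r.+1 -> 'I_N.+1) (f' : 'I_r -> 'I_N)
    (g : 'I_n -> 'I_N.+1) (g' : 'I_n -> 'I_N)
    (kx : 'I_s -> 'I_P) (ky : 'I_p -> 'I_P) (sp : 'I_Q -> 'I_t + 'I_q)
    (D : endpoints r.+1 s t) (E : endpoints n p q)
    (cx : seq 'I_r.+1) (cy : seq 'I_n) i j :
  (forall h a, unlift (f h) (g a) = Some (g' a)) ->
  (forall h b, unlift (f h) (f b) = omap f' (unlift h b)) ->
  (forall i j, (f i < f j)%N = (i < j)%N) ->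
  shuffle_arc R (glue (embed f kx) (embed g ky) sp D E) (map f cx) (map g cy)
    (f i) (f j) =
  if unlift (arc_removed i j) (arc_kept i j) is Some l
  then arc_sign R (f i) (f j) *:
    shuffle_class R (map f' (pmap (unlift (arc_removed i j)) cx)) (map g' cy)
      (glue (embed f' kx) (embed g' ky) sp (contract_ends (arc_removed i j) l D) E)
  else 0.
Proof.
move=> f_g f_f f_mono; rewrite glueC shuffle_arcC.
rewrite (shuffle_arc_glue_right _ _ _ f_g f_f f_mono).
case: (unlift (arc_removed i j) (arc_kept i j)) => [l|]; last by [].
by rewrite shuffle_classC [in RHS]glueC.
Qed.

(** Contracting an edge leaves the word of the circle alone. Abstracting over [Phi] lets one formula
    serve for a single drawing and for a whole shuffle sum. *)
Definition edge_part n (Phi : forall p q, endpoints n p q -> D_e R) p q :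
    endpoints n p q -> 'I_q -> D_e R :=
  match p, q with
  | p'.+1, q'.+1 => fun E a =>
      if merged_ends (E a) is Some (u, y)
      then edge_sign R n a *: Phi p' q' (contract_edge_ends a u y E) else 0
  | _, _ => fun _ _ => 0
  end.

Lemma edge_part_none n Phi p q (E : endpoints n p.+1 q.+1) a :
  merged_ends (E a) = None -> edge_part Phi E a = 0.
Proof. by rewrite /= => ->. Qed.

Section EdgeRight.
Variables r n N s p P t q Q : nat.
Variables (f : 'I_r -> 'I_N) (g : 'I_n -> 'I_N).
Variables (kx : 'I_s -> 'I_P.+1) (kx' : 'I_s -> 'I_P).
Variables (ky : 'I_p.+1 -> 'I_P.+1) (ky' : 'I_p -> 'I_P).
Variables (sp : 'I_Q.+1 -> 'I_t + 'I_q.+1) (sp' : 'I_Q -> 'I_t + 'I_q).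
Variables (a : 'I_Q.+1) (b : 'I_q.+1).
Hypothesis ky_kx : forall u w, unlift (ky u) (kx w) = Some (kx' w).
Hypothesis ky_ky : forall u w, unlift (ky u) (ky w) = omap ky' (unlift u w).
Hypothesis sp_a : sp a = inr b.
Hypothesis sp_lift : forall c, sp (lift a c) =
  match sp' c with inl d => inl d | inr d => inr (lift b d) end.

Lemma merged_ends_embed (e : vertex n p.+1 * vertex n p.+1) :
  merged_ends (map_vertex (embed g ky) e) =
  omap (fun uy => (ky uy.1, embed g ky' uy.2)) (merged_ends e).
Proof.
case: e => [[w|u] [w'|u']] //=; rewrite ky_ky.
by case: unlift.
Qed.

Lemma contract_edge_ends_glue u y (D : endpoints r s t)
    (E : endpoints n p.+1 q.+1) :
  contract_edge_ends a (ky u) (embed g ky' y)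
    (glue (embed f kx) (embed g ky) sp D E) =
  glue (embed f kx') (embed g ky') sp' D (contract_edge_ends b u y E).
Proof.
apply/ffunP=> c; rewrite !ffunE sp_lift; case: (sp' c) => d;
  rewrite ?ffunE !map_vertex_comp.
  by apply: eq_map_vertex; case=> //= w; rewrite ky_kx.
apply: eq_map_vertex; case=> //= w; rewrite ky_ky.
by case: unlift.
Qed.

Lemma edge_part_glue_right Phi (D : endpoints r s t)
    (E : endpoints n p.+1 q.+1) :
  edge_part Phi (glue (embed f kx) (embed g ky) sp D E) a =
  if merged_ends (E b) is Some (u, y)
  then edge_sign R N a *: Phi P Q
         (glue (embed f kx') (embed g ky') sp' D (contract_edge_ends b u y E))
  else 0.
Proof.
rewrite /edge_part ffunE sp_a merged_ends_embed.
by case: merged_ends => //= -[u y] /=; rewrite contract_edge_ends_glue.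
Qed.
End EdgeRight.

Lemma edge_part_glue_left r n N s p P t q Q
    (f : 'I_r -> 'I_N) (g : 'I_n -> 'I_N)
    (kx : 'I_s.+1 -> 'I_P.+1) (kx' : 'I_s -> 'I_P)
    (ky : 'I_p -> 'I_P.+1) (ky' : 'I_p -> 'I_P)
    (sp : 'I_Q.+1 -> 'I_t.+1 + 'I_q) (sp' : 'I_Q -> 'I_t + 'I_q)
    (a : 'I_Q.+1) (b : 'I_t.+1) Phi
    (D : endpoints r s.+1 t.+1) (E : endpoints n p q) :
  (forall u w, unlift (kx u) (ky w) = Some (ky' w)) ->
  (forall u w, unlift (kx u) (kx w) = omap kx' (unlift u w)) ->
  sp a = inl b ->
  (forall c, sp (lift a c) =
     match sp' c with inl d => inl (lift b d) | inr d => inr d end) ->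
  edge_part Phi (glue (embed f kx) (embed g ky) sp D E) a =
  if merged_ends (D b) is Some (u, y)
  then edge_sign R N a *: Phi P Q
         (glue (embed f kx') (embed g ky') sp' (contract_edge_ends b u y D) E)
  else 0.
Proof.
move=> kx_ky kx_kx sp_a sp_lift; rewrite glueC.
rewrite (@edge_part_glue_right _ _ _ _ _ _ _ _ _ _ _ ky ky' kx kx' _
  (fun c => swap_sum (sp' c)) a b) //=.
- by case: merged_ends => // -[u y]; rewrite -glueC.
- by rewrite sp_a.
- by move=> c; rewrite sp_lift; case: (sp' c).
Qed.

Lemma edge_contractions_class n p q (c : seq 'I_n) (E : endpoints n p q) :
  graph_class (edge_contractions R ((c, E) : labelled n p q)) =
  \sum_a edge_part (fun p q E => drawing_class R ((c, E) : labelled n p q)) E a.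
Proof.
case: p q E => [|p] [|q] E; try by rewrite big1 ?raddf0.
rewrite raddf_sum; apply: eq_bigr => a _; rewrite /edge_term /=.
case: merged_ends => [[u y]|].
  exact: graph_classZ.
exact: raddf0.
Qed.

Lemma edge_part_shuffle n p q (ca cb : seq 'I_n) (E : endpoints n p q) a :
  edge_part (fun p q E => shuffle_class R ca cb E) E a =
  (size (ca ++ cb))%:R^-1 *:
    \sum_(c <- permutations (ca ++ cb) | cyclic_shuffle ca cb c)
      edge_part (fun p q E => drawing_class R ((c, E) : labelled n p q)) E a.
Proof.
case: p q E a => [|p] [|q] E a /=; try by rewrite big1 ?scaler0.
case: merged_ends => [[u y]|]; last by rewrite big1 ?scaler0.
by rewrite -scaler_sumr scalerA mulrC -scalerA.
Qed.

Lemma coboundary_drawing_class n p q (x : labelled n p q) :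
  is_graph x -> ~~ has_internal_loop x ->
  coboundary (drawing_class R x) =
  graph_class (arc_contractions R x) + graph_class (edge_contractions R x).
Proof.
move=> gx /negPf lx; rewrite coboundary_class chain_coboundary_basis_vector //.
by rewrite /labelled_coboundary lx raddfD.
Qed.

(** The divisor [n.+1] cancels the multiplicity in [sum_arc_classes], the contracted shuffles having
    their own divisor; for edges the number of points, hence the divisor, stays the same. *)
Lemma coboundary_shuffle_class n p q (ca cb : seq 'I_n.+1)
    (E : endpoints n.+1 p q) :
  perm_eq (ca ++ cb) (enum 'I_n.+1) ->
  (forall c, perm_eq c (enum 'I_n.+1) ->
     is_graph ((c, E) : labelled n.+1 p q)) ->
  (forall c, ~~ has_internal_loop ((c, E) : labelled n.+1 p q)) ->
  coboundary (shuffle_class R ca cb E) =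
  \sum_(i <- ca) shuffle_arc R E ca cb i (next ca i) +
  \sum_(i <- cb) shuffle_arc R E ca cb i (next cb i) +
  \sum_a edge_part (fun p q E => shuffle_class R ca cb E) E a.
Proof.
move=> cab_enum graph_E loop_E.
have size_cab : size (ca ++ cb) = n.+1.
  by rewrite (perm_size cab_enum) size_enum_ord.
rewrite (eq_bigr _ (fun a _ => edge_part_shuffle ca cb E a)) -scaler_sumr.
have -> : \sum_(i <- ca) shuffle_arc R E ca cb i (next ca i) +
    \sum_(i <- cb) shuffle_arc R E ca cb i (next cb i) =
  (size (ca ++ cb))%:R^-1 *:
    \sum_(c <- permutations (ca ++ cb) | cyclic_shuffle ca cb c)
      \sum_i arc_class R E c i (next c i).
  rewrite sum_arc_classes // size_cab -scaler_nat scalerA mulVf ?scale1r //.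
  by rewrite pnatr_eq0.
rewrite /shuffle_class linearZ /= -scalerDr; congr (_ *: _).
rewrite raddf_sum [X in _ + X]exchange_big -big_split /= big_seq_cond [RHS]big_seq_cond.
apply: eq_bigr => c; rewrite mem_permutations => /andP[pc _].
rewrite coboundary_drawing_class ?loop_E //; last first.
  by apply: graph_E; apply: perm_trans pc cab_enum.
congr (_ + _); last exact: edge_contractions_class.
by rewrite /= raddf_sum.
Qed.
End Gluing.

(** * The shuffle product and relabellings *)

Section BlockPermutations.
Variables m n : nat.
Implicit Types (s : 'S_m) (t : 'S_n).

Definition sum_map (f : 'I_m -> 'I_m) (g : 'I_n -> 'I_n) (i : 'I_(m + n)) :
    'I_(m + n) :=
  match split i with inl a => lshift n (f a) | inr b => rshift m (g b) end.

Lemma sum_map_lshift f g a : sum_map f g (lshift n a) = lshift n (f a).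
Proof. by rewrite /sum_map (unsplitK (inl a)). Qed.

Lemma sum_map_rshift f g b : sum_map f g (rshift m b) = rshift m (g b).
Proof. by rewrite /sum_map (unsplitK (inr b)). Qed.

Lemma sum_map_perm_inj s t : injective (sum_map s t).
Proof.
apply: (@can_inj _ _ _ (sum_map s^-1%g t^-1%g)) => i.
rewrite -(splitK i); case: (split i) => a /=.
  by rewrite !sum_map_lshift permK.
by rewrite !sum_map_rshift permK.
Qed.

Definition block_perm s t : 'S_(m + n) := perm (@sum_map_perm_inj s t).

Lemma block_perm_lshift s t a : block_perm s t (lshift n a) = lshift n (s a).
Proof. by rewrite permE sum_map_lshift. Qed.

Lemma block_perm_rshift s t b : block_perm s t (rshift m b) = rshift m (t b).
Proof. by rewrite permE sum_map_rshift. Qed.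

Lemma block_permP s t (u : 'S_(m + n)) :
  (forall a, u (lshift n a) = lshift n (s a)) ->
  (forall b, u (rshift m b) = rshift m (t b)) -> block_perm s t = u.
Proof.
move=> ul ur; apply/permP=> i; rewrite -(splitK i); case: (split i) => a /=.
  by rewrite block_perm_lshift ul.
by rewrite block_perm_rshift ur.
Qed.

Lemma block_permM s1 s2 t1 t2 :
  block_perm (s1 * s2) (t1 * t2) = (block_perm s1 t1 * block_perm s2 t2)%g.
Proof.
by apply: block_permP => a; rewrite !permM ?block_perm_lshift ?block_perm_rshift.
Qed.

(** The two blocks are treated separately, each through a factorization into transpositions, which
    remain transpositions in the larger set. *)
Lemma odd_block_perm s t : block_perm s t = s (+) t :> bool.
Proof.
have -> : block_perm s t = (block_perm s 1 * block_perm 1 t)%g.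
  by rewrite -block_permM mulg1 mul1g.
have block11 : block_perm 1 1 = 1%g.
  by apply: block_permP => a; rewrite !perm1.
rewrite odd_permM; congr (_ (+) _).
  have [ts -> _] := prod_tpermP s; elim: ts => [|[a b] ts IH].
    by rewrite big_nil block11 !odd_perm1.
  rewrite big_cons -[X in block_perm _ X](mulg1 1%g) block_permM !odd_permM IH odd_tperm.
  congr (_ (+) _).
  have -> : block_perm (tperm a b) 1 = tperm (lshift n a) (lshift n b).
    apply: block_permP => c; last by rewrite perm1 tpermD // eq_lrshift.
    case: tpermP => [->|->|ac bc]; rewrite ?tpermL ?tpermR // tpermD //;
      by rewrite (inj_eq (@lshift_inj _ _)) eq_sym; apply/eqP.
  by rewrite odd_tperm (inj_eq (@lshift_inj _ _)).
have [ts -> _] := prod_tpermP t; elim: ts => [|[a b] ts IH].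
  by rewrite big_nil block11 !odd_perm1.
rewrite big_cons -[X in block_perm X _](mulg1 1%g) block_permM !odd_permM IH odd_tperm.
congr (_ (+) _).
have -> : block_perm 1 (tperm a b) = tperm (rshift m a) (rshift m b).
  apply: block_permP => c; first by rewrite perm1 tpermD // eq_rlshift.
  case: tpermP => [->|->|ac bc]; rewrite ?tpermL ?tpermR // tpermD //;
    by rewrite (inj_eq (@rshift_inj _ _)) eq_sym; apply/eqP.
by rewrite odd_tperm (inj_eq (@rshift_inj _ _)).
Qed.
End BlockPermutations.

(* [x'] is [x], up to isomorphism, with its external vertices relabelled by [s]
   and with the label [a] given to its edge [u a]. *)
Definition relabelling n p q (s : 'S_n) (u : 'S_q) (x x' : labelled n p q) : Prop :=
  same_cycle (map s (circle x)) (circle x') /\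
  exists k : 'S_p, forall a,
    same_pair (map_vertex (embed s k) (ends x (u a))) (ends x' a).

Section Star.
Variable R : realType.

Lemma drawing_class_relabelling n p q (s : 'S_n) (u : 'S_q) (x x' : labelled n p q) :
  is_graph x -> is_graph x' -> relabelling s u x x' ->
  drawing_class R x' = (-1) ^+ s * (-1) ^+ u *: drawing_class R x.
Proof.
move=> gx gx' [/same_cycleP[r cE] [k eE]].
rewrite -scalerA -drawing_class_relabel_edges -drawing_class_relabel_ext.
apply/esym/drawing_class_isomorphic => //.
  exact/is_graph_relabel_ext/is_graph_relabel_edges.
split; first by exists r.
exists k => a; move: (eE a); rewrite !ffunE map_vertex_comp.
by congr same_pair; apply: eq_map_vertex; case.
Qed.

Lemma big_cyclic_shuffle_map n (V : nmodType) (s : 'S_n) (ca cb : seq 'I_n)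
    (F : seq 'I_n -> V) :
  \sum_(c <- permutations (map s ca ++ map s cb) |
          cyclic_shuffle (map s ca) (map s cb) c) F c =
  \sum_(c <- permutations (ca ++ cb) | cyclic_shuffle ca cb c) F (map s c).
Proof.
have mapVK : cancel (map s) (map s^-1%g).
  by move=> c; rewrite -map_comp map_id_in // => w _ /=; rewrite permK.
have mapKV : cancel (map s^-1%g) (map s).
  by move=> c; rewrite -map_comp map_id_in // => w _ /=; rewrite permKV.
have filter_map_mem (a c : seq 'I_n) :
    filter (mem (map s a)) (map s c) = map s (filter (mem a) c).
  rewrite filter_map; congr map; apply: eq_filter => w /=.
  by rewrite (mem_map perm_inj).
have shuffle_map c :
    cyclic_shuffle (map s ca) (map s cb) (map s c) = cyclic_shuffle ca cb c.
  rewrite /cyclic_shuffle !filter_map_mem.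
  by rewrite !(same_cycle_map_inj _ _ (@perm_inj _ s)).
rewrite -map_cat; apply/esym.
apply: (@big_seq_bij (seq 'I_n) (seq 'I_n) _ _ _ _ _ (map s) (map s^-1%g));
  rewrite ?permutations_uniq //.
- move=> c; rewrite mem_permutations => pc Wc; split=> //.
    by rewrite mem_permutations perm_map.
  by rewrite shuffle_map.
- move=> c; rewrite mem_permutations => pc Wc; split=> //.
    by rewrite mem_permutations -[ca ++ cb]mapVK perm_map.
  by rewrite -shuffle_map mapKV.
Qed.

Lemma shuffle_class_relabelling n p q (s : 'S_n) (u : 'S_q) (k : 'S_p)
    (ca cb ca' cb' : seq 'I_n) (E E' : endpoints n p q) :
  perm_eq (ca ++ cb) (enum 'I_n) ->
  (forall c, perm_eq c (enum 'I_n) -> is_graph ((c, E) : labelled n p q)) ->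
  (forall c, perm_eq c (enum 'I_n) -> is_graph ((c, E') : labelled n p q)) ->
  same_cycle (map s ca) ca' -> same_cycle (map s cb) cb' ->
  (forall a, same_pair (map_vertex (embed s k) (E (u a))) (E' a)) ->
  shuffle_class R ca' cb' E' = (-1) ^+ s * (-1) ^+ u *: shuffle_class R ca cb E.
Proof.
move=> cab gE gE' sca scb eE.
rewrite -(shuffle_class_left _ _ _ sca) shuffle_classC -(shuffle_class_left _ _ _ scb).
rewrite shuffle_classC /shuffle_class big_cyclic_shuffle_map.
rewrite -map_cat size_map scalerA mulrC -scalerA.
congr (_ *: _); rewrite scaler_sumr big_seq_cond [RHS]big_seq_cond.
apply: eq_bigr => c; rewrite mem_permutations => /andP[pc _].
have pc' : perm_eq c (enum 'I_n) by apply: perm_trans pc cab.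
apply: drawing_class_relabelling; first exact: gE.
  apply: gE'; apply: uniq_perm; rewrite ?enum_uniq //.
    by rewrite (map_inj_uniq (@perm_inj _ s)) (perm_uniq pc') enum_uniq.
  move=> w; rewrite mem_enum -[w](permKV s) (mem_map (@perm_inj _ s)).
  by rewrite (perm_mem pc') mem_enum.
by split; [exact: same_cycle_refl | exists k].
Qed.

Section Glued.
Variables r s t n p q : nat.
Implicit Types (x : labelled r s t) (y : labelled n p q).

Definition left_vertex : vertex r s -> vertex (r + n) (s + p) :=
  embed (lshift n) (lshift p).
Definition right_vertex : vertex n p -> vertex (r + n) (s + p) :=
  embed (@rshift r n) (@rshift s p).

Definition union_ends (D : endpoints r s t) (E : endpoints n p q) :
    endpoints (r + n) (s + p) (t + q) :=
  glue left_vertex right_vertex (@split t q) D E.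

Lemma union_ends_lshift D E a :
  union_ends D E (lshift q a) = map_vertex left_vertex (D a).
Proof. by rewrite ffunE (unsplitK (inl a)). Qed.

Lemma union_ends_rshift D E a :
  union_ends D E (rshift t a) = map_vertex right_vertex (E a).
Proof. by rewrite ffunE (unsplitK (inr a)). Qed.

Lemma is_graph_union x y c : is_graph x -> is_graph y ->
  perm_eq c (enum 'I_(r + n)) ->
  is_graph ((c, union_ends (ends x) (ends y)) : labelled (r + n) (s + p) (t + q)).
Proof.
case/and4P=> _ /forallP xi /forallP xe /forallP xc.
case/and4P=> _ /forallP yi /forallP ye /forallP yc pc.
set z : labelled _ _ _ := (c, _).
have val_l v : (valence x v <= valence z (left_vertex v))%N.
  rewrite /valence big_split_ord; apply: leq_trans (leq_addr _ _).
  apply: leq_sum => a _; rewrite /= union_ends_lshift /=.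
  by apply: leq_add; case: eqP => // ->; rewrite eqxx.
have val_r v : (valence y v <= valence z (right_vertex v))%N.
  rewrite /valence big_split_ord; apply: leq_trans (leq_addl _ _).
  apply: leq_sum => a _; rewrite /= union_ends_rshift /=.
  by apply: leq_add; case: eqP => // ->; rewrite eqxx.
apply/and4P; split=> //; apply/forallP=> v; rewrite -(splitK v);
  case: (split v) => {}v.
- exact: leq_trans (xi v) (val_l _).
- exact: leq_trans (yi v) (val_r _).
- exact: leq_trans (xe v) (val_l _).
- exact: leq_trans (ye v) (val_r _).
- have /existsP[w cvw] := xc v; apply/existsP; exists (lshift n w).
  apply: (connect_map (f := left_vertex)) cvw => {}v {}w /existsP[a evw].
  apply: connect1; apply/existsP; exists (lshift q a).
  by rewrite /= union_ends_lshift; case/orP: evw => /eqP ->; rewrite eqxx ?orbT.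
- have /existsP[w cvw] := yc v; apply/existsP; exists (rshift r w).
  apply: (connect_map (f := right_vertex)) cvw => {}v {}w /existsP[a evw].
  apply: connect1; apply/existsP; exists (rshift t a).
  by rewrite /= union_ends_rshift; case/orP: evw => /eqP ->; rewrite eqxx ?orbT.
Qed.

Lemma perm_eq_union x y : is_graph x -> is_graph y ->
  perm_eq (map (lshift n) (circle x) ++ map (@rshift r n) (circle y))
    (enum 'I_(r + n)).
Proof.
case/and4P=> xc _ _ _ /and4P[yc _ _ _].
apply: uniq_perm; rewrite ?enum_uniq //.
  rewrite cat_uniq (map_inj_uniq (@lshift_inj _ _)) (map_inj_uniq (@rshift_inj _ _)).
  rewrite (perm_uniq xc) (perm_uniq yc) !enum_uniq andbT /=.
  by apply/hasPn=> _ /mapP[b _ ->]; apply/mapP=> -[a _ /eqP]; rewrite eq_rlshift.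
move=> i; rewrite mem_enum mem_cat -(splitK i).
case: (split i) => a /=.
  by rewrite (mem_map (@lshift_inj _ _)) (perm_mem xc) mem_enum.
by rewrite (mem_map (@rshift_inj _ _)) (perm_mem yc) mem_enum orbT.
Qed.

(* The sign moves the [t] edges of [x] past the [n] external vertices of [y], so
   that the coboundary satisfies the Leibniz rule. *)
Definition star x y : D_e R :=
  (-1) ^+ (t * n) *: shuffle_class R (map (lshift n) (circle x))
    (map (@rshift r n) (circle y)) (union_ends (ends x) (ends y)).

Lemma internal_loop_union x y c :
  has_internal_loop ((c, union_ends (ends x) (ends y)) : labelled _ _ _) =
  has_internal_loop x || has_internal_loop y.
Proof.
apply/existsP/orP=> [[a /existsP[v /eqP]]|[]/existsP[a /existsP[v /eqP E]]].
- rewrite -(splitK a); case: (split a) => {}a;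
    rewrite /= ?union_ends_lshift ?union_ends_rshift.
    rewrite -(splitK v); case: (split v) => {}v /=; rewrite /map_vertex;
      case E: (ends x a) => [[w|w] [w'|w']] //= -[] Ew Ew'; last first.
      by have := ltn_ord w; rewrite Ew ltnNge leq_addr.
    left; apply/existsP; exists a; apply/existsP; exists v.
    by rewrite E; apply/eqP; congr (inr _, inr _); apply: val_inj.
  rewrite -(splitK v); case: (split v) => {}v /=; rewrite /map_vertex;
    case E: (ends y a) => [[w|w] [w'|w']] //= -[] Ew Ew'.
    by have := ltn_ord v; rewrite -Ew ltnNge leq_addr.
  right; apply/existsP; exists a; apply/existsP; exists v; rewrite E.
  by apply/eqP; congr (inr _, inr _); apply: val_inj; apply: (@addnI s).
- exists (lshift q a); apply/existsP; exists (lshift p v).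
  by rewrite /= union_ends_lshift E.
- exists (rshift t a); apply/existsP; exists (rshift s v).
  by rewrite /= union_ends_rshift E.
Qed.

Lemma loopless_union x y c :
  ~~ has_internal_loop x -> ~~ has_internal_loop y ->
  ~~ has_internal_loop ((c, union_ends (ends x) (ends y)) : labelled _ _ _).
Proof. by move=> lx ly; rewrite internal_loop_union negb_or lx. Qed.

Lemma multiple_edge_union x y c :
  has_multiple_edge x || has_multiple_edge y ->
  has_multiple_edge ((c, union_ends (ends x) (ends y)) : labelled _ _ _).
Proof.
case/orP=> /existsP[a /existsP[b /andP[ab same]]].
  apply/existsP; exists (lshift q a); apply/existsP; exists (lshift q b).
  rewrite (inj_eq (@lshift_inj _ _)) ab /= !union_ends_lshift.
  exact: map_vertex_same_pair.
apply/existsP; exists (rshift t a); apply/existsP; exists (rshift t b).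
rewrite (inj_eq (@rshift_inj _ _)) ab /= !union_ends_rshift.
exact: map_vertex_same_pair.
Qed.

Lemma star_multiple_edge x y :
  has_multiple_edge x || has_multiple_edge y -> star x y = 0.
Proof.
move=> mxy; rewrite /star /shuffle_class big1 ?scaler0 // => c _.
exact/drawing_class_multiple/multiple_edge_union.
Qed.

Lemma star_internal_loop x y :
  has_internal_loop x || has_internal_loop y -> star x y = 0.
Proof.
move=> lxy; rewrite /star /shuffle_class big1 ?scaler0 // => c _.
by apply/drawing_class_loop; rewrite internal_loop_union.
Qed.

Lemma star_relabelling (s1 : 'S_r) (u1 : 'S_t) (s2 : 'S_n) (u2 : 'S_q) x x' y y' :
  is_graph x -> is_graph x' -> is_graph y -> is_graph y' ->
  relabelling s1 u1 x x' -> relabelling s2 u2 y y' ->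
  star x' y' =
  ((-1) ^+ s1 * (-1) ^+ u1) * ((-1) ^+ s2 * (-1) ^+ u2) *: star x y.
Proof.
move=> gx gx' gy gy' [c1 [k1 e1]] [c2 [k2 e2]].
rewrite /star (@shuffle_class_relabelling _ _ _ (block_perm s1 s2) (block_perm u1 u2)
  (block_perm k1 k2) (map (lshift n) (circle x)) (map (@rshift r n) (circle y)) _ _
  (union_ends (ends x) (ends y))).
- rewrite !odd_block_perm !signr_addb [LHS]scalerA [RHS]scalerA [X in X *: _ = _]mulrC.
  by rewrite [X in X * _ *: _ = _]mulrACA.
- exact: perm_eq_union.
- by move=> c; apply: is_graph_union.
- by move=> c; apply: is_graph_union.
- rewrite -map_comp (eq_map (g := lshift n \o s1)); last first.
    by move=> a; rewrite /= block_perm_lshift.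
  by rewrite map_comp; apply: same_cycle_map.
- rewrite -map_comp (eq_map (g := @rshift r n \o s2)); last first.
    by move=> a; rewrite /= block_perm_rshift.
  by rewrite map_comp; apply: same_cycle_map.
- move=> a; rewrite -(splitK a); case: (split a) => {}a /=.
    rewrite block_perm_lshift !union_ends_lshift.
    have := map_vertex_same_pair left_vertex (e1 a); rewrite !map_vertex_comp.
    congr same_pair; apply: eq_map_vertex; case=> v /=;
      by rewrite block_perm_lshift.
  rewrite block_perm_rshift !union_ends_rshift.
  have := map_vertex_same_pair right_vertex (e2 a); rewrite !map_vertex_comp.
  congr same_pair; apply: eq_map_vertex; case=> v /=;
    by rewrite block_perm_rshift.
Qed.
End Glued.
End Star.

(** * The product as an operator on the complex *)

Section LinearExtension.
Variables (R : realType) (V : lmodType R) (f : graph -> V).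
Local Notation chains := {freeg graph / R}.

Lemma fglift_is_linear : linear (fglift f : chains -> V).
Proof.
have addB c d : fglift f (c - d) = fglift f c - fglift f d.
  exact: lift_is_additive.
have add0 : fglift f (0 : chains) = 0.
  by rewrite -[X in fglift f X](subrr 0) addB subrr.
have addN c : fglift f (- c) = - fglift f c by rewrite -(sub0r c) addB add0 sub0r.
have addD c d : fglift f (c + d) = fglift f c + fglift f d.
  by rewrite -{1}(opprK d) addB addN opprK.
have addS I (r : seq I) (F : I -> chains) :
    fglift f (\sum_(i <- r) F i) = \sum_(i <- r) fglift f (F i).
  exact: (big_morph _ addD add0).
move=> a u v; rewrite addD; congr (_ + _).
rewrite -[in RHS](freeg_sumE u) addS scaler_sumr.
have -> : a *: u = \sum_(g <- dom u) << a * coeff g u *g g >> by [].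
by rewrite addS; apply: eq_bigr => g _; rewrite !liftU scalerA.
Qed.

Definition extend (c : chains) : V := fglift f c.

HB.instance Definition _ := GRing.isLinear.Build R chains V *:%R
  extend fglift_is_linear.

Lemma extend_relations :
  (forall r, relator r -> extend r = 0) ->
  forall c, c \in @relations R -> extend c = 0.
Proof.
move=> f0 c /asboolP; elim=> [|a r d Rr _ IH]; first exact: raddf0.
by rewrite linearP /= f0 // IH scaler0 addr0.
Qed.

(** The value is read off a chosen representative; when the relators go to 0, [descend_class] makes
    it independent of the choice. *)
Definition descend (x : D_e R) : V := extend (generic_quotient.repr x).

Hypothesis f0 : forall r, relator r -> extend r = 0.

Lemma descend_class c : descend (graph_class c) = extend c.
Proof.
apply/eqP; rewrite -subr_eq0 -raddfB; apply/eqP/extend_relations => //.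
by apply/graph_class_eq; apply: reprK.
Qed.

Lemma descend_is_linear : linear descend.
Proof.
move=> a u v; have [c <-] := graph_class_surj u.
have [d <-] := graph_class_surj v.
by rewrite -linearP !descend_class linearP.
Qed.
End LinearExtension.

Lemma extend_basis_vector (R : realType) (V : lmodType R)
    (F : forall n p q, labelled n p q -> V) n p q (x : labelled n p q) :
  is_graph x ->
  extend (fun g => F _ _ _ (drawing g)) (basis_vector R x) = F _ _ _ x.
Proof.
move=> gx; rewrite /basis_vector; case: insubP => [g _ gE|]; last first.
  by rewrite /= gx.
rewrite /extend liftU scale1r /drawing /n_ext /n_int /n_edges.
by move: gE; rewrite /= => ->.
Qed.

(** * Left multiplication by a fixed graph *)

Section StarRight.
Variable R : realType.
Variables (r s t : nat) (x : labelled r s t).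
Hypothesis gx : is_graph x.

Definition star_right : {freeg graph / R} -> D_e R :=
  extend (fun g => star R x (drawing g)).
HB.instance Definition _ := GRing.Linear.on star_right.

Lemma star_right_basis n p q (y : labelled n p q) :
  is_graph y -> star_right (basis_vector R y) = star R x y.
Proof. exact: (@extend_basis_vector R _ (fun n p q y => star R x y)). Qed.

Lemma relabelling_refl n p q (y : labelled n p q) :
  relabelling 1 1 y y.
Proof.
split; first by rewrite map_id_in ?same_cycle_refl // => i _; rewrite perm1.
exists 1%g => a; rewrite perm1 (@eq_map_vertex _ _ _ _ _ id).
  by rewrite /map_vertex -surjective_pairing /same_pair eqxx.
by case=> i /=; rewrite perm1.
Qed.

Lemma star_relabelling_right n p q (s2 : 'S_n) (u2 : 'S_q) (y y' : labelled n p q) :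
  is_graph y -> is_graph y' -> relabelling s2 u2 y y' ->
  star R x y' = (-1) ^+ s2 * (-1) ^+ u2 *: star R x y.
Proof.
move=> gy gy' yy'; rewrite (star_relabelling _ gx gx gy gy' (relabelling_refl x) yy').
by rewrite !odd_perm1 !mul1r.
Qed.

Lemma star_right_relator c : relator c -> star_right c = 0.
Proof.
case=> [n p q y z gy gz [yz [k yz']]|n p q y u gy|n p q y u gy|
        n p q y gy my|n p q y gy ly].
- rewrite raddfB /= !star_right_basis //.
  rewrite (@star_relabelling_right _ _ _ 1 1 y z) //.
    by rewrite !odd_perm1 mul1r scale1r subrr.
  split.
    rewrite map_id_in; last by move=> i _; rewrite perm1.
    by apply/same_cycleP.
  exists k => a; rewrite perm1; move: (yz' a).
  by congr same_pair; apply: eq_map_vertex; case=> // i /=; rewrite perm1.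
- have gy' := is_graph_relabel_ext u gy.
  rewrite raddfB /= linearZ /= !star_right_basis //.
  rewrite (@star_relabelling_right _ _ _ u 1 y) ?odd_perm1 ?mulr1 ?subrr //.
  split; first exact: same_cycle_refl.
  exists 1%g => a; rewrite ffunE perm1 (@eq_map_vertex _ _ _ _ _ (renumber_ext u)).
    by rewrite /same_pair eqxx.
  by case=> i /=; rewrite ?perm1.
- have gy' := is_graph_relabel_edges u gy.
  rewrite raddfB /= linearZ /= !star_right_basis //.
  rewrite (@star_relabelling_right _ _ _ 1 u y) ?odd_perm1 ?mul1r ?subrr //.
  split.
    by rewrite map_id_in ?same_cycle_refl // => i _; rewrite perm1.
  exists 1%g => a; rewrite ffunE (@eq_map_vertex _ _ _ _ _ id).
    by rewrite /map_vertex -surjective_pairing /same_pair eqxx.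
  by case=> i /=; rewrite perm1.
- by rewrite star_right_basis // star_multiple_edge ?my ?orbT.
- by rewrite star_right_basis // star_internal_loop ?ly ?orbT.
Qed.

Lemma star_right_arc_contractions n p q (y : labelled n.+1 p q) :
  is_graph y ->
  star_right (arc_contractions R y) =
  \sum_(i <- circle y)
    if unlift (arc_removed i (next (circle y) i)) (arc_kept i (next (circle y) i))
    is Some l
    then arc_sign R i (next (circle y) i) *:
      star R x (contract_arc (arc_removed i (next (circle y) i)) l y)
    else 0.
Proof.
move=> gy; rewrite raddf_sum /=.
have -> (F : 'I_n.+1 -> D_e R) : \sum_(i <- circle y) F i = \sum_i F i.
  by case/and4P: gy => cy _ _ _; rewrite (perm_big _ cy) big_enum.
apply: eq_bigr => i _; rewrite /arc_term /arc_removed /arc_kept.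
by case: ifP => _; case: unlift => [l|]; rewrite ?raddf0 // linearZ /=
  star_right_basis // is_graph_contract_arc.
Qed.

Lemma star_right_edge_contractions n p q (y : labelled n p q) :
  is_graph y ->
  star_right (edge_contractions R y) =
  \sum_b edge_part
    (fun p q E => star R x ((circle y, E) : labelled n p q)) (ends y) b.
Proof.
case: p q y => [|p] [|q] y gy; try by rewrite big1 ?raddf0.
rewrite raddf_sum /=; apply: eq_bigr => b _; rewrite /edge_term.
case Eb: (merged_ends (ends y b)) => [[u v]|]; last by rewrite raddf0.
rewrite linearZ /= star_right_basis //.
exact: is_graph_contract_edge Eb gy.
Qed.
End StarRight.

Lemma unlift_bump n (h i : 'I_n.+1) (j : 'I_n) :
  i = bump h j :> nat -> unlift h i = Some j.
Proof. by move=> E; rewrite (_ : i = lift h j) ?liftK //; apply: val_inj. Qed.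

Lemma unlift_morph m n (f : 'I_m.+1 -> 'I_n.+1) (f' : 'I_m -> 'I_n) :
  (forall h b, f (lift h b) = bump (f h) (f' b) :> nat) ->
  forall h b, unlift (f h) (f b) = omap f' (unlift h b).
Proof.
move=> E h b; case: (unliftP h b) => [j ->|->] /=; last by rewrite unlift_none.
exact: unlift_bump.
Qed.

Lemma unlift_rshift_lshift N r n (h : 'I_n) (a : 'I_r) (g : 'I_N.+1) (f : 'I_N.+1)
    (f' : 'I_N) :
  g = (r + h)%N :> nat -> f = a :> nat -> f' = a :> nat -> unlift g f = Some f'.
Proof.
move=> gE fE f'E; apply: unlift_bump; rewrite gE fE f'E /bump leqNgt.
by rewrite (leq_trans (ltn_ord a) (leq_addr _ _)).
Qed.

Lemma unlift_lshift_rshift r n (h : 'I_r.+1) (b : 'I_n) :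
  unlift (lshift n h : 'I_(r + n).+1) (@rshift r.+1 n b) = Some (@rshift r n b).
Proof.
apply: unlift_bump; rewrite /bump /= (leq_trans _ (leq_addr _ _)) //.
by rewrite -ltnS.
Qed.

Lemma unlift_lshift_lshift r n (h b : 'I_r.+1) :
  unlift (lshift n h : 'I_(r + n).+1) (lshift n b) =
  omap (lshift n) (unlift h b).
Proof.
exact: (@unlift_morph _ (r + n) (lshift n) (lshift n)).
Qed.

Lemma split_lift_lshift t q (a : 'I_t.+1) (c : 'I_(t + q)) :
  @split t.+1 q (lift (lshift q a : 'I_(t + q).+1) c) =
  match @split t q c with inl d => inl (lift a d) | inr d => inr d end.
Proof.
rewrite -{1}(splitK c); case: (split c) => d /=.
  rewrite (_ : lift _ _ = lshift q (lift a d)) ?(unsplitK (inl _)) //.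
  exact: val_inj.
rewrite (_ : lift _ _ = @rshift t.+1 q d) ?(unsplitK (inr _)) //.
apply: val_inj; rewrite /= /bump (leq_trans _ (leq_addr _ _)) //.
by rewrite -ltnS.
Qed.

(** * Signs in the Leibniz rule *)

Section LeftTerms.
Variable R : realType.
Variables (n p q : nat) (y : labelled n p q).

Lemma left_arcs r s t (x : labelled r.+1 s t) : uniq (circle x) ->
  (-1) ^+ (t * n) *: \sum_(i <- map (lshift n) (circle x))
    @shuffle_arc R (r + n) _ _ (union_ends (ends x) (ends y))
      (map (lshift n) (circle x)) (map (@rshift r.+1 n) (circle y))
      i (next (map (lshift n) (circle x)) i) =
  \sum_(i <- circle x)
    if unlift (arc_removed i (next (circle x) i)) (arc_kept i (next (circle x) i))
    is Some l
    then arc_sign R i (next (circle x) i) *: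
      star R (contract_arc (arc_removed i (next (circle x) i)) l x) y
    else 0.
Proof.
move=> ux; rewrite big_map scaler_sumr; apply: eq_bigr => i _.
rewrite next_map //; last exact: lshift_inj.
rewrite /union_ends /left_vertex /right_vertex.
rewrite (@shuffle_arc_glue_left R r n (r + n) s p _ t q _ (lshift n) (lshift n)
  (@rshift r.+1 n) (@rshift r n)); last first.
- by [].
- exact: unlift_lshift_lshift.
- exact: unlift_lshift_rshift.
case: (unlift _ _) => [l|]; last exact: scaler0.
by rewrite /star [LHS]scalerA [RHS]scalerA mulrC.
Qed.

(** This is where the prefactor of [star] is needed: the edge sign counts the external vertices,
    [r + n] in the union instead of [r], and the surplus [(-1)^n] is the ratio of the prefactors for
    [t.+1] and [t] edges. *)
Lemma left_edge r s t (x : labelled r s.+1 t.+1) (a : 'I_t.+1) ca cb :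
  (-1) ^+ (t.+1 * n) *:
    @edge_part R (r + n) (fun p q E => shuffle_class R ca cb E)
      (s + p).+1 (t + q).+1 (union_ends (ends x) (ends y)) (lshift q a) =
  if merged_ends (ends x a) is Some (u, v)
  then edge_sign R r a *: ((-1) ^+ (t * n) *:
    shuffle_class R ca cb (union_ends (contract_edge_ends a u v (ends x)) (ends y)))
  else 0.
Proof.
rewrite /union_ends /left_vertex /right_vertex.
rewrite (@edge_part_glue_left R r n _ s p (s + p) t q (t + q) (lshift n)
  (@rshift r n) (lshift p) (lshift p) (@rshift s.+1 p) (@rshift s p) _
  (@split t q) _ a); first last.
- exact: split_lift_lshift.
- exact: (unsplitK (inl a)).
- exact: unlift_lshift_lshift.
- exact: unlift_lshift_rshift.
case: (merged_ends _) => [[u v]|]; last exact: scaler0.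
rewrite [LHS]scalerA [RHS]scalerA.
rewrite [X in X *: _ = _](_ : _ = edge_sign R r a * (-1) ^+ (t * n)) //.
rewrite /edge_sign -!exprD /= -signr_odd -[RHS]signr_odd; congr (_ ^+ nat_of_bool _).
rewrite mulSn !oddD /=; move: (odd n) (odd (t * n)) (odd a) (odd r).
by do 4!case.
Qed.
End LeftTerms.

Lemma split_inl m n (i : 'I_(m + n)) (d : 'I_m) : i = d :> nat -> split i = inl d.
Proof.
by move=> E; rewrite (_ : i = lshift n d) ?(unsplitK (inl d)) //; apply: val_inj.
Qed.

Lemma split_inr m n (i : 'I_(m + n)) (d : 'I_n) :
  i = (m + d)%N :> nat -> split i = inr d.
Proof.
by move=> E; rewrite (_ : i = rshift m d) ?(unsplitK (inr d)) //; apply: val_inj.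
Qed.

Lemma bump_addl r h b : bump (r + h) (r + b) = (r + bump h b)%N.
Proof. by rewrite /bump leq_add2l addnCA. Qed.

Section RightTerms.
Variable R : realType.

Lemma arc_sign_shift r n N (g : 'I_n -> 'I_N) i j :
  (forall i, g i = (r + i)%N :> nat) ->
  arc_sign R (g i) (g j) = (-1) ^+ r * arc_sign R i j.
Proof.
move=> gE; rewrite /arc_sign !gE ltn_add2l.
by case: ifP => _; rewrite -exprD ?addnS.
Qed.

Section Arcs.
Variables r n N s p P t q Q : nat.
Variables (f : 'I_r -> 'I_N.+1) (f' : 'I_r -> 'I_N).
Variables (g : 'I_n.+1 -> 'I_N.+1) (g' : 'I_n -> 'I_N).
Variables (kx : 'I_s -> 'I_P) (ky : 'I_p -> 'I_P) (sp : 'I_Q -> 'I_t + 'I_q).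
Hypothesis fE : forall a, f a = a :> nat.
Hypothesis f'E : forall a, f' a = a :> nat.
Hypothesis gE : forall b, g b = (r + b)%N :> nat.
Hypothesis g'E : forall b, g' b = (r + b)%N :> nat.
Hypothesis even_rt : ~~ odd (r + t).

(** Shifting labels by [r] multiplies the arc sign by [(-1)^r], and losing one external vertex of
    [y] changes the prefactor by [(-1)^t]. *)
Lemma right_arcs (x : labelled r s t) (y : labelled n.+1 p q) : uniq (circle y) ->
  (-1) ^+ (t * n.+1) *: \sum_(i <- map g (circle y))
    shuffle_arc R (glue (embed f kx) (embed g ky) sp (ends x) (ends y))
      (map f (circle x)) (map g (circle y)) i (next (map g (circle y)) i) =
  \sum_(i <- circle y)
    if unlift (arc_removed i (next (circle y) i)) (arc_kept i (next (circle y) i))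
    is Some l
    then arc_sign R i (next (circle y) i) *: ((-1) ^+ (t * n) *:
      shuffle_class R (map f' (circle x))
        (map g' (pmap (unlift (arc_removed i (next (circle y) i))) (circle y)))
        (glue (embed f' kx) (embed g' ky) sp (ends x)
          (contract_ends (arc_removed i (next (circle y) i)) l (ends y))))
    else 0.
Proof.
have g_inj : injective g.
  by move=> i j /(congr1 val); rewrite /= !gE => /addnI/val_inj.
move=> uy; rewrite big_map scaler_sumr; apply: eq_bigr => i _.
rewrite next_map // (@shuffle_arc_glue_right R _ _ _ _ _ _ _ _ _ f f' g g'); first last.
- by move=> j k; rewrite !gE ltn_add2l.
- by apply: unlift_morph => h b; rewrite !gE g'E bump_addl.
- by move=> h a; apply: unlift_rshift_lshift.
case: (unlift _ _) => [l|]; last exact: scaler0.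
rewrite [LHS]scalerA [RHS]scalerA (arc_sign_shift _ _ gE).
rewrite [X in X *: _ = _](_ : _ = arc_sign R i (next (circle y) i) * (-1) ^+ (t * n)) //.
rewrite mulrA mulrC -exprD; congr (_ * _).
rewrite -signr_odd -[RHS]signr_odd; congr (_ ^+ nat_of_bool _).
move: even_rt; rewrite mulnS !oddD.
by move: (odd r) (odd t) (odd (t * n)); do 3!case.
Qed.
End Arcs.

Section Edges.
Variables r n N s p P t q Q : nat.
Variables (f : 'I_r -> 'I_N) (g : 'I_n -> 'I_N).
Variables (kx : 'I_s -> 'I_P.+1) (kx' : 'I_s -> 'I_P).
Variables (ky : 'I_p.+1 -> 'I_P.+1) (ky' : 'I_p -> 'I_P).
Variables (sp : 'I_Q.+1 -> 'I_t + 'I_q.+1) (sp' : 'I_Q -> 'I_t + 'I_q).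
Variables (a : 'I_Q.+1) (b : 'I_q.+1).
Hypothesis kxE : forall u, kx u = u :> nat.
Hypothesis kx'E : forall u, kx' u = u :> nat.
Hypothesis kyE : forall u, ky u = (s + u)%N :> nat.
Hypothesis ky'E : forall u, ky' u = (s + u)%N :> nat.
Hypothesis sp_a : sp a = inr b.
Hypothesis sp_lift : forall c, sp (lift a c) =
  match sp' c with inl d => inl d | inr d => inr (lift b d) end.
Hypothesis NE : N = (r + n)%N.
Hypothesis aE : a = (t + b)%N :> nat.
Hypothesis even_rt : ~~ odd (r + t).

(** The edge label grows by [t] and the number of external vertices by [r], so the sign changes by
    [(-1)^(r + t)]. *)
Lemma right_edge Phi (D : endpoints r s t) (E : endpoints n p.+1 q.+1) :
  @edge_part R N Phi _ _ (glue (embed f kx) (embed g ky) sp D E) a =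
  if merged_ends (E b) is Some (u, v)
  then edge_sign R n b *: Phi P Q
         (glue (embed f kx') (embed g ky') sp' D (contract_edge_ends b u v E))
  else 0.
Proof.
rewrite (@edge_part_glue_right R _ _ _ _ _ _ _ _ _ f g kx kx' ky ky' sp sp' a b) //.
- suff -> : edge_sign R N a = edge_sign R n b by [].
  rewrite /edge_sign NE aE -signr_odd -[RHS]signr_odd; congr (_ ^+ nat_of_bool _).
  move: even_rt; rewrite !(oddD, oddS) /=.
  by move: (odd r) (odd t) (odd n) (odd b); do 4!case.
- by move=> u w; apply: unlift_rshift_lshift.
- by apply: unlift_morph => u w; rewrite !kyE ky'E bump_addl.
Qed.
End Edges.

Lemma merged_ends_embed_ext n N P (f : 'I_n -> 'I_N) (k : 'I_0 -> 'I_P.+1)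
    (e : vertex n 0 * vertex n 0) :
  merged_ends (map_vertex (embed f k) e) = None.
Proof. by case: e => [[?|[? ?]] [?|[? ?]]]. Qed.
End RightTerms.

Section Leibniz.
Variable R : realType.

(** The numerals 4, 0 and 2 make the sizes of the union before and after a contraction in [y]
    convertible; [right_terms_tripod] repeats the argument with 3, 1 and 3 for the same reason. *)
Lemma right_terms_cross (x : labelled 4 0 2) n p q (y : labelled n p q) :
  is_graph x -> is_graph y ->
  (-1) ^+ (2 * n) *: (\sum_(i <- map (@rshift 4 n) (circle y))
    @shuffle_arc R (3 + n) _ _ (union_ends (ends x) (ends y))
      (map (lshift n) (circle x)) (map (@rshift 4 n) (circle y))
      i (next (map (@rshift 4 n) (circle y)) i) +
    \sum_(b < q) @edge_part R (4 + n) (fun p q E => shuffle_class R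
      (map (lshift n) (circle x)) (map (@rshift 4 n) (circle y)) E)
      (0 + p) (2 + q) (union_ends (ends x) (ends y)) (rshift 2 b)) =
  star_right x (arc_contractions R y + edge_contractions R y).
Proof.
move=> gx gy; rewrite [RHS]raddfD scalerDr; congr (_ + _).
  rewrite -[RHS]/(star_right x (arc_contractions R y)).
  case: n y gy => [|n] y gy.
    have -> : circle y = [::].
      by case: (circle y) => // -[].
    by rewrite big_nil scaler0 raddf0.
  rewrite star_right_arc_contractions //.
  exact: (@right_arcs R 4 n (4 + n) 0 p _ 2 q _ (lshift n.+1) (lshift n)
    (@rshift 4 n.+1) (@rshift 4 n) _ _ _ _ _ _ _ _ x y (is_graph_uniq gy)).
rewrite -[RHS]/(star_right x (edge_contractions R y)).
rewrite star_right_edge_contractions // scaler_sumr; apply: eq_bigr => b _.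
case: p q y gy b => [|p] [|q] y gy b; try exact: scaler0; first by case: b.
rewrite (@right_edge R 4 n (4 + n) 0 p (0 + p) 2 q (2 + q) (lshift n) (@rshift 4 n)
  (lshift p.+1) (lshift p) (@rshift 0 p.+1) (@rshift 0 p) (@split 2 q.+1)
  (@split 2 q) (rshift 2 b) b) //.
- rewrite /edge_part; case: (merged_ends _) => [[u v]|]; last exact: scaler0.
  by rewrite [LHS]scalerA mulrC -scalerA.
- exact: split_inr.
- move=> c; rewrite -{1}(splitK c); case: (split c) => d /=.
    by apply: split_inl; rewrite /= /bump leqNgt (leq_trans (ltn_ord d)) ?leq_addr.
  by apply: split_inr; rewrite /= -bump_addl.
Qed.
End Leibniz.

Lemma forall_ord2 (P : 'I_2 -> Prop) : P ord0 -> P ord_max -> forall a, P a.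
Proof.
move=> P0 P1 a; case: (unliftP ord0 a) => [j ->|->] //.
by rewrite (_ : lift _ _ = ord_max) //; apply: val_inj; rewrite ord1.
Qed.

(** * The crossed chords and the tripod *)

Section Cocycle.
Variable R : realType.

Lemma right_terms_tripod (x : labelled 3 1 3) n p q (y : labelled n p q) :
  is_graph x -> is_graph y ->
  (-1) ^+ (3 * n) *: (\sum_(i <- map (@rshift 3 n) (circle y))
    @shuffle_arc R (2 + n) _ _ (union_ends (ends x) (ends y))
      (map (lshift n) (circle x)) (map (@rshift 3 n) (circle y))
      i (next (map (@rshift 3 n) (circle y)) i) +
    \sum_(b < q) @edge_part R (3 + n) (fun p q E => shuffle_class R
      (map (lshift n) (circle x)) (map (@rshift 3 n) (circle y)) E)
      (1 + p) (3 + q) (union_ends (ends x) (ends y)) (rshift 3 b)) =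
  star_right x (arc_contractions R y + edge_contractions R y).
Proof.
move=> gx gy; rewrite [RHS]raddfD scalerDr; congr (_ + _).
  rewrite -[RHS]/(star_right x (arc_contractions R y)).
  case: n y gy => [|n] y gy.
    have -> : circle y = [::].
      by case: (circle y) => // -[].
    by rewrite big_nil scaler0 raddf0.
  rewrite star_right_arc_contractions //.
  exact: (@right_arcs R 3 n (3 + n) 1 p _ 3 q _ (lshift n.+1) (lshift n)
    (@rshift 3 n.+1) (@rshift 3 n) _ _ _ _ _ _ _ _ x y (is_graph_uniq gy)).
rewrite -[RHS]/(star_right x (edge_contractions R y)).
rewrite star_right_edge_contractions // scaler_sumr; apply: eq_bigr => b _.
case: p q y gy b => [|p] [|q] y gy b; try by case: b.
  (* Here [y] has no internal vertex but the union has the one of [x], so [edge_part] does inspect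
     the edges of [y]; they are chords, and none is contracted. *)
  rewrite (@edge_part_none _ _ _ 0 (2 + q.+1)) ?scaler0 //.
  apply: etrans (congr1 (@merged_ends _ _) (union_ends_rshift (ends x) (ends y) b)) _.
  exact: merged_ends_embed_ext.
rewrite (@right_edge R 3 n (3 + n) 1 p (1 + p) 3 q (3 + q) (lshift n) (@rshift 3 n)
  (lshift p.+1) (lshift p) (@rshift 1 p.+1) (@rshift 1 p) (@split 3 q.+1)
  (@split 3 q) (rshift 3 b) b) //.
- rewrite /edge_part; case: (merged_ends _) => [[u v]|]; last exact: scaler0.
  by rewrite [LHS]scalerA mulrC -scalerA.
- exact: split_inr.
- move=> c; rewrite -{1}(splitK c); case: (split c) => d /=.
    by apply: split_inl; rewrite /= /bump leqNgt (leq_trans (ltn_ord d)) ?leq_addr.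
  by apply: split_inr; rewrite /= -bump_addl.
Qed.

Definition cross : labelled 4 0 2 :=
  ([:: @Ordinal 4 0 isT; @Ordinal 4 1 isT; @Ordinal 4 2 isT; @Ordinal 4 3 isT],
   [ffun a : 'I_2 => if a == ord0
      then (inl (@Ordinal 4 0 isT), inl (@Ordinal 4 2 isT))
      else (inl (@Ordinal 4 1 isT), inl (@Ordinal 4 3 isT))]).

Definition triangle : seq 'I_3 :=
  [:: @Ordinal 3 0 isT; @Ordinal 3 1 isT; @Ordinal 3 2 isT].

Definition tripod : labelled 3 1 3 :=
  (triangle, [ffun a : 'I_3 => (inl a, inr ord0)]).

(** The graph [V] of the overview in its three positions; [lift c] numbers the edges by increasing
    far end, which fixes the sign of each position. *)
Definition vee (c : 'I_3) : labelled 3 0 2 :=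
  (triangle, [ffun a : 'I_2 => (inl c, inl (lift c a))]).

Lemma valence_gt0 n p q (x : labelled n p q) v a :
  (ends x a).1 = v \/ (ends x a).2 = v -> (0 < valence x v)%N.
Proof. by rewrite /valence (bigD1 a) //= => -[->|->]; rewrite eqxx ?addn1 ?addnS. Qed.

Lemma perm_triangle : perm_eq triangle (enum 'I_3).
Proof.
apply: uniq_perm; rewrite ?enum_uniq // => i; rewrite mem_enum.
by case: i => [[|[|[|]]] ?].
Qed.

Lemma is_graph_cross : is_graph cross.
Proof.
apply/and4P; split; try by apply/forallP=> -[].
  apply: uniq_perm; rewrite ?enum_uniq // => i; rewrite mem_enum.
  by case: i => [[|[|[|[|]]]] ?].
apply/forallP=> w.
have: exists a : 'I_2, (ends cross a).1 = inl w \/ (ends cross a).2 = inl w.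
  case: w => [[|[|[|[|//]]]] ?].
  - by exists ord0; left; rewrite ffunE /=; congr inl; apply: val_inj.
  - by exists ord_max; left; rewrite ffunE /=; congr inl; apply: val_inj.
  - by exists ord0; right; rewrite ffunE /=; congr inl; apply: val_inj.
  - by exists ord_max; right; rewrite ffunE /=; congr inl; apply: val_inj.
by case=> a; apply: valence_gt0.
Qed.

Lemma is_graph_vee c : is_graph (vee c).
Proof.
apply/and4P; split; try by apply/forallP=> -[].
  exact: perm_triangle.
apply/forallP=> w; case: (unliftP c w) => [a ->|->].
  by apply: (valence_gt0 (a := a)); right; rewrite ffunE.
by apply: (valence_gt0 (a := ord0)); left; rewrite ffunE.
Qed.

Lemma is_graph_tripod : is_graph tripod.
Proof.
apply/and4P; split; first exact: perm_triangle.
- apply/forallP=> v; rewrite /valence (eq_bigr (fun=> 1%N)).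
    by rewrite sum_nat_const card_ord.
  by move=> a _; rewrite ffunE /= (ord1 v) eqxx.
- by apply/forallP=> w; apply: (valence_gt0 (a := w)); left; rewrite ffunE.
- apply/forallP=> v; apply/existsP; exists ord0; apply: connect1.
  by apply/existsP; exists ord0; rewrite ffunE (ord1 v) eqxx orbT.
Qed.

Lemma loopless_cross : ~~ has_internal_loop cross.
Proof. by apply/existsP=> -[a /existsP[]] [[]]. Qed.

Lemma loopless_tripod : ~~ has_internal_loop tripod.
Proof. by apply/existsP=> -[a /existsP[v]]; rewrite ffunE. Qed.

Definition turn : 'S_3 := perm (@ordS_inj 3).

(** A permutation of order three equals its fourth power, which is even. *)
Lemma odd_turn : turn = false :> bool.
Proof.
have -> : turn = (turn * turn * (turn * turn))%g.
  apply/permP=> i; rewrite !permM !permE; apply: val_inj.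
  by case: i => [[|[|[|]]] ?].
by rewrite !odd_permM; case: (odd_perm turn).
Qed.

Lemma same_pair_inl n p (a b c d : 'I_n) :
  same_pair (inl a, inl b) (inl c, inl d : vertex n p) =
  ((c == a) && (d == b)) || ((c == b) && (d == a)).
Proof. by []. Qed.

Section StarLeft.
Variables (n p q : nat) (y : labelled n p q).
Hypothesis gy : is_graph y.

Lemma star_relabelling_left r s t (s1 : 'S_r) (u1 : 'S_t) (x x' : labelled r s t) :
  is_graph x -> is_graph x' -> relabelling s1 u1 x x' ->
  star R x' y = (-1) ^+ s1 * (-1) ^+ u1 *: star R x y.
Proof.
move=> gx gx' xx'; rewrite (star_relabelling _ gx gx' gy gy xx' (relabelling_refl y)).
by rewrite !odd_perm1 !mulr1.
Qed.

Lemma relabelling_vee c (u : 'S_2) :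
  (forall a : 'I_2, same_pair (inl (turn c), inl (turn (lift c (u a))))
     (inl (turn c), inl (lift (turn c) a) : vertex 3 0)) ->
  relabelling turn u (vee c) (vee (turn c)).
Proof.
move=> H; split.
  (* The turned triangle reads 1, 2, 0, and two more places bring it back to 0, 1, 2. *)
  apply/same_cycleP; exists 2%N; apply: (inj_map val_inj).
  by rewrite /= !permE.
by exists 1%g => a; rewrite !ffunE; apply: H.
Qed.

(** A third of a turn is even on the external vertices but reverses the order of the two far ends,
    hence of the two edges, in passing from 0 to 1 and from 1 to 2; each passage costs one sign. *)
Lemma star_vee c : star R (vee c) y = (-1) ^+ c *: star R (vee ord0) y.
Proof.
have swap01 : odd_perm (tperm (ord0 : 'I_2) ord_max) = true by rewrite odd_tperm.
have signE : (-1) ^+ turn * (-1) ^+ tperm (ord0 : 'I_2) ord_max = -1 :> R.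
  by rewrite odd_turn swap01 expr0 mul1r expr1.
have turnE (i j : 'I_3) : (i.+1 %% 3)%N = j -> turn i = j.
  by move=> E; rewrite permE; apply: val_inj.
have E01 : star R (vee (@Ordinal 3 1 isT)) y = - star R (vee ord0) y.
  have T : turn ord0 = @Ordinal 3 1 isT by apply: turnE.
  rewrite -T (star_relabelling_left (is_graph_vee _) (is_graph_vee _)
    (@relabelling_vee ord0 (tperm ord0 ord_max) _)).
    by rewrite signE; apply: scaleN1r.
  apply: forall_ord2; rewrite ?tpermL ?tpermR same_pair_inl T.
    by rewrite (turnE _ (@Ordinal 3 0 isT)).
  by rewrite (turnE _ (@Ordinal 3 2 isT)).
have E12 : star R (vee (@Ordinal 3 2 isT)) y = - star R (vee (@Ordinal 3 1 isT)) y.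
  have T : turn (@Ordinal 3 1 isT) = @Ordinal 3 2 isT by apply: turnE.
  rewrite -T (star_relabelling_left (is_graph_vee _) (is_graph_vee _)
    (@relabelling_vee (@Ordinal 3 1 isT) (tperm ord0 ord_max) _)).
    by rewrite signE; apply: scaleN1r.
  apply: forall_ord2; rewrite ?tpermL ?tpermR same_pair_inl T.
    by rewrite (turnE _ (@Ordinal 3 0 isT)).
  by rewrite (turnE _ (@Ordinal 3 1 isT)).
have [->|[->|->]] : c = ord0 \/ c = @Ordinal 3 1 isT \/ c = @Ordinal 3 2 isT.
  by case: c => [[|[|[|//]]] c3]; [left|right;left|right;right]; apply: val_inj.
- by rewrite expr0 scale1r.
- have -> : (-1) ^+ @Ordinal 3 1 isT = -1 :> R by exact: expr1.
  rewrite scaleN1r; exact: E01.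
- have -> : (-1) ^+ @Ordinal 3 2 isT = 1 :> R by exact: (sqrr_sign R 1).
  rewrite scale1r; apply: etrans E12 _; apply: etrans (congr1 -%R E01) _.
  exact: opprK.
Qed.
End StarLeft.
End Cocycle.

Lemma val_pmap_unlift n (h : 'I_n.+1) (s : seq 'I_n.+1) :
  map val (pmap (unlift h) s) =
  [seq unbump h i | i <- map val s & i != h :> nat].
Proof.
elim: s => //= w s IH; case: (unliftP h w) => [j ->|->] /=.
  by rewrite IH /= eq_sym (negPf (neq_bump _ _)) /= bumpK.
by rewrite eqxx.
Qed.

Lemma val_merge n (h w : 'I_n.+1) (l : 'I_n) :
  val (odflt l (unlift h w)) = if w == h :> nat then val l else unbump h w.
Proof.
case: (unliftP h w) => [j ->|->] /=; last by rewrite eqxx.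
by rewrite eq_sym (negPf (neq_bump _ _)) bumpK.
Qed.

(** * Contractions inside the left factor *)

Section CocycleTerms.
Variable R : realType.
Variables (n p q : nat) (y : labelled n p q).
Hypothesis gy : is_graph y.

Definition left_arc_term r s t (x : labelled r.+1 s t) (i : 'I_r.+1) : D_e R :=
  if unlift (arc_removed i (next (circle x) i)) (arc_kept i (next (circle x) i))
  is Some l
  then arc_sign R i (next (circle x) i) *:
    star R (contract_arc (arc_removed i (next (circle x) i)) l x) y
  else 0.

(** The last hypothesis collects three signs: of the arc, of the renumbering of the two chords, and
    of [vee c] relative to [vee ord0]. *)
Lemma left_arc_cross i j h l c (u : 'S_2) :
  next (circle cross) i = j -> arc_removed i j = h -> arc_kept i j = lift h l ->
  relabelling 1 u (vee c) (contract_arc h l cross) ->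
  arc_sign R i j * ((-1) ^+ u * (-1) ^+ c) = 1 ->
  left_arc_term cross i = star R (vee ord0) y.
Proof.
move=> ij hE kE rel sgn; rewrite /left_arc_term ij hE kE liftK.
have gc := is_graph_contract_arc h l is_graph_cross.
rewrite (star_relabelling_left R gy (is_graph_vee c) gc rel) odd_perm1 mul1r.
by rewrite (star_vee R gy) scalerA scalerA sgn scale1r.
Qed.

(** The condition on the circle is phrased with natural numbers, where it is settled by
    computation. *)
Lemma relabelling_cross (h : 'I_4) (l c : 'I_3) (u : 'S_2) :
  [seq unbump h i | i <- [:: 0; 1; 2; 3]%N & i != h :> nat] = [:: 0; 1; 2]%N ->
  (forall a, same_pair (inl c, inl (lift c (u a)))
    (map_vertex (merge_ext h l) (ends cross a) : vertex 3 0 * vertex 3 0)) ->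
  relabelling 1 u (vee c) (contract_arc h l cross).
Proof.
move=> cE eE; split.
  rewrite map_id_in; last by move=> i _; rewrite perm1.
  apply/same_cycleP; exists 0%N; rewrite rot0; apply: (inj_map val_inj).
  by rewrite val_pmap_unlift.
exists 1%g => a; move: (eE a); rewrite [ends (contract_arc _ _ _) _]ffunE.
by rewrite [ends (vee c) _]ffunE /map_vertex /= !perm1.
Qed.

(** The contracted arcs 0-1, 1-2 and 2-3 give [vee] at 0, 1 and 2; their arc signs alternate exactly
    as the signs of [star_vee], so all terms agree. *)
Lemma left_arcs_cross :
  \sum_(i <- circle cross) left_arc_term cross i = star R (vee ord0) y *+ 4.
Proof.
pose o4 k (lt_k : (k < 4)%N) : 'I_4 := Ordinal lt_k.
pose o3 k (lt_k : (k < 3)%N) : 'I_3 := Ordinal lt_k.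
have E0 : left_arc_term cross (@o4 0 isT) = star R (vee ord0) y.
  apply: (@left_arc_cross _ (@o4 1 isT) (@o4 1 isT) (@o3 0 isT) (@o3 0 isT) 1);
    try exact: val_inj.
    apply: relabelling_cross => //.
    by apply: forall_ord2; rewrite perm1 ffunE /map_vertex /=
      same_pair_inl -!val_eqE /= !val_merge.
  by rewrite /arc_sign /= odd_perm1 -!exprD -signr_odd.
have E1 : left_arc_term cross (@o4 1 isT) = star R (vee ord0) y.
  apply: (@left_arc_cross _ (@o4 2 isT) (@o4 2 isT) (@o3 1 isT) (@o3 1 isT) 1);
    try exact: val_inj.
    apply: relabelling_cross => //.
    by apply: forall_ord2; rewrite perm1 ffunE /map_vertex /=
      same_pair_inl -!val_eqE /= !val_merge.
  by rewrite /arc_sign /= odd_perm1 -!exprD -signr_odd.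
have E2 : left_arc_term cross (@o4 2 isT) = star R (vee ord0) y.
  apply: (@left_arc_cross _ (@o4 3 isT) (@o4 3 isT) (@o3 2 isT) (@o3 2 isT) 1);
    try exact: val_inj.
    apply: relabelling_cross => //.
    by apply: forall_ord2; rewrite perm1 ffunE /map_vertex /=
      same_pair_inl -!val_eqE /= !val_merge.
  by rewrite /arc_sign /= odd_perm1 -!exprD -signr_odd.
(* The closing arc descends from 3 to 0: its sign is -1, but the two chords also come out in the
   opposite order. *)
have E3 : left_arc_term cross (@o4 3 isT) = star R (vee ord0) y.
  apply: (@left_arc_cross _ (@o4 0 isT) (@o4 3 isT) (@o3 0 isT) (@o3 0 isT)
    (tperm ord0 ord_max)); try exact: val_inj.
    apply: relabelling_cross => //.
    by apply: forall_ord2; rewrite ?tpermL ?tpermR ffunE /map_vertex /=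
      same_pair_inl -!val_eqE /= !val_merge.
  by rewrite /arc_sign /= odd_tperm -!exprD -signr_odd.
rewrite /cross [circle _]/= !big_cons big_nil E0 E1 E2 E3 addr0.
by rewrite !mulrS mulr0n addr0.
Qed.

Lemma left_arcs_tripod :
  \sum_(i <- circle tripod) left_arc_term tripod i = 0.
Proof.
rewrite big1 // => i _; rewrite /left_arc_term.
case E: (unlift _ _) => [l|] //; rewrite star_multiple_edge ?scaler0 //.
(* The leg labelled [a] ends at the external vertex [a], so the labels of the two merged vertices
   are also those of the two legs that become parallel. *)
apply/orP; left; apply/existsP; exists (arc_removed i (next (circle tripod) i)).
apply/existsP; exists (lift (arc_removed i (next (circle tripod) i)) l).
rewrite neq_lift /= !ffunE /map_vertex /= unlift_none liftK /=.
by rewrite /same_pair eqxx.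
Qed.

(** Contracting leg [a] yields [vee a] with its edges already in order. With three external vertices
    the edge sign is [(-1)^(a + 5)], and [star_vee] removes the dependence on [a]. *)
Lemma left_edges_tripod (a : 'I_3) :
  (if merged_ends (ends tripod a) is Some (u, v)
   then edge_sign R 3 a *: ((-1) ^+ (2 * n) *:
     shuffle_class R (map (lshift n) (circle tripod)) (map (@rshift 3 n) (circle y))
       (union_ends (contract_edge_ends a u v (ends tripod)) (ends y)))
   else 0) = - star R (vee ord0) y.
Proof.
have mE : merged_ends (ends tripod a) = Some (ord0, inl a) by rewrite ffunE.
have gc : is_graph (contract_edge a ord0 (inl a) tripod).
  exact: is_graph_contract_edge mE is_graph_tripod.
have rel : relabelling 1 1 (vee a) (contract_edge a ord0 (inl a) tripod).
  split.
    rewrite map_id_in; last by move=> i _; rewrite perm1.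
    exact: same_cycle_refl.
  exists 1%g => b; rewrite !ffunE /map_vertex /= !perm1 unlift_none.
  by rewrite same_pair_inl !eqxx orbT.
rewrite mE -[X in _ *: X]/(star R (contract_edge a ord0 (inl a) tripod) y).
rewrite (star_relabelling_left R gy (is_graph_vee a) gc rel) !odd_perm1 mulr1.
rewrite scale1r (star_vee R gy) scalerA -scaleN1r.
rewrite [X in X *: _ = _](_ : _ = -1) // /edge_sign -exprD -signr_odd.
by rewrite !oddD /=; case: (odd a).
Qed.
End CocycleTerms.

(** * The multiplication that commutes with the coboundary *)

Section Multiplication.
Variable R : realType.

Lemma coboundaryZ a (x : D_e R) : coboundary (a *: x) = a *: coboundary x.
Proof. exact: linearZ. Qed.

Lemma star_unfold r s t n p q (x : labelled r s t) (y : labelled n p q) :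
  star R x y = (-1) ^+ (t * n) *: shuffle_class R (map (lshift n) (circle x))
    (map (@rshift r n) (circle y)) (union_ends (ends x) (ends y)).
Proof. by []. Qed.

Lemma left_edge_chord r t n p q (x : labelled r 0 t.+1) (y : labelled n p q)
    Phi (a : 'I_t.+1) :
  @edge_part R (r + n) Phi (0 + p) (t + q).+1 (union_ends (ends x) (ends y))
    (lshift q a) = 0.
Proof.
case: p y => [|p] y //; apply: (@edge_part_none _ _ _ (0 + p)).
apply: etrans (congr1 (@merged_ends _ _) (union_ends_lshift (ends x) (ends y) a)) _.
by case: (ends x a) => [[?|[]//] [?|[]//]].
Qed.

Section Coboundary.
Variables (n p q : nat) (y : labelled n p q).
Hypothesis gy : is_graph y.
Hypothesis ly : ~~ has_internal_loop y.

Let coboundary_yE :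
  labelled_coboundary R y = arc_contractions R y + edge_contractions R y.
Proof. by rewrite /labelled_coboundary (negPf ly). Qed.

Lemma coboundary_star_cross :
  coboundary (star R cross y) =
  star R (vee ord0) y *+ 4 + star_right cross (labelled_coboundary R y).
Proof.
rewrite star_unfold coboundaryZ (@coboundary_shuffle_class R (3 + n)); first last.
- by move=> c; apply: (@loopless_union _ _ _ _ _ _ cross y c loopless_cross ly).
- by move=> c; apply: (@is_graph_union _ _ _ _ _ _ cross y c is_graph_cross gy).
- exact: perm_eq_union is_graph_cross gy.
rewrite big_split_ord [X in _ + (X + _)]big1; last first.
  move=> a _; exact: left_edge_chord.
rewrite add0r -addrA scalerDr coboundary_yE.
rewrite (right_terms_cross R is_graph_cross gy).
by rewrite (left_arcs R y (is_graph_uniq is_graph_cross)) -(left_arcs_cross R gy).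
Qed.

Lemma coboundary_star_tripod :
  coboundary (star R tripod y) =
  - star R (vee ord0) y *+ 3 + star_right tripod (labelled_coboundary R y).
Proof.
rewrite star_unfold coboundaryZ (@coboundary_shuffle_class R (2 + n)); first last.
- by move=> c; apply: (@loopless_union _ _ _ _ _ _ tripod y c loopless_tripod ly).
- by move=> c; apply: (@is_graph_union _ _ _ _ _ _ tripod y c is_graph_tripod gy).
- exact: perm_eq_union is_graph_tripod gy.
rewrite big_split_ord -addrA [X in _ + X]addrCA !scalerDr coboundary_yE.
rewrite addrA -[X in _ + X = _]scalerDr (right_terms_tripod R is_graph_tripod gy).
rewrite (left_arcs R y (is_graph_uniq is_graph_tripod)).
rewrite (left_arcs_tripod R y) add0r; congr (_ + _).
rewrite scaler_sumr (eq_bigr (fun=> - star R (vee ord0) y)).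
  by rewrite sumr_const card_ord.
move=> a _; rewrite -(left_edges_tripod R gy a).
exact: left_edge.
Qed.
End Coboundary.

Definition mult_labelled n p q (y : labelled n p q) : D_e R :=
  star R cross y *+ 3 + star R tripod y *+ 4.

Definition mult_chain : {freeg graph / R} -> D_e R :=
  extend (fun g => mult_labelled (drawing g)).
HB.instance Definition _ := GRing.Linear.on mult_chain.

Lemma mult_chainE c :
  mult_chain c = star_right cross c *+ 3 + star_right tripod c *+ 4.
Proof.
rewrite -(freeg_sumE c) !raddf_sum /= -!sumrMnl -big_split /=.
apply: eq_bigr => g _.
rewrite /mult_chain /star_right /extend !liftU /mult_labelled scalerDr.
by rewrite !scalerMnr.
Qed.

Lemma mult_chain_relator c : relator c -> mult_chain c = 0.
Proof.
move=> Rc; rewrite mult_chainE !star_right_relator ?mul0rn ?addr0 //.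
  exact: is_graph_tripod.
exact: is_graph_cross.
Qed.

Definition mult : D_e R -> D_e R := descend (fun g => mult_labelled (drawing g)).

Lemma mult_class c : mult (graph_class c) = mult_chain c.
Proof. exact: descend_class mult_chain_relator c. Qed.

Lemma mult_is_linear : linear mult.
Proof. exact: descend_is_linear mult_chain_relator. Qed.
HB.instance Definition _ := GRing.isLinear.Build R (D_e R) (D_e R) *:%R
  mult mult_is_linear.

(** The terms with [vee] occur [4 * 3] times with each sign, whatever [y] is. A [y] with an internal
    loop is set apart, because the contraction formula does not apply to it and both sides are 0. *)
Lemma coboundary_mult_labelled n p q (y : labelled n p q) : is_graph y ->
  coboundary (mult_labelled y) = mult_chain (labelled_coboundary R y).
Proof.
move=> gy; have [ly|ly] := boolP (has_internal_loop y).
  by rewrite /labelled_coboundary ly raddf0 /mult_labelled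
    !star_internal_loop ?ly ?orbT // !mul0rn addr0 raddf0.
rewrite mult_chainE raddfD !raddfMn /= coboundary_star_cross // coboundary_star_tripod //.
have cancel (V : zmodType) (v a b : V) :
    (v *+ 4 + a) *+ 3 + (- v *+ 3 + b) *+ 4 = a *+ 3 + b *+ 4.
  rewrite (mulrnDl 3 (v *+ 4)) (mulrnDl 4 (- v *+ 3)) addrACA -!mulrnA (mulnC 4).
  by rewrite mulNrn subrr add0r.
exact: cancel.
Qed.

Lemma coboundary_mult x : coboundary (mult x) = mult (coboundary x).
Proof.
have [c <-] := graph_class_surj x.
rewrite coboundary_class !mult_class -(freeg_sumE c) !raddf_sum /=.
apply: eq_bigr => g _; rewrite /chain_coboundary /mult_chain /extend !liftU.
rewrite -[fglift _ _]/(mult_chain _) !linearZ /=.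
rewrite coboundary_mult_labelled //; exact: (valP g).
Qed.
End Multiplication.

(** * The determinant of the incidence matrix *)

Section Detection.
Variable R : realType.

(** Internal vertices have no row. Adding the two ends makes the entry independent of their order,
    with 2 for an external small loop. *)
Definition incidence n p q (E : endpoints n p q) : 'M[R]_(n, q) :=
  \matrix_(i, a) (((E a).1 == inl i) + ((E a).2 == inl i))%:R.

(* The matrix of a graph with as many edges as external vertices is cast to a
   square one; [conform_mx] only keeps matrices of the right size. *)
Definition incidence_det n p q (x : labelled n p q) : R^o :=
  if n == q then \det (conform_mx (0 : 'M_n) (incidence (ends x))) else 0.

Lemma incidence_detE n p (x : labelled n p n) :
  incidence_det x = \det (incidence (ends x)).
Proof. by rewrite /incidence_det eqxx conform_mx_id. Qed.

Lemma incidence_det_neq n p q (x : labelled n p q) :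
  n != q -> incidence_det x = 0.
Proof. by rewrite /incidence_det => /negPf ->. Qed.

Lemma incidence_det_isomorphic n p q (x y : labelled n p q) :
  isomorphic x y -> incidence_det y = incidence_det x.
Proof.
case=> _ [k xy]; rewrite /incidence_det (_ : incidence (ends y) = incidence (ends x)) //.
apply/matrixP=> i a; rewrite !mxE; congr (_%:R).
have renumber_inl (v : vertex n p) : (renumber_int k v == inl i) = (v == inl i).
  by case: v.
by case/orP: (xy a) => /eqP ->; rewrite /= !renumber_inl // addnC.
Qed.

Lemma incidence_det_relabel_ext n p q (s : 'S_n) (x : labelled n p q) :
  incidence_det (relabel_ext s x) = (-1) ^+ s * incidence_det x.
Proof.
have [E|neq] := eqVneq n q; last by rewrite !incidence_det_neq ?mulr0.
subst q; rewrite !incidence_detE.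
rewrite (_ : incidence _ = row_perm s^-1%g (incidence (ends x))).
  by rewrite row_permE det_mulmx det_perm odd_permV.
apply/matrixP=> i a; rewrite !mxE ffunE; congr (_%:R).
have renumber_inl (v : vertex n p) :
    (renumber_ext s v == inl i) = (v == inl (s^-1%g i)).
  case: v => //= w; rewrite -[i in LHS](permKV s).
  by rewrite !(inj_eq (@inl_inj _ _)) (inj_eq perm_inj).
by rewrite /= !renumber_inl.
Qed.

Lemma incidence_det_relabel_edges n p q (s : 'S_q) (x : labelled n p q) :
  incidence_det (relabel_edges s x) = (-1) ^+ s * incidence_det x.
Proof.
have [E|neq] := eqVneq n q; last by rewrite !incidence_det_neq ?mulr0.
subst q; rewrite !incidence_detE.
rewrite (_ : incidence _ = col_perm s (incidence (ends x))).
  by rewrite col_permE det_mulmx det_perm odd_permV mulrC.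
by apply/matrixP=> i a; rewrite !mxE ffunE.
Qed.

(** Parallel edges have equal columns. *)
Lemma incidence_det_multiple n p q (x : labelled n p q) :
  has_multiple_edge x -> incidence_det x = 0.
Proof.
have [E|neq] := eqVneq n q; last by rewrite incidence_det_neq.
subst q; case/existsP=> a /existsP[b /andP[neq same]].
rewrite incidence_detE -det_tr; apply: (determinant_alternate neq) => i.
rewrite !mxE; congr (_%:R).
by case/orP: same => /eqP ->; rewrite //= addnC.
Qed.

(** An edge without external end has a zero column. *)
Lemma incidence_det_loop n p q (x : labelled n p q) :
  has_internal_loop x -> incidence_det x = 0.
Proof.
have [E|neq] := eqVneq n q; last by rewrite incidence_det_neq.
subst q; case/existsP=> a /existsP[v /eqP Ea].
rewrite incidence_detE (expand_det_col _ a) big1 // => i _.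
by rewrite mxE Ea mul0r.
Qed.

Lemma incidence_det_equal_rows n p q (x : labelled n p q) (i j : 'I_n) :
  i != j ->
  (forall a, (((ends x a).1 == inl i) + ((ends x a).2 == inl i) =
              ((ends x a).1 == inl j) + ((ends x a).2 == inl j))%N) ->
  incidence_det x = 0.
Proof.
move=> neq Eij; have [E|neq'] := eqVneq n q; last by rewrite incidence_det_neq.
subst q; rewrite incidence_detE; apply: (determinant_alternate neq) => a.
by rewrite !mxE Eij.
Qed.

Definition detect_chain : {freeg graph / R} -> R^o :=
  extend (fun g => incidence_det (drawing g)).
HB.instance Definition _ := GRing.Linear.on detect_chain.

Lemma detect_basis n p q (x : labelled n p q) :
  is_graph x -> detect_chain (basis_vector R x) = incidence_det x.
Proof. exact: (@extend_basis_vector R _ (fun n p q x => incidence_det x)). Qed.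

Lemma detect_relator c : relator c -> detect_chain c = 0.
Proof.
case=> [n p q y z gy gz yz|n p q y u gy|n p q y u gy|
        n p q y gy my|n p q y gy ly].
- by rewrite raddfB /= !detect_basis // (incidence_det_isomorphic yz) subrr.
- rewrite raddfB /= linearZ /= !detect_basis ?is_graph_relabel_ext //.
  by rewrite incidence_det_relabel_ext subrr.
- rewrite raddfB /= linearZ /= !detect_basis ?is_graph_relabel_edges //.
  by rewrite incidence_det_relabel_edges subrr.
- by rewrite detect_basis // incidence_det_multiple.
- by rewrite detect_basis // incidence_det_loop.
Qed.

Definition detect : D_e R -> R^o :=
  descend (fun g => incidence_det (drawing g)).

Lemma detect_class c : detect (graph_class c) = detect_chain c.
Proof. exact: descend_class detect_relator c. Qed.

Lemma detect_is_linear : linear detect.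
Proof. exact: descend_is_linear detect_relator. Qed.
HB.instance Definition _ := GRing.isLinear.Build R (D_e R) R^o *:%R
  detect detect_is_linear.

Lemma detect_drawing_class n p q (x : labelled n p q) :
  is_graph x -> detect (drawing_class R x) = incidence_det x.
Proof. by move=> gx; rewrite /drawing_class detect_class detect_basis. Qed.

(** For words on distinct letters, not both empty, this is the number of cyclic shuffles up to
    rotation. *)
Definition shuffle_weight n (ca cb : seq 'I_n) : R :=
  (size (ca ++ cb))%:R^-1 *
    \sum_(c <- permutations (ca ++ cb) | cyclic_shuffle ca cb c) 1.

(** The determinant does not see the circle, for which [[::]] is a mere placeholder; every shuffle
    thus has the same value. *)
Lemma detect_star r s t n p q (x : labelled r s t) (y : labelled n p q) :
  is_graph x -> is_graph y ->
  detect (star R x y) = (-1) ^+ (t * n) *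
    (shuffle_weight (map (lshift n) (circle x)) (map (@rshift r n) (circle y)) *
     incidence_det (([::], union_ends (ends x) (ends y)) :
                      labelled (r + n) (s + p) (t + q))).
Proof.
move=> gx gy; rewrite /star linearZ /=; congr (_ * _).
rewrite /shuffle_class linearZ /= raddf_sum /= /shuffle_weight -[LHS]/(_ * _).
rewrite -mulrA; congr (_ * _); rewrite mulr_suml big_seq_cond [RHS]big_seq_cond.
apply: eq_bigr => c; rewrite mem_permutations mul1r => /andP[pc _].
rewrite detect_drawing_class //; apply: is_graph_union => //.
exact: perm_trans pc (perm_eq_union gx gy).
Qed.

(** The ends 0 and 2 of the first chord meet no other edge, so their rows coincide. *)
Lemma detect_star_cross n p q (y : labelled n p q) :
  is_graph y -> detect (star R cross y) = 0.
Proof.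
move=> gy; rewrite detect_star ?is_graph_cross //.
rewrite (@incidence_det_equal_rows _ _ _ _ (lshift n (@Ordinal 4 0 isT))
  (lshift n (@Ordinal 4 2 isT))) ?mulr0 // => a.
rewrite [ends _ _]/= -(splitK a); case: (split a) => b /=.
  rewrite union_ends_lshift ffunE; by case: ifP.
by rewrite union_ends_rshift; case: (ends y b) => [[?|?] [?|?]].
Qed.

(** The matrix is block diagonal, and its first block is the identity since leg [a] has the external
    vertex [a] as its only external end. *)
Lemma incidence_det_tripod n p q (y : labelled n p q) c :
  incidence_det ((c, union_ends (ends tripod) (ends y)) :
    labelled (3 + n) (1 + p) (3 + q)) = incidence_det y.
Proof.
have [E|neq] := eqVneq n q; last by rewrite !incidence_det_neq ?eqn_add2l.
subst q; rewrite !incidence_detE.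
rewrite (_ : incidence _ = block_mx 1%:M 0 0 (incidence (ends y))).
  by rewrite det_ublock det1 mul1r.
apply/matrixP=> i a; rewrite -(splitK i) -(splitK a).
case: (split i) (split a) => {}i [] {}a; rewrite [unsplit _]/= [unsplit _]/=.
- rewrite block_mxEul !mxE union_ends_lshift ffunE /= addn0.
  by congr (_%:R); rewrite eq_sym.
- rewrite block_mxEur !mxE union_ends_rshift /=.
  have neq v : (right_vertex 3 1 v == inl (lshift n i)) = false.
    case: v => // w; apply: etrans (_ : (rshift 3 w == lshift n i) = false) => //.
    exact: eq_rlshift.
  by rewrite !neq.
- rewrite block_mxEdl !mxE union_ends_lshift ffunE /= addn0.
  by rewrite -[_ == _]/(lshift n a == rshift 3 i) eq_lrshift.
- rewrite block_mxEdr !mxE union_ends_rshift /=; congr (_%:R).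
  have eqv v : (right_vertex 3 1 v == inl (rshift 3 i)) = (v == inl i).
    by case: v => // w; exact: (inj_eq (@rshift_inj 3 n)).
  by rewrite !eqv.
Qed.

(** Relabelling the right letters carries the shuffles with one circular order to those with
    another. The weight therefore depends only on [n] and can leave a sum over graphs. *)
Lemma shuffle_weight_invariant r n (cx : seq 'I_r) (cy : seq 'I_n) :
  perm_eq cy (enum 'I_n) ->
  shuffle_weight (map (lshift n) cx) (map (@rshift r n) cy) =
  shuffle_weight (map (lshift n) cx) (map (@rshift r n) (enum 'I_n)).
Proof.
move=> py; have uy : uniq cy by rewrite (perm_uniq py) enum_uniq.
have sy : size cy = n by rewrite (perm_size py) size_enum_ord.
have nth_inj : injective (fun i : 'I_n => nth i cy i).
  move=> i j; rewrite (set_nth_default i) ?sy // => /eqP.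
  by rewrite nth_uniq ?sy // => /eqP/val_inj.
have cyE : cy = map (perm nth_inj) (enum 'I_n).
  (* Comparing words letter by letter takes a default letter, hence the separate case of the empty
     circle. *)
  case: (n) cy {py uy} sy nth_inj => [|m] c sc c_inj.
    apply: etrans (size0nil sc) (esym (size0nil _)).
    by rewrite size_map size_enum_ord.
  apply: (@eq_from_nth _ ord0); first by rewrite size_map size_enum_ord.
  move=> k; rewrite sc => lt_k; rewrite (nth_map ord0) ?size_enum_ord // permE.
  by rewrite nth_enum_ord //; apply: set_nth_default; rewrite sc.
rewrite [in LHS]cyE.
have -> : map (@rshift r n) (map (perm nth_inj) (enum 'I_n)) =
    map (block_perm 1 (perm nth_inj)) (map (@rshift r n) (enum 'I_n)).
  by rewrite -!map_comp; apply: eq_map => i /=; rewrite block_perm_rshift.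
have {1}-> : map (lshift n) cx = map (block_perm 1 (perm nth_inj)) (map (lshift n) cx).
  by rewrite -map_comp; apply: eq_map => i /=; rewrite block_perm_lshift perm1.
rewrite /shuffle_weight big_cyclic_shuffle_map -map_cat size_map.
by [].
Qed.

(** The concatenated word is a shuffle, so the sum is at least 1; a nonempty [cx] keeps the divisor
    away from 0. *)
Lemma shuffle_weight_gt0 r n (cx : seq 'I_r.+1) (cy : seq 'I_n) :
  cx != [::] -> 0 < shuffle_weight (map (lshift n) cx) (map (@rshift r.+1 n) cy).
Proof.
move=> cx0; set ca := map _ cx; set cb := map _ cy.
have disj : forall i, i \in ca -> i \notin cb.
  move=> _ /mapP[a _ ->]; apply/mapP=> -[b _ /eqP]; by rewrite eq_lrshift.
rewrite mulr_gt0 // ?invr_gt0 ?ltr0n ?size_cat ?size_map.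
  by case: cx cx0 @ca disj.
rewrite (big_rem (ca ++ cb)) /=; last by rewrite mem_permutations.
have -> : cyclic_shuffle ca cb (ca ++ cb).
  have E1 : filter (mem ca) (ca ++ cb) = ca.
    rewrite filter_cat (_ : filter (mem ca) cb = [::]) ?cats0.
      by apply/all_filterP/allP.
    apply/eqP; rewrite -(negbK (_ == _)) -has_filter; apply/hasPn=> i icb.
    by apply/negP=> /disj; rewrite icb.
  have E2 : filter (mem cb) (ca ++ cb) = cb.
    rewrite filter_cat (_ : filter (mem cb) ca = [::]).
      by apply/all_filterP/allP.
    by apply/eqP; rewrite -(negbK (_ == _)) -has_filter; apply/hasPn.
  by rewrite /cyclic_shuffle E1 E2 !same_cycle_refl.
by rewrite ltr_wpDr // sumr_ge0.
Qed.

Definition mult_weight n : R :=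
  (-1) ^+ (3 * n) *
    shuffle_weight (map (lshift n) (circle tripod)) (map (@rshift 3 n) (enum 'I_n)) *+ 4.

Lemma mult_weight_neq0 n : mult_weight n != 0.
Proof.
rewrite /mult_weight -mulr_natr; apply: mulf_neq0; last by rewrite pnatr_eq0.
apply: mulf_neq0; first by rewrite signr_eq0.
by rewrite gt_eqF //; apply: (@shuffle_weight_gt0 2 n).
Qed.

Lemma detect_mult_labelled n p q (y : labelled n p q) : is_graph y ->
  detect (mult_labelled R y) = mult_weight n * incidence_det y.
Proof.
move=> gy; rewrite /mult_labelled raddfD !raddfMn /= detect_star_cross // mul0rn add0r.
rewrite detect_star ?is_graph_tripod // incidence_det_tripod.
rewrite shuffle_weight_invariant; last by case/and4P: gy.
by rewrite /mult_weight mulrnAl mulrA.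
Qed.

(** The factor depends on the number of external vertices, but the determinant only sees graphs with
    as many edges as external vertices. In order [2k] and degree 0 these have [k] internal and [3k]
    external vertices, so the factor is constant. *)
Lemma detect_mult k x : x \in bigraded (2 * k%:Z) 0 ->
  detect (mult x) = mult_weight (3 * k) * detect x.
Proof.
case/asboolP=> c /allP hc <-; rewrite mult_class !detect_class -(freeg_sumE c).
rewrite !raddf_sum /= mulr_sumr big_seq [RHS]big_seq; apply: eq_bigr => g gc.
have /andP[/eqP og /eqP dg] := hc g gc.
rewrite /mult_chain /detect_chain /extend !liftU linearZ /=.
rewrite detect_mult_labelled; last exact: (valP g).
rewrite -[LHS]/(coeff g c * _) -[X in _ = _ * X]/(coeff g c * _) mulrCA.
have [E|neq] := eqVneq (n_ext g) (n_edges g); last first.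
  by rewrite incidence_det_neq // !mulr0.
suff -> : (3 * k)%N = n_ext g by [].
by move: og dg; rewrite /order_of /degree_of; lia.
Qed.
End Detection.

(** * The powers and their bidegree *)

Section MultBigraded.
Variable R : realType.

Lemma drawing_class_bigraded n p q (x : labelled n p q) :
  drawing_class R x \in bigraded (q%:Z - p%:Z) (2 * q%:Z - n%:Z - 3 * p%:Z).
Proof.
by apply/asboolP; exists (basis_vector R x); first exact: homogeneous_basis_vector.
Qed.

Lemma star_bigraded k m r s t n p q (x : labelled r s t) (y : labelled n p q) :
  (t + q)%:Z - (s + p)%:Z = k ->
  2 * (t + q)%:Z - (r + n)%:Z - 3 * (s + p)%:Z = m ->
  star R x y \in bigraded k m.
Proof.
move=> <- <-; rewrite /star /shuffle_class !rpredZ // rpred_sum // => c _.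
exact: drawing_class_bigraded.
Qed.

(** Both [cross] (4 external vertices, 2 edges) and [tripod] (3 external, 1 internal, 3 edges) have
    order 2 and degree 0, and both gradings are additive. *)
Lemma mult_bigraded k m (x : D_e R) :
  x \in bigraded k m -> mult x \in bigraded (k + 2) m.
Proof.
case/asboolP=> c /allP hc <-; rewrite mult_class -(freeg_sumE c) raddf_sum /=.
rewrite big_seq rpred_sum // => g gc.
have /andP[/eqP og /eqP dg] := hc g gc.
rewrite /mult_chain /extend liftU rpredZ // /mult_labelled rpredD // rpredMn //;
  apply: star_bigraded; move: og dg; rewrite /order_of /degree_of; lia.
Qed.

Lemma degree_of_ge0 (g : graph) : 0 <= degree_of g.
Proof.
have gg : is_graph (drawing g) := valP g; rewrite /degree_of; move: gg.
move: (n_ext g) (n_int g) (n_edges g) (drawing g) => n p q x.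
case/and4P=> _ /forallP vi /forallP ve _.
have total : (\sum_v valence x v = 2 * q)%N.
  rewrite /valence exchange_big /= (eq_bigr (fun=> 2%N)).
    by rewrite sum_nat_const card_ord mulnC.
  move=> a _; rewrite big_split /=.
  have one (w : vertex n p) : (\sum_v (w == v) = 1)%N.
    rewrite (bigD1 w) //= eqxx big1 // => v neq.
    by rewrite eq_sym (negPf neq).
  by rewrite !one.
have : (n + 3 * p <= 2 * q)%N.
  rewrite -total big_sumType /=; apply: leq_add.
    rewrite -[X in (X <= _)%N](card_ord n) -sum1_card; exact: leq_sum.
  rewrite mulnC -[X in (X * _ <= _)%N](card_ord p) -sum_nat_const; exact: leq_sum.
by lia.
Qed.

Lemma bigraded_negative k m (x : D_e R) : m < 0 -> x \in bigraded k m -> x = 0.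
Proof.
move=> m_lt0 /asboolP[c /allP hc <-]; suff -> : c = 0 by rewrite raddf0.
rewrite -(freeg_sumE c) big_seq big1 // => g /hc /andP[_ /eqP dg].
by have := degree_of_ge0 g; rewrite dg leNgt m_lt0.
Qed.

(** The unit of the shuffle product; starting the powers here covers order 0, where the empty
    incidence matrix has determinant 1. *)
Definition bare_circle : labelled 0 0 0 := ([::], ffun0 (card_ord 0)).

Lemma is_graph_bare_circle : is_graph bare_circle.
Proof.
apply/and4P; split; try by apply/forallP=> -[].
by rewrite (size0nil (size_enum_ord 0)).
Qed.

Lemma coboundary_bare_circle : coboundary (drawing_class R bare_circle) = 0.
Proof.
rewrite coboundary_class chain_coboundary_basis_vector ?is_graph_bare_circle //.
by rewrite /labelled_coboundary; case: ifP; rewrite /= ?addr0 raddf0.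
Qed.

Definition power k : D_e R := iter k (@mult R) (drawing_class R bare_circle).

Lemma power_bigraded k : power k \in bigraded (2 * k%:Z) 0.
Proof.
elim: k => [|k IH]; first exact: (drawing_class_bigraded bare_circle).
rewrite (_ : 2 * k.+1%:Z = 2 * k%:Z + 2); last by lia.
exact: mult_bigraded IH.
Qed.

Lemma coboundary_power k : coboundary (power k) = 0.
Proof.
elim: k => [|k IH]; first exact: coboundary_bare_circle.
by rewrite /power iterS coboundary_mult -/(power k) IH raddf0.
Qed.

Lemma detect_power_neq0 k : detect (power k) != 0.
Proof.
elim: k => [|k IH].
  rewrite [power 0]/= detect_drawing_class ?is_graph_bare_circle //.
  by rewrite incidence_detE det_mx00 oner_eq0.
rewrite /power iterS -/(power k) (detect_mult (power_bigraded k)).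
by apply: mulf_neq0; first exact: mult_weight_neq0.
Qed.

Lemma power_is_cocycle k : power k \in is_cocycle (2 * k%:Z) 0.
Proof. by rewrite inE power_bigraded coboundary_power eqxx. Qed.
End MultBigraded.

Theorem proposition4p1 (R : realType) (k : nat) :
  exists h : cohomology R (2 * k%:Z) 0, h != 0.
Proof.
exists (\pi_(quot_mod (@is_coboundary R (2 * k%:Z) 0))
  (Cocycle (power_is_cocycle R k)))%qT.
rewrite pi_quot_eq0; apply/asboolP=> -[y by_ /= dy].
have y0 : y = 0 by apply: bigraded_negative by_; rewrite sub0r oppr_lt0.
by have := detect_power_neq0 R k; rewrite -dy y0 !raddf0 eqxx.
Qed.
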